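(* Let $$\mathbb{G}(r):=\liminf_{m\to\infty}\mathbb{P}\left(\frac{T_m}{2^{-5/2}m^{3/2}}>r\right),$$ where $T_m$ is the coalescence time of the two semi-infinite geodesics in direction $(1,1)$ started at $(m,0)$ and $(0,m)$ in exponential last-passage percolation on $\mathbb{Z}^2$. There exist constants $c_0,r_0>0$ such that for all $r\in[0,r_0]$, $$\mathbb{G}(r)\ge 1-c_0r^2.$$ In particular, $\lim_{r\to0}\mathbb{G}(r)=1$.
   Context: Notation: $\mathbf e_1=(1,0)$, $\mathbf e_2=(0,1)$, $\mathbf 0=(0,0)$; for $\mathbf x,\mathbf y\in\mathbb{Z}^2$, $\mathbf x\le \mathbf y$ means $x(i)\le y(i)$ for $i=1,2$. Last-passage percolation. Let $\omega=\{W_{\mathbf x}:\mathbf x\in\mathbb{Z}^2\}$ be i.i.d. exponential random variables of parameter $1$. For $\mathbf x\le\mathbf y$, let $\Gamma(\mathbf x,\mathbf y)$ be the set of up-right paths $\gamma=(\mathbf x_0,\dots,\mathbf x_k)$ with $\mathbf x_0=\mathbf x$, $\mathbf x_k=\mathbf y$, $\mathbf x_{j+1}-\mathbf x_j\in\{\mathbf e_1,\mathbf e_2\}$. Put $W(\gamma)=\sum_{j=1}^k W_{\mathbf x_j}$ and $L(\mathbf x,\mathbf y)=\max_{\gamma\in\Gamma(\mathbf x,\mathbf y)}W(\gamma)$. The geodesic $\gamma(\mathbf x,\mathbf y)$ is the a.s. unique maximizing path. Coalescence time. It is known that a.s., for each $\mathbf x\in\mathbb{Z}^2$ there is a unique semi-infinite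 up-right path $\gamma(\mathbf x)=(\mathbf x_n)_{n\ge0}$ such that (i) $\mathbf x_0=\mathbf x$ and $\gamma(\mathbf x_k,\mathbf x_n)=(\mathbf x_k,\dots,\mathbf x_n)$ for all $k<n$; (ii) for every sequence of lattice points $\mathbf y_n\ge\mathbf 0$ with $|\mathbf y_n|\to\infty$ and $y_n(2)/y_n(1)\to1$, $\gamma(\mathbf x,\mathbf x+\mathbf y_n)\to\gamma(\mathbf x)$ (on each finite set $K\subseteq \mathbb{Z}^2$ the paths eventually coincide). It is also known that a.s. (iii) for all $\mathbf x,\mathbf y$ there is $\mathbf c\in\mathbb{Z}^2$ such that $\gamma(\mathbf x)$ is the concatenation of $\gamma(\mathbf x,\mathbf c)$ and $\gamma(\mathbf c)$, and $\gamma(\mathbf y)$ is the concatenation of $\gamma(\mathbf y,\mathbf c)$ and $\gamma(\mathbf c)$. Let $\mathbf c(\mathbf x,\mathbf y)$ be the first such point, i.e. the one with $\mathbf c'\ge\mathbf c(\mathbf x,\mathbf y)$ for every other $\mathbf c'$ satisfying (iii). For $m\ge1$, $T_m$ is the second coordinate of $\mathbf c((m,0),(0,m))$. *)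

(* Defs.v *)
(* Exponential last-passage percolation on Z^2, over MathComp-Analysis. *)
From HB Require Import structures.
From mathcomp Require Export all_boot all_order all_algebra.
From mathcomp Require Export all_classical all_reals all_analysis.
Export Order.TTheory GRing.Theory Num.Theory.
Export numFieldNormedType.Exports.

Set Implicit Arguments.
Unset Strict Implicit.
Unset Printing Implicit Defensive.

Local Open Scope classical_set_scope.
Local Open Scope ring_scope.

Definition site : Type := (int * int)%type.

Definition le_site (x y : site) : bool := (x.1 <= y.1) && (x.2 <= y.2).

Definition e1 : site := (1, 0).
Definition e2 : site := (0, 1).

Definition up_right (x y : site) : bool := (y - x == e1) || (y - x == e2).

(* As in [path.v], the path (x_0, ..., x_k) with x_0 = x is represented by its
   tail s = [:: x_1; ...; x_k]; its set of sites is x :: s. *)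
Definition lpp_paths (x y : site) : set (seq site) :=
  [set s | path up_right x s /\ last x s = y].

Section LastPassage.
Variable R : realType.
Implicit Types (w : site -> R) (x y c : site) (s : seq site) (g : nat -> site).

(* The weight of the starting site x_0 does not contribute. *)
Definition path_weight w s : R := \sum_(z <- s) w z.

(* The set of paths is finite, and nonempty when x <= y, so that this supremum
   is then a maximum. *)
Definition last_passage_time w x y : R :=
  sup [set path_weight w s | s in lpp_paths x y].

Definition maximizing_path w x y s : Prop :=
  lpp_paths x y s /\ path_weight w s = last_passage_time w x y.

Definition is_geodesic w x y s : Prop := unique (maximizing_path w x y) s.

(* The tail of (g j, ..., g k), for j <= k. *)
Definition segment g (j k : nat) : seq site :=
  [seq g i | i <- index_iota j.+1 k.+1].

Definition diagonal_sequence (v : nat -> site) : Prop :=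
  [/\ forall n, le_site 0 (v n),
      ((`|(v n).1| + `|(v n).2|)%:~R : R) @[n --> \oo] --> +oo &
      (((v n).2)%:~R / ((v n).1)%:~R : R) @[n --> \oo] --> (1 : R)].

(* g is the semi-infinite geodesic in direction (1,1) started at x. At most one
   g qualifies: the last clause determines the sites visited by g, hence g. *)
Definition is_semi_infinite_geodesic w x g : Prop :=
  [/\ g 0%N = x,
      forall n, up_right (g n) (g n.+1),
      forall k n, (k < n)%N -> is_geodesic w (g k) (g n) (segment g k n) &
      forall v, diagonal_sequence v ->
        forall K : seq site, \forall n \near \oo,
          exists2 s, is_geodesic w x (x + v n) s &
            forall z, z \in K -> (z \in x :: s) <-> (exists i, g i = z)].

(* gx is the concatenation of the geodesic from x to c and of gc. *)
Definition is_concatenation w x c gx gc : Prop :=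
  exists2 k, is_geodesic w x c (segment gx 0 k) &
    forall n, gc n = gx (k + n)%N.

Definition coalesce_at w x y c : Prop :=
  exists gx gy gc,
    [/\ is_semi_infinite_geodesic w x gx, is_semi_infinite_geodesic w y gy,
        is_semi_infinite_geodesic w c gc,
        is_concatenation w x c gx gc & is_concatenation w y c gy gc].

Definition first_coalescence_points w x y : set site :=
  [set c | coalesce_at w x y c /\
           forall c', coalesce_at w x y c' -> le_site c c'].

(* The first coalescence point is unique whenever it exists, which happens
   almost surely under i.i.d. exponential weights; the value (0, 0) is a
   placeholder on the exceptional null set. *)
Definition coalescence_point w x y : site :=
  xget (0, 0) (first_coalescence_points w x y).

Definition coalescence_time w (m : nat) : int :=
  (coalescence_point w (m%:Z, 0) (0, m%:Z)).2.

End LastPassage.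

Section Probability.
Context d (Omega : measurableType d) (R : realType).
Variable P : probability Omega R.
Local Open Scope ereal_scope.

Definition mutually_independent (I : eqType) (X : I -> {RV P >-> R}) : Prop :=
  forall (J : seq I) (B : I -> set R),
    uniq J -> (forall i, measurable (B i)) ->
    P (\bigcap_(i in [set` J]) (X i @^-1` B i)) =
    \prod_(i <- J) P (X i @^-1` B i).

(* Equality of laws is only meaningful on Borel sets: a measure is a function
   on all sets, unspecified outside the sigma-algebra. *)
Definition iid_exponential (X : site -> {RV P >-> R}) : Prop :=
  mutually_independent X /\
  forall x (B : set R), measurable B ->
    distribution P (X x) B = exponential_prob (1%R : R) B.

(* The lower limit of P (T m / (2^(-5/2) m^(3/2)) > r) as m tends to oo. *)
Definition liminf_tail (T : nat -> {RV P >-> R}) (r : R) : \bar R :=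
  limn_einf (fun m : nat =>
    P [set o | (r < T m o / (2 `^ (- (5 / 2)) * m%:R `^ (3 / 2)))%R]).

End Probability.

(* Main.v *)
(** Seen from a far corner, last-passage percolation is the corner growth
    recursion [g]; with independent exponential boundary weights of rates 1/2 - t
    and 1/2 + t its increments are stationary (Burke).  A moment computation
    bounds the probability that the stationary geodesic leaves the boundary on
    the unexpected side, and comparison with the stationary models for small
    t and - t shows that, along cones around the direction (1,1), the differences
    [dif] between the last-passage times from y + e2 and y + e1 converge.  Their
    limits are a.s. nonzero, by resampling one weight, and their signs give the
    steps of the semi-infinite geodesics, here called rays.

    Two sites of an antidiagonal cannot both have ancestors (sites whose ray
    passes through them) at all depths: the difference between the best weights
    through the two sites converges, in the cones around (1,1) and (-1,-1), to an
    a.s. nonzero limit whose sign decides between them.  By translation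
    invariance no site has ancestors at all depths, and counting the distinct
    rays issued from a long antidiagonal segment shows that adjacent rays meet.

    Finally T_m > n as soon as the ray from (m,0) does not leave the box
    [.., n]^2 through its northern side, nor the ray from (0,m) through its
    eastern side.  By the exit estimate in a stationary model with parameter of
    order m / n, each of these events has probability at most
    exp (- m^3 / (2304 (n+1)^2)) <= 2304 (n+1)^2 / m^3, which is of order r^2
    for n of order r m^(3/2). *)

(* No infinite-volume stationary process is constructed. Every stationary model lives on the given
   weights: those on the two axes beyond a far corner are divided by the boundary rates, so that
   models of all parameters share their bulk and are ordered in the parameter. The limits of [dif]
   are not identified in law either; being Cauchy and nonzero is enough to define the rays.
   Convergence is stated in cones because uncountably many sequences have direction (1,1) and one
   almost sure event must serve them all. The price is paid in the argument on ancestors: limits say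
   nothing outside cones, so ancestors must first be shown to lie in a cone at arbitrarily large
   depths. The cubes arise as follows. The exponent of the exit bound is the square of a tilt eta
   times a term of order t m, where t measures the mismatch between parameter and direction, and
   this term keeps its sign as long as eta is at most of order t. This gives t^3 m; with t of order
   (n - m) / n it becomes (n - m)^3 / n^2. *)
From HB Require Import structures.
Require Import Defs.
From mathcomp Require Import ring lra zify.
From mathcomp Require Import measurable_realfun exponential_distribution charge lebesgue_integral_fubini.

Set Implicit Arguments.
Unset Strict Implicit.
Unset Printing Implicit Defensive.

Local Open Scope classical_set_scope.
Local Open Scope ring_scope.

(** * Exponential laws *)

(* The library also equips R with the structure [measurableTypeR R], which has
   the same sigma-algebra but another display. *)
Notation mR R := (Real_sort__canonical__measurable_structure_Measurable R).

Section Law.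
Context d d' (T : measurableType d) (T' : measurableType d').

Definition mfun_of (f : T -> T') (mf : measurable_fun setT f) : {mfun T >-> T'} :=
  HB.pack f (isMeasurableFun.Build _ _ _ _ f mf).

Context (R : realType) (P : probability T R).

Definition law (X : T -> T') (mX : measurable_fun setT X) : probability T' R :=
  distribution P (mfun_of mX).

Lemma lawE X (mX : measurable_fun setT X) A : law mX A = P (X @^-1` A).
Proof. by []. Qed.

End Law.

Section ExponentialLaw.
Context {R : realType}.
Implicit Types (l t x : R) (A : set R).

Definition exponential_probability l (l0 : 0 < l) : probability (measurableTypeR R) R.
Proof. by unshelve refine (exponential_prob l : probability _ _). Defined.

Lemma measurable_to_mR :
  measurable_fun [set: measurableTypeR R] (idfun : measurableTypeR R -> R).
Proof. by move=> _ A mA; rewrite setTI. Qed.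

Definition expo1 : probability (mR R) R :=
  law (exponential_probability ltr01) measurable_to_mR.

Lemma expo1E A : expo1 A = exponential_prob 1 A.
Proof. by []. Qed.

Definition scale_by (c : R) : R -> R := fun t => t * c.

Lemma measurable_scale_by c : measurable_fun [set: R] (scale_by c).
Proof. by apply: measurable_funM. Qed.

(* [expo 0] is the Dirac mass at 0, because 0^-1 = 0. *)
Definition expo l : probability (mR R) R :=
  law expo1 (@measurable_scale_by l^-1).

Lemma expoE l A : expo l A = expo1 (scale_by l^-1 @^-1` A).
Proof. by []. Qed.

(** Defining [expo] by scaling makes this an identity of preimages, valid for all [l] and [c]; it is
    what lets [iexp_reindex] rescale coordinates. *)
Lemma expo_scale l c A : expo l (scale_by c @^-1` A) = expo (l / c) A.
Proof.
rewrite !expoE; congr (expo1 _); apply/seteqP; split => x /=;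
  by rewrite /scale_by invf_div mulrAC -mulrA.
Qed.

Lemma exponential_prob_Ny0 l : exponential_prob l `]-oo, 0[ = 0%E.
Proof.
rewrite /exponential_prob integral0_eq// => x /=; rewrite in_itv/= => x0.
by rewrite lt0_exponential_pdf.
Qed.

Lemma exponential_prob_tail l t : 0 < l ->
  exponential_prob l `]t, +oo[ = (expR (- l * Num.max t 0))%:E.
Proof.
move=> l0; pose P := exponential_probability l0.
have PNy0 : P `]-oo, 0[%classic = 0%E by exact: exponential_prob_Ny0.
rewrite -[LHS]/(P _) -setCitvl probability_setC//.
suff -> : P `]-oo, t]%classic = (1 - (expR (- l * Num.max t 0))%:E)%E.
  by rewrite oppeB// addeA subee// add0e.
have [t0|t0] := leP t 0.
  rewrite mulr0 expR0 subee//; apply/eqP; rewrite eq_le measure_ge0 andbT.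
  have -> : 0%E = (P `]-oo, 0%R[%classic + P [set 0%R])%E.
    by rewrite PNy0 add0e -[RHS]/(\int[_]_(x in _) _)%E integral_set1.
  rewrite -measureU//; last first.
    by apply/seteqP; split => // x [/=]; rewrite in_itv/= => x0 xE; move: x0; rewrite xE ltxx.
  apply: le_measure; rewrite ?inE//; first exact: measurableU.
  move=> x /=; rewrite !in_itv/= => /le_trans/(_ t0).
  by rewrite le_eqVlt => /orP[/eqP ->|->]; [right|left].
rewrite -exponential_prob_itv0c// -[RHS]/(P _) -[RHS]add0e -PNy0 -measureU//.
  congr (P _); apply/seteqP; split => x /=; rewrite !in_itv/=.
    by move=> xt; case: (ltP x 0) => x0; [left|right].
  by move=> [x0|/andP[]//]; rewrite (le_trans (ltW x0))// ltW.
apply/seteqP; split => // x [/=]; rewrite !in_itv/=.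
by move=> x0 /andP[/le_lt_trans/(_ x0)]; rewrite ltxx.
Qed.

Lemma expo_tail l t : 0 < l -> expo l `]t, +oo[%classic = (expR (- l * Num.max t 0))%:E.
Proof.
move=> l0; rewrite expoE.
have -> : scale_by l^-1 @^-1` `]t, +oo[ = `]t * l, +oo[%classic.
  apply/seteqP; split => x /=; rewrite /scale_by !in_itv/= !andbT.
    by rewrite ltr_pdivlMr.
  by rewrite ltr_pdivlMr.
rewrite expo1E exponential_prob_tail//; congr (EFin (expR _)).
have -> : Num.max (t * l) 0 = Num.max t 0 * l.
  by rewrite -[X in Num.max _ X](mul0r l) maxr_pMl// ltW.
by rewrite mulNr mul1r mulrC mulNr.
Qed.

(** Half lines are stable under intersection and generate the Borel sets; those starting at [- n]
    exhaust the line. *)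
Lemma measure_tail_unique (m1 m2 : {measure set (mR R) -> \bar R}) :
  (forall t, m1 `]t, +oo[%classic < +oo)%E ->
  (forall t, m1 `]t, +oo[%classic = m2 `]t, +oo[%classic) -> forall A, measurable A -> m1 A = m2 A.
Proof.
move=> fin h A mA.
have mE : @measurable _ (mR R) = <<s @RGenOInfty.G R >>.
  exact: RGenOInfty.measurableE.
have setIG : setI_closed (@RGenOInfty.G R).
  move=> _ _ [x ->] [y ->]; exists (Num.max x y).
  by apply/seteqP; split => z /=; rewrite !in_itv/= !andbT gt_max; [move=> [-> ->]|move/andP].
apply: (measure_unique (@RGenOInfty.G R) (fun n => `](- n%:R), +oo[%classic)) => //.
- by move=> i; exists (- i%:R).
- apply/seteqP; split => // x _.
  have [n xn] : exists n : nat, `|x| < n%:R.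
    by exists (Num.bound `|x|); apply: archi_boundP; rewrite normr_ge0.
  exists n => //=; rewrite in_itv/= andbT.
  by move: xn; rewrite ltr_norml => /andP[].
- by move=> _ [x ->]; exact: h.
Qed.

Lemma expo_exponential_prob l A : 0 < l -> measurable A ->
  expo l A = exponential_prob l A.
Proof.
move=> l0 mA.
pose m2 : probability (mR R) R := law (exponential_probability l0) measurable_to_mR.
rewrite -[RHS]/(m2 A); apply: measure_tail_unique => // t.
  by rewrite -ge0_fin_numE// fin_num_measure.
apply: etrans (expo_tail t l0) _; apply/esym; exact: exponential_prob_tail.
Qed.

Lemma expo_set1 l t : 0 < l -> expo l [set t] = 0%E.
Proof. by move=> l0; rewrite expo_exponential_prob// /exponential_prob integral_set1. Qed.

Lemma expo_le0 l : 0 < l -> expo l `]-oo, 0]%classic = 0%E.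
Proof.
move=> l0; rewrite -setCitvr probability_setC// expo_tail//.
by rewrite maxxx mulr0 expR0 subee.
Qed.

End ExponentialLaw.

(** Change of variables holds for the Radon-Nikodym derivative of [nu]; having the same integrals
    over all measurable sets, [p] agrees with it [mu]-almost everywhere. *)
Lemma ge0_integral_density d (T : measurableType d) (R : realType)
    (mu : {sigma_finite_measure set T -> \bar R})
    (nu : {finite_measure set T -> \bar R}) (p : T -> R) (f : T -> \bar R) :
  measurable_fun setT p -> (forall x, 0 <= p x) ->
  (forall A, measurable A -> nu A = (\int[mu]_(x in A) (p x)%:E)%E) ->
  measurable_fun setT f -> (forall y, (0 <= f y)%E) ->
  (\int[nu]_x f x = \int[mu]_x (f x * (p x)%:E))%E.
Proof.
move=> mp p0 nuE mf f0.
have mpE : measurable_fun setT (EFin \o p) by exact/measurable_EFinP.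
have dom : nu `<< mu.
  apply/null_content_dominatesP => A mA A0; rewrite nuE//.
  apply: null_set_integral => //; exact: measurable_funTS.
rewrite -(Radon_Nikodym_SigmaFinite.change_of_variables dom f0)//.
set g := Radon_Nikodym_SigmaFinite.f nu mu.
have ig : mu.-integrable setT g by exact: Radon_Nikodym_SigmaFinite.f_integrable.
have mg : measurable_fun setT g by exact: measurable_int ig.
apply: ae_eq_integral => //; try exact: emeasurable_funM.
apply: ae_eqe_mul2l; apply: integral_ae_eq => // E _ mE.
by rewrite -nuE// -Radon_Nikodym_SigmaFinite.f_integral.
Qed.

Section ExpoIntegral.
Context {R : realType}.
Implicit Types (l x t : R) (F : R -> \bar R).
Local Notation mu := (@lebesgue_measure R).

Lemma ge0_integral_law d d' (T : measurableType d) (T' : measurableType d')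
    (P : probability T R) (X : T -> T') (mX : measurable_fun setT X)
    (f : T' -> \bar R) :
  measurable_fun setT f -> (forall y, (0 <= f y)%E) ->
  (\int[law P mX]_x f x = \int[P]_x f (X x))%E.
Proof. by move=> mf f0; rewrite ge0_integral_pushforward. Qed.

Lemma integral_expo l F : 0 < l ->
  measurable_fun setT F -> (forall x, (0 <= F x)%E) ->
  (\int[expo l]_x F x = \int[mu]_x (F x * (exponential_pdf l x)%:E))%E.
Proof.
move=> l0 mF F0.
have mF' : measurable_fun [set: measurableTypeR R] F.
  exact: (measurableT_comp mF (measurable_to_mR (R := R))).
transitivity (\int[law (exponential_probability l0) measurable_to_mR]_x F x)%E.
  apply: eq_measure_integral => A mA _.
  exact: expo_exponential_prob.
rewrite ge0_integral_law//.
apply: (ge0_integral_density (mu := mu) (p := exponential_pdf l)) => //.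
- by have := @measurable_exponential_pdf R l; move/(measurableT_comp); apply; exact: measurable_to_mR.
- by move=> x; rewrite exponential_pdf_ge0// ltW.
Qed.

(** Ratio of densities: on the positive half line, multiplying the density of rate [l] by
    [expR ((l - l') * t)] gives [l / l'] times the density of rate [l']. *)
Lemma expo_tilt l l' F : 0 < l -> 0 < l' ->
  measurable_fun setT F -> (forall x, (0 <= F x)%E) ->
  (\int[expo l]_t (F t * (expR ((l - l') * t))%:E) = (l / l')%:E * \int[expo l']_t F t)%E.
Proof.
move=> l0 l'0 mF F0.
have mE : measurable_fun setT (fun t => (expR ((l - l') * t))%:E).
  apply/measurable_EFinP; exact: measurableT_comp.
rewrite integral_expo//; last 2 first.
  exact: emeasurable_funM.
  by move=> x; rewrite mule_ge0// lee_fin expR_ge0.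
rewrite integral_expo// -ge0_integralZl//; first last.
- by rewrite lee_fin divr_ge0// ltW.
- by move=> x _; rewrite mule_ge0// lee_fin exponential_pdf_ge0// ltW.
- apply: emeasurable_funM.
    exact: (measurableT_comp mF (measurable_to_mR (R := R))).
  apply/measurable_EFinP.
  by have := @measurable_exponential_pdf R l'; move/(measurableT_comp); apply; exact: measurable_to_mR.
apply: eq_integral => x _.
have [x0|x0] := leP 0 x; last by rewrite !lt0_exponential_pdf// !mule0.
rewrite !exponential_pdfE// -muleA -EFinM [RHS]muleCA -EFinM; congr (_ * _%:E)%E.
rewrite mulrCA -expRD [RHS]mulrA divfK ?gt_eqF//; congr (_ * expR _).
by ring.
Qed.

(** Memorylessness for integrals: given that it exceeds [x], an exponential variable is distributed
    as [x] plus a fresh one, and [expR (m * x)] is the inverse of the probability of that event. *)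
Lemma expo_memoryless m x F : 0 < m -> 0 <= x ->
  measurable_fun setT F -> (forall x, (0 <= F x)%E) ->
  (\int[expo m]_t F (x + t)%R =
   (expR (m * x))%:E * \int[expo m]_(t in `]x, +oo[%classic) F t)%E.
Proof.
move=> m0 x0 mF F0.
have mx : measurable_fun setT (fun t : R => x + t) by apply: measurable_funD.
rewrite -(ge0_integral_law (expo m) mx mF F0).
pose p t := expR (m * x) * \1_(`]x, +oo[%classic) t.
rewrite (ge0_integral_density (mu := expo m) (p := p))//.
- rewrite -ge0_integralZl ?lee_fin ?expR_ge0//; last first.
    exact: measurable_funTS.
  rewrite [RHS]integral_mkcond; apply: eq_integral => t _.
  rewrite /p patchE indicE; case: ifPn => _; last by rewrite mulr0 mule0.
  by rewrite mulr1 muleC.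
- by apply: measurable_funM => //; exact: measurable_indic.
- by move=> t; rewrite mulr_ge0// expR_ge0.
move=> A mA.
have mI : measurable (`]x, +oo[%classic : set R) by [].
have k0 : 0 < expR (m * x) by exact: expR_gt0.
under eq_integral do rewrite /p EFinM.
rewrite ge0_integralZl ?lee_fin ?expR_ge0//; last first.
  by apply/measurable_EFinP; apply: measurable_funTS; exact: measurable_indic.
rewrite integral_indic// setIC.
(* Both sides are measures in [A], so it suffices to compare their tails. *)
pose nu : {measure set (mR R) -> \bar R} := mscale (NngNum (ltW k0)) (mrestr (expo m) mI).
rewrite -[RHS]/(nu A).
apply: (measure_tail_unique (m2 := nu)) => //.
  by move=> t; rewrite -ge0_fin_numE// fin_num_measure.
move=> t.
have tail1 : law (expo m) mx `]t, +oo[%classic = (expR (- m * Num.max (t - x) 0))%:E.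
  rewrite lawE -expo_tail//; congr (expo m _).
  by apply/seteqP; split => y /=; rewrite !in_itv/= !andbT ltrBlDl.
have -> : nu `]t, +oo[%classic = ((expR (m * x))%:E * expo m `]Num.max t x, +oo[%classic)%E.
  rewrite /nu/= /mscale/= /mrestr; congr (_ * expo m _)%E.
  apply/seteqP; split => z /=; rewrite !in_itv/= !andbT gt_max; [by move=> [-> ->]|by move/andP].
apply: etrans tail1 _; rewrite expo_tail// -EFinM -expRD; congr (EFin (expR _)).
have -> : Num.max (Num.max t x) 0 = Num.max t x by apply/max_idPl; rewrite le_max x0 orbT.
have -> : Num.max (t - x) 0 = Num.max t x - x by rewrite addr_maxl subrr.
by ring.
Qed.

End ExpoIntegral.

Section IteratedIntegrals.
Context d1 d2 (T1 : measurableType d1) (T2 : measurableType d2) (R : realType).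
Variables (P1 : probability T1 R) (P2 : probability T2 R).
Variable f : T1 -> T2 -> \bar R.
Hypothesis mf : measurable_fun setT (fun p : T1 * T2 => f p.1 p.2).
Hypothesis f0 : forall x y, (0 <= f x y)%E.

Lemma iterated_integralC :
  (\int[P1]_x \int[P2]_y f x y = \int[P2]_y \int[P1]_x f x y)%E.
Proof. exact: (fubini_tonelli (fun p => f p.1 p.2) mf (fun p => f0 p.1 p.2)). Qed.

Lemma measurable_inner_integral :
  measurable_fun setT (fun x => \int[P2]_y f x y)%E.
Proof. exact: (measurable_fun_fubini_tonelli_F (m2 := P2) (fun p => f p.1 p.2) mf (fun p => f0 p.1 p.2)). Qed.

Lemma measurable_section1 x : measurable_fun setT (f x).
Proof. exact: (measurableT_comp mf (pair1_measurable x)). Qed.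

End IteratedIntegrals.

Section Projections.
Context d0 d1 d2 (T0 : measurableType d0) (T1 : measurableType d1) (T2 : measurableType d2).
Variable h : T0 -> T1 * T2.
Hypothesis mh : measurable_fun setT h.

Lemma measurable_fun_proj1 : measurable_fun setT (fun x => (h x).1).
Proof. by have /measurable_fun_pairP[] := mh. Qed.

Lemma measurable_fun_proj2 : measurable_fun setT (fun x => (h x).2).
Proof. by have /measurable_fun_pairP[] := mh. Qed.

End Projections.

Ltac meas_step := first
  [ exact: measurable_fst | exact: measurable_snd | exact: measurable_id
  | exact: measurable_cst | assumption
  | apply: measurable_fun_pair | apply: measurable_funB | apply: measurable_funD
  | apply: measurable_maxr | apply: measurable_minr | apply: measurable_funM
  | apply: measurable_fun_proj1 | apply: measurable_fun_proj2 ].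
Ltac meas := by repeat meas_step.

(** * Competing exponentials and Burke's cell *)

Section Burke.
Context {R : realType}.
Implicit Types (l m a b c t x y z : R).

Lemma eq_integral_expo l (F G : R -> \bar R) : 0 < l ->
  measurable_fun setT F -> measurable_fun setT G ->
  (forall x, (0 <= F x)%E) -> (forall x, (0 <= G x)%E) ->
  (forall x, 0 < x -> F x = G x) ->
  (\int[expo l]_x F x = \int[expo l]_x G x)%E.
Proof.
move=> l0 mF mG F0 G0 FG.
have mN : measurable (`]-oo, 0]%classic : set R) by [].
have N0 := expo_le0 l0.
rewrite (ge0_negligible_integral mN)//.
rewrite [RHS](ge0_negligible_integral mN)//.
apply: eq_integral => x; rewrite inE/= in_itv/= => -[_ /negP].
by rewrite -ltNge; exact: FG.
Qed.

(** Memorylessness turns the inner integral into one over the excess [t] of [y] over [x], at the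
    price of a factor [expR (- m * x)]; this factor tilts the rate of [x] from [l] to [l + m]. *)
Lemma expo_min_split_gt l m (h : R -> R -> \bar R) : 0 < l -> 0 < m ->
  measurable_fun setT (fun p : R * R => h p.1 p.2) -> (forall x y, (0 <= h x y)%E) ->
  (\int[expo l]_x \int[expo m]_(y in `]x, +oo[%classic) h x y =
   (l / (l + m))%:E * \int[expo m]_t \int[expo (l + m)]_z h z (z + t)%R)%E.
Proof.
move=> l0 m0 mh h0.
have lm0 : 0 < l + m by rewrite addr_gt0.
pose k x := (\int[expo m]_t h x (x + t)%R)%E.
have mk2 : measurable_fun setT (fun p : R * R => h p.1 (p.1 + p.2)).
  apply: (measurableT_comp mh (g := fun p : R * R => (p.1, p.1 + p.2))).
  by apply: measurable_fun_pair => //; apply: measurable_funD.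
have mk : measurable_fun setT k.
  exact: (measurable_inner_integral (expo m) mk2).
have k0 x : (0 <= k x)%E by exact: integral_ge0.
have mI : measurable_fun setT (fun x => \int[expo m]_(y in `]x, +oo[%classic) h x y)%E.
  under eq_fun do rewrite integral_mkcond.
  pose h' x y := ((fun y => h x y) \_ `]x, +oo[%classic) y.
  apply: (measurable_inner_integral (expo m) (f := h')).
    rewrite [X in measurable_fun _ X](_ : _ = (fun p : R * R => if p.1 < p.2 then h p.1 p.2 else 0%E)); last first.
      apply/funext => p; rewrite /h' patchE; congr (if _ then _ else _).
      by rewrite mem_setE in_itv/= andbT.
    apply: measurable_fun_ifT => //.
    by apply: measurable_fun_ltr; [exact: measurable_fst|exact: measurable_snd].
  by move=> x y; rewrite /h' patchE; case: ifP.
transitivity (\int[expo l]_x (k x * (expR ((l - (l + m)) * x))%:E))%E.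
  apply: eq_integral_expo => //.
  - apply: emeasurable_funM => //; apply/measurable_EFinP; exact: measurableT_comp.
  - by move=> x; exact: integral_ge0.
  - by move=> x; rewrite mule_ge0// lee_fin expR_ge0.
  move=> x x0; rewrite /k (expo_memoryless (F := h x))// ?ltW//; last first.
    exact: (measurable_section1 mh).
  rewrite muleAC -EFinM -expRD.
  have -> : m * x + (l - (l + m)) * x = 0 by ring.
  by rewrite expR0 mul1e.
apply: etrans (expo_tilt l0 lm0 mk k0) _.
apply: (congr1 (fun u => (l / (l + m))%:E * u)%E).
exact: (iterated_integralC (expo (l + m)) (expo m) mk2).
Qed.

Lemma expo_min_split l m (h : R -> R -> \bar R) : 0 < l -> 0 < m ->
  measurable_fun setT (fun p : R * R => h p.1 p.2) -> (forall x y, (0 <= h x y)%E) ->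
  (\int[expo l]_x \int[expo m]_y h x y =
   (l / (l + m))%:E * \int[expo m]_t \int[expo (l + m)]_z h z (z + t)%R +
   (m / (l + m))%:E * \int[expo l]_t \int[expo (l + m)]_z h (z + t)%R z)%E.
Proof.
move=> l0 m0 mh h0.
have mh' : measurable_fun setT (fun p : R * R => h p.2 p.1).
  apply: (measurableT_comp mh (g := fun p : R * R => (p.2, p.1))).
  exact: measurable_fun_pair.
pose h1 x y := if x < y then h x y else 0%E.
pose h2 x y := if y < x then h x y else 0%E.
have h10 x y : (0 <= h1 x y)%E by rewrite /h1; case: ifP.
have h20 x y : (0 <= h2 x y)%E by rewrite /h2; case: ifP.
have mh1 : measurable_fun setT (fun p : R * R => h1 p.1 p.2).
  apply: measurable_fun_ifT => //.
  by apply: measurable_fun_ltr; [exact: measurable_fst|exact: measurable_snd].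
have mh2 : measurable_fun setT (fun p : R * R => h2 p.1 p.2).
  apply: measurable_fun_ifT => //.
  by apply: measurable_fun_ltr; [exact: measurable_snd|exact: measurable_fst].
transitivity (\int[expo l]_x \int[expo m]_y h1 x y + \int[expo l]_x \int[expo m]_y h2 x y)%E.
  rewrite -ge0_integralD//; last 4 first.
  - by move=> x _; exact: integral_ge0.
  - exact: (measurable_inner_integral (expo m) mh1).
  - by move=> x _; exact: integral_ge0.
  - exact: (measurable_inner_integral (expo m) mh2).
  apply: eq_integral => x _; rewrite -ge0_integralD//; last 2 first.
  - exact: (measurable_section1 mh1).
  - exact: (measurable_section1 mh2).
  have N0 := expo_set1 x m0.
  have ms := measurable_section1 mh x.
  have ms12 : measurable_fun setT (fun y => h1 x y + h2 x y)%E.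
    by apply: emeasurable_funD; [exact: (measurable_section1 mh1)|exact: (measurable_section1 mh2)].
  have remove_diag k : measurable_fun setT k -> (forall y, (0 <= k y)%E) ->
      (\int[expo m]_y k y = \int[expo m]_(y in setT `\` [set x]) k y)%E.
    by move=> mk k0; apply: ge0_negligible_integral.
  rewrite (remove_diag _ ms)// (remove_diag _ ms12)//; last first.
    by move=> y; rewrite adde_ge0.
  apply: eq_integral => y; rewrite inE/= => -[_ /eqP]; rewrite /h1 /h2 /=.
  by case: ltgtP; rewrite ?adde0 ?add0e.
congr (_ + _)%E.
  rewrite -expo_min_split_gt//; apply: eq_integral => x _.
  rewrite [RHS]integral_mkcond; apply: eq_integral => y _.
  by rewrite patchE mem_setE in_itv/= andbT.
rewrite (iterated_integralC (expo l) (expo m) mh2 h20) [l + m]addrC.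
rewrite -(expo_min_split_gt (h := fun x y => h y x))//; apply: eq_integral => y _.
rewrite [RHS]integral_mkcond; apply: eq_integral => x _.
by rewrite patchE mem_setE in_itv/= andbT.
Qed.

(* [a], [b], [c] are the increments and the weight entering a cell; the map
   returns the two increments leaving it and the discarded minimum. *)
Lemma burke_cell l m (f : R -> R -> R -> \bar R) : 0 < l -> 0 < m ->
  measurable_fun setT (fun p : R * (R * R) => f p.1 p.2.1 p.2.2) ->
  (forall x y z, (0 <= f x y z)%E) ->
  (\int[expo l]_a \int[expo m]_b \int[expo (l + m)]_c
     f (c + Num.max (a - b) 0)%R (c + Num.max (b - a) 0)%R (Num.min a b) =
   \int[expo l]_a \int[expo m]_b \int[expo (l + m)]_c f a b c)%E.
Proof.
move=> l0 m0 mf f0; have lm0 : 0 < l + m by rewrite addr_gt0.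
pose g (p : R * R) c := f (c + Num.max (p.1 - p.2) 0) (c + Num.max (p.2 - p.1) 0) (Num.min p.1 p.2).
have mcomp (u : (R * R) * R -> R * (R * R)) : measurable_fun setT u ->
    measurable_fun setT (fun p => f (u p).1 (u p).2.1 (u p).2.2).
  exact: measurableT_comp mf.
have mg : measurable_fun setT (fun p : (R * R) * R => g p.1 p.2).
  apply: (mcomp (fun p => (p.2 + Num.max (p.1.1 - p.1.2) 0,
    (p.2 + Num.max (p.1.2 - p.1.1) 0, Num.min p.1.1 p.1.2)))).
  meas.
have g0 p c : (0 <= g p c)%E by exact: f0.
have mgI := measurable_inner_integral (expo (l + m)) mg g0.
pose f' (p : R * R) c := f p.1 p.2 c.
have mf' : measurable_fun setT (fun p : (R * R) * R => f' p.1 p.2).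
  apply: (mcomp (fun p => (p.1.1, (p.1.2, p.2)))); meas.
have f'0 p c : (0 <= f' p c)%E by exact: f0.
have mfI := measurable_inner_integral (expo (l + m)) mf' f'0.
rewrite (expo_min_split (h := fun a b => \int[expo (l + m)]_c g (a, b) c)%E l0 m0); last 2 first.
- by apply: eq_measurable_fun mgI => -[].
- by move=> x y; exact: integral_ge0.
rewrite (expo_min_split (h := fun a b => \int[expo (l + m)]_c f' (a, b) c)%E l0 m0); last 2 first.
- by apply: eq_measurable_fun mfI => -[].
- by move=> x y; exact: integral_ge0.
have mrest (k : R -> R -> R -> \bar R) (P : probability (mR R) R) :
    measurable_fun setT (fun p : (R * R) * R => k p.1.1 p.1.2 p.2) ->
    (forall x y z, (0 <= k x y z)%E) ->
    measurable_fun setT (fun t => \int[P]_z \int[P]_c k t z c)%E.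
  move=> mk k0.
  apply: (measurable_inner_integral P (f := fun t z => (\int[P]_c k t z c)%E)).
    apply: eq_measurable_fun (measurable_inner_integral P (f := fun p c => k p.1 p.2 c) mk _) => //.
  by move=> *; exact: integral_ge0.
have mk1 : measurable_fun setT (fun p : (R * R) * R => f p.2 (p.2 + p.1.1) p.1.2).
  by apply: (mcomp (fun p => (p.2, (p.2 + p.1.1, p.1.2)))); meas.
have mk2 : measurable_fun setT (fun p : (R * R) * R => f (p.2 + p.1.1) p.2 p.1.2).
  by apply: (mcomp (fun p => (p.2 + p.1.1, (p.2, p.1.2)))); meas.
have mk1' : measurable_fun setT (fun p : (R * R) * R => f p.1.2 (p.1.2 + p.1.1) p.2).
  by apply: (mcomp (fun p => (p.1.2, (p.1.2 + p.1.1, p.2)))); meas.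
have mk2' : measurable_fun setT (fun p : (R * R) * R => f (p.1.2 + p.1.1) p.1.2 p.2).
  by apply: (mcomp (fun p => (p.1.2 + p.1.1, (p.1.2, p.2)))); meas.
have mg1 : measurable_fun setT (fun p : (R * R) * R => g (p.1.2, p.1.2 + p.1.1) p.2).
  apply: (mcomp (fun p => (p.2 + Num.max (p.1.2 - (p.1.2 + p.1.1)) 0,
    (p.2 + Num.max ((p.1.2 + p.1.1) - p.1.2) 0, Num.min p.1.2 (p.1.2 + p.1.1))))); meas.
have mg2 : measurable_fun setT (fun p : (R * R) * R => g (p.1.2 + p.1.1, p.1.2) p.2).
  apply: (mcomp (fun p => (p.2 + Num.max ((p.1.2 + p.1.1) - p.1.2) 0,
    (p.2 + Num.max (p.1.2 - (p.1.2 + p.1.1)) 0, Num.min (p.1.2 + p.1.1) p.1.2)))); meas.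
(* With [z] the minimum and [t] the excess, the case [a < b] has input [(z, z + t, c)] and output
   [(c, c + t, z)]. Since [z] and [c] both have rate [l + m], the two integrals differ by exchanging
   them. The case [b < a] is symmetric. *)
apply: (congr2 (fun u v => (l / (l + m))%:E * u + (m / (l + m))%:E * v)%E).
- transitivity (\int[expo m]_t \int[expo (l + m)]_z \int[expo (l + m)]_c f c (c + t)%R z)%E.
    apply: eq_integral_expo => //.
    + exact: (mrest (fun t z c => g (z, z + t) c)).
    + exact: (mrest (fun t z c => f c (c + t) z)).
    + by move=> x; do 2 (apply: integral_ge0 => ? _).
    + by move=> x; do 2 (apply: integral_ge0 => ? _).
    move=> t t0; apply: eq_integral => z _; apply: eq_integral => c _; rewrite /g /=.
    have -> : z - (z + t) = - t by ring.
    have -> : z + t - z = t by ring.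
    have -> : Num.max (- t) 0 = 0 by apply/max_idPr; rewrite oppr_le0 ltW.
    have -> : Num.max t 0 = t by apply/max_idPl; rewrite ltW.
    have -> : Num.min z (z + t) = z by apply/min_idPl; rewrite lerDl ltW.
    by rewrite addr0.
  apply: eq_integral => t _.
  apply: (iterated_integralC _ _ (f := fun z c => f c (c + t) z)) => //.
  apply: (measurableT_comp mf (g := fun p : R * R => (p.2, (p.2 + t, p.1)))); meas.
- transitivity (\int[expo l]_t \int[expo (l + m)]_z \int[expo (l + m)]_c f (c + t)%R c z)%E.
    apply: eq_integral_expo => //.
    + exact: (mrest (fun t z c => g (z + t, z) c)).
    + exact: (mrest (fun t z c => f (c + t) c z)).
    + by move=> x; do 2 (apply: integral_ge0 => ? _).
    + by move=> x; do 2 (apply: integral_ge0 => ? _).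
    move=> t t0; apply: eq_integral => z _; apply: eq_integral => c _; rewrite /g /=.
    have -> : z - (z + t) = - t by ring.
    have -> : z + t - z = t by ring.
    have -> : Num.max (- t) 0 = 0 by apply/max_idPr; rewrite oppr_le0 ltW.
    have -> : Num.max t 0 = t by apply/max_idPl; rewrite ltW.
    have -> : Num.min (z + t) z = z by apply/min_idPr; rewrite lerDl ltW.
    by rewrite addr0.
  apply: eq_integral => t _.
  apply: (iterated_integralC _ _ (f := fun z c => f (c + t) c z)) => //.
  apply: (measurableT_comp mf (g := fun p : R * R => (p.2 + t, (p.2, p.1)))); meas.
Qed.

End Burke.

(** * Families of independent exponential weights *)

Section Configurations.
Variables (I : eqType) (R : realType).
Implicit Types (J : seq I) (B : I -> set R) (w : I -> R) (i z : I).

Definition box J B : set (I -> R) := [set w | forall i, i \in J -> B i (w i)].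

Definition cylinder : set (set (I -> R)) :=
  [set C | exists J B, (forall i, measurable (B i)) /\ C = box J B].

Definition conf := g_sigma_algebraType cylinder.

Lemma setI_closed_cylinder : setI_closed cylinder.
Proof.
move=> _ _ [J1 [B1 [mB1 ->]]] [J2 [B2 [mB2 ->]]].
exists (J1 ++ J2), (fun i => (if i \in J1 then B1 i else setT) `&`
                             (if i \in J2 then B2 i else setT)); split.
  by move=> i; apply: measurableI; case: ifP.
apply/seteqP; split => w /=.
  move=> [h1 h2] i _; split; case: ifP => // iJ; [exact: h1|exact: h2].
move=> h; split => i iJ.
  by have /= [] := h i; rewrite ?mem_cat ?iJ.
by have /= [] := h i; rewrite ?mem_cat ?iJ ?orbT.
Qed.

Lemma measurable_box J B : (forall i, measurable (B i)) ->
  measurable (box J B : set conf).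
Proof. by move=> mB; apply: sub_sigma_algebra; exists J, B. Qed.

Lemma measurable_coord i : measurable_fun setT (fun w : conf => w i).
Proof.
move=> _ A mA; rewrite setTI.
rewrite [X in measurable X](_ : _ = box [:: i] (fun=> A)); last first.
  by apply/seteqP; split => w /= h; [move=> j; rewrite inE => /eqP ->|exact/h/mem_head].
exact: measurable_box.
Qed.

Lemma measurable_to_conf d (T : measurableType d) (X : T -> conf) :
  (forall i, measurable_fun setT (fun o => X o i)) -> measurable_fun setT X.
Proof.
move=> mX; apply: (measurability (aT := T) (rT := conf) cylinder erefl) => _ [_ [J [B [mB ->]]] <-].
rewrite setTI; elim: J => [|i J IH].
  by rewrite (_ : _ @^-1` _ = setT)//; apply/seteqP; split.
rewrite (_ : _ @^-1` _ = ((fun o => X o i) @^-1` B i) `&` (X @^-1` box J B)); last first.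
  apply/seteqP; split => o /=.
    by move=> h; split=> [|j jJ]; apply: h; rewrite inE ?eqxx// jJ orbT.
  by move=> [hi hJ] j; rewrite inE => /orP[/eqP ->|/hJ].
by apply: measurableI => //; rewrite -[X in measurable X]setTI; exact: mX.
Qed.

Definition upd w z (t : R) : I -> R := fun i => if i == z then t else w i.

Lemma measurable_upd d (T : measurableType d) (X : T -> conf) z (Y : T -> R) :
  measurable_fun setT X -> measurable_fun setT Y ->
  measurable_fun setT (fun o => upd (X o) z (Y o) : conf).
Proof.
move=> mX mY; apply: measurable_to_conf => i; rewrite /upd; case: eqP => // _.
exact: (measurableT_comp (measurable_coord i) mX).
Qed.

End Configurations.

Arguments measurable_coord {I R}.

Section IndependentExponentials.
Variables (I : eqType) (R : realType).
Local Notation conf := (conf I R).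
Implicit Types (lam : I -> R) (i : I) (J : seq I).

(** The sample space is left free because resampling and tilting pass to product spaces; by
    [iexp_unique] the rates determine the law of [X]. *)
Definition iexp d (T : measurableType d) (P : probability T R) (X : T -> I -> R) lam :=
  measurable_fun setT (X : T -> conf) /\
  forall J B, uniq J -> (forall i, measurable (B i)) ->
    P (X @^-1` box J B) = (\prod_(i <- J) expo (lam i) (B i))%E.

Lemma box_undup J (B : I -> set R) : box (undup J) B = box J B.
Proof.
by apply/seteqP; split => w /= h i; have := h i; rewrite mem_undup.
Qed.

Section Uniqueness.
Context d (T : measurableType d) (P : probability T R) (X : T -> I -> R).
Context d' (T' : measurableType d') (P' : probability T' R) (X' : T' -> I -> R).
Variable lam : I -> R.
Hypotheses (iX : iexp P X lam) (iX' : iexp P' X' lam).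

Lemma iexp_unique (E : set conf) : measurable E ->
  P (X @^-1` E) = P' (X' @^-1` E).
Proof.
move=> mE.
have GT : nat -> cylinder (I := I) (R := R) setT.
  by move=> _; exists [::], (fun=> setT); split => //; apply/seteqP; split.
have coverT : \bigcup_(k : nat) (setT : set conf) = setT.
  by apply/seteqP; split => // x _; exists 0%N.
apply: (@measure_unique _ R conf (cylinder (I := I) (R := R)) (fun=> setT) erefl
  (@setI_closed_cylinder I R) GT coverT (law P iX.1) (law P' iX'.1) _ _ E mE).
- move=> _ [J [B [mB ->]]]; rewrite -box_undup.
  exact: etrans (iX.2 _ _ (undup_uniq J) mB) (esym (iX'.2 _ _ (undup_uniq J) mB)).
- by move=> _; rewrite -ge0_fin_numE// fin_num_measure.
Qed.

Lemma iexp_integral (F : conf -> \bar R) : measurable_fun setT F ->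
  (forall w, (0 <= F w)%E) -> (\int[P]_o F (X o) = \int[P']_o F (X' o))%E.
Proof.
move=> mF F0; rewrite -(ge0_integral_law P iX.1)// -(ge0_integral_law P' iX'.1)//.
by apply: eq_measure_integral => A mA _; exact: iexp_unique.
Qed.

End Uniqueness.

Section Operations.
Context d (T : measurableType d) (P : probability T R).
Variables (X : T -> I -> R) (lam : I -> R).
Hypothesis iX : iexp P X lam.

Lemma measurable_iexp_coord i : measurable_fun setT (fun o => X o i).
Proof. exact: (measurableT_comp (measurable_coord i) iX.1). Qed.

Lemma iexp_coord i (B : set R) : measurable B ->
  P [set o | B (X o i)] = expo (lam i) B.
Proof.
move=> mB; have := iX.2 [:: i] (fun=> B) erefl (fun=> mB).
rewrite big_seq1 => <-; congr (P _); apply/seteqP; split => o /=.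
  by move=> h j; rewrite inE => /eqP ->.
by apply; exact: mem_head.
Qed.

Lemma iexp_of_law d' (T' : measurableType d') (P' : probability T' R)
    (Y : T' -> I -> R) : measurable_fun setT (Y : T' -> conf) ->
  (forall E : set conf, measurable E -> P' (Y @^-1` E) = P (X @^-1` E)) ->
  iexp P' Y lam.
Proof.
move=> mY h; split => // J B uJ mB; rewrite h ?iX.2//; exact: measurable_box.
Qed.

Lemma iexp_upd z l :
  iexp (P \x expo l : probability _ _)%E (fun p => upd (X p.1) z p.2) (upd lam z l).
Proof.
split.
  apply: measurable_upd; last exact: measurable_snd.
  exact: (measurableT_comp iX.1 measurable_fst).
move=> J B uJ mB.
pose J' := rem z J.
pose Bz := if z \in J then B z else setT.
have mBz : measurable Bz by rewrite /Bz; case: ifP.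
have mJ' : measurable (X @^-1` box J' B).
  by rewrite -[X in measurable X]setTI; apply: iX.1 => //; exact: measurable_box.
have -> : (fun p : T * R => upd (X p.1) z p.2) @^-1` box J B = (X @^-1` box J' B) `*` Bz.
  apply/seteqP; split=> [] [ o t] /=.
    move=> h; split.
      move=> i; rewrite mem_rem_uniq// inE => /andP[/= iz iJ].
      by have := h i iJ; rewrite /upd (negbTE iz).
    by rewrite /Bz; case: ifP => // zJ; have := h z zJ; rewrite /upd eqxx.
  move=> [h hz] i iJ; rewrite /upd; case: eqP => [iz|/eqP iz].
    by move: hz; rewrite /Bz -iz iJ.
  by apply: h; rewrite mem_rem_uniq// inE iz.
transitivity ((\prod_(i <- J') expo (lam i) (B i)) * expo l Bz)%E.
  rewrite -(iX.2 J' B (rem_uniq z uJ) mB); exact: product_measure1E.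
rewrite /Bz; case: ifP => zJ; last first.
  have -> : expo l setT = 1%E by exact: probability_setT.
  rewrite mule1 /J' rem_id ?zJ// big_seq [RHS]big_seq; apply: eq_bigr => i iJ.
  by rewrite /upd; case: eqP => // iz; move: iJ; rewrite iz zJ.
rewrite [RHS](perm_big _ (perm_to_rem zJ)) big_cons muleC /= {1}/upd eqxx.
congr (_ * _)%E; rewrite big_seq [RHS]big_seq; apply: eq_bigr => i.
by rewrite mem_rem_uniq// inE => /andP[/= iz _]; rewrite /upd (negbTE iz).
Qed.

(** Replacing one coordinate by an independent copy keeps the law; with Fubini this plays the role
    of conditioning on all the other coordinates. *)
Lemma iexp_resample z (F : conf -> \bar R) : measurable_fun setT F ->
  (forall w, (0 <= F w)%E) ->
  (\int[P]_o F (X o) = \int[P]_o \int[expo (lam z)]_t F (upd (X o) z t))%E.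
Proof.
move=> mF F0; have iU := iexp_upd z (lam z).
have lamE : upd lam z (lam z) = lam by apply/funext => i; rewrite /upd; case: eqP => // ->.
rewrite lamE in iU.
rewrite (iexp_integral iX iU mF F0).
apply: (fubini_tonelli1 (fun p => F (upd (X p.1) z p.2))) => //.
exact: (measurableT_comp mF iU.1).
Qed.

End Operations.
End IndependentExponentials.

Section Reindexing.
Variables (I K : eqType) (R : realType).
Context d (T : measurableType d) (P : probability T R).
Variables (X : T -> I -> R) (lam : I -> R).
Hypothesis iX : iexp P X lam.
Variables (tau : K -> I) (c : K -> R).
Hypothesis tau_inj : injective tau.

Lemma iexp_reindex :
  iexp P (fun o k => X o (tau k) * c k) (fun k => lam (tau k) / c k).
Proof.
split.
  apply: measurable_to_conf => k; apply: measurable_funM => //.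
  exact: measurable_iexp_coord iX _.
move=> J B uJ mB.
(* By injectivity at most one [k] contributes to this intersection, which thus inverts [tau] without
   a choice and is [setT] off its image. *)
pose B' i := \bigcap_(k in [set k | tau k = i /\ k \in J]) (scale_by (c k) @^-1` B k).
have B'E k : k \in J -> B' (tau k) = scale_by (c k) @^-1` B k.
  move=> kJ; apply/seteqP; split => [t /(_ k)|t tB k' /= [/tau_inj -> _]//].
  exact.
have msc k : measurable (scale_by (c k) @^-1` B k).
  by rewrite -[X in measurable X]setTI; exact: measurable_scale_by.
have mB' i : measurable (B' i).
  have [[k [<- kJ]]|h] := pselect (exists k, tau k = i /\ k \in J).
    by rewrite B'E.
  rewrite (_ : B' i = setT)//; apply/seteqP; split => // t _ k /= hk.
  by exfalso; apply: h; exists k.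
have uJ' : uniq (map tau J) by rewrite map_inj_uniq.
have -> : (fun o k => X o (tau k) * c k) @^-1` box J B = X @^-1` box (map tau J) B'.
  apply/seteqP; split => w /=.
    by move=> h _ /mapP[k kJ ->]; rewrite B'E//; exact: h.
  by move=> h k kJ; have := h (tau k) (map_f _ kJ); rewrite B'E.
rewrite iX.2// big_map big_seq [RHS]big_seq; apply: eq_bigr => k kJ.
by rewrite B'E// expo_scale.
Qed.

End Reindexing.

Section CellMap.
Variables (I : eqType) (R : realType).
Implicit Types (w : I -> R).
Variables (h k c : I).
Hypotheses (hk : h != k) (hc : h != c) (kc : k != c).

(** Burke's map acting in place: the outgoing increments overwrite the incoming ones at [h] and [k],
    and the discarded minimum is stored at [c], so that the whole family stays independent with the
    same rates. *)
Definition cell w : I -> R := fun i =>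
  if i == h then w c + Num.max (w h - w k) 0
  else if i == k then w c + Num.max (w k - w h) 0
  else if i == c then Num.min (w h) (w k) else w i.

Lemma measurable_cell : measurable_fun setT (cell : conf I R -> conf I R).
Proof.
have mc := @measurable_coord I R.
apply: measurable_to_conf => i; rewrite /cell.
case: eqP => _; first by apply: measurable_funD => //; apply: measurable_maxr => //; exact: measurable_funB.
case: eqP => _; first by apply: measurable_funD => //; apply: measurable_maxr => //; exact: measurable_funB.
by case: eqP => _ //; exact: measurable_minr.
Qed.

Context d (T : measurableType d) (P : probability T R).
Variables (X : T -> I -> R) (lam : I -> R).
Hypotheses (iX : iexp P X lam) (h0 : 0 < lam h) (k0 : 0 < lam k)
  (lamc : lam c = lam h + lam k).

Lemma iexp_cell : iexp P (fun o => cell (X o)) lam.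
Proof.
apply: (iexp_of_law iX); first exact: (measurableT_comp measurable_cell iX.1).
move=> E mE.
have resample3 (F : conf I R -> \bar R) : measurable_fun setT F ->
    (forall w, (0 <= F w)%E) ->
    (\int[P]_o F (X o) = \int[P]_o \int[expo (lam h)]_a \int[expo (lam k)]_b
       \int[expo (lam h + lam k)]_t F (upd (upd (upd (X o) h a) k b) c t))%E.
  move=> mF F0.
  have mU z : measurable_fun setT (fun p : conf I R * R => upd p.1 z p.2 : conf I R).
    by apply: measurable_upd; [exact: measurable_fst|exact: measurable_snd].
  have mstep (G : conf I R -> \bar R) z l : measurable_fun setT G -> (forall w, (0 <= G w)%E) ->
      measurable_fun setT (fun w : conf I R => \int[expo l]_t G (upd w z t))%E.
    move=> mG G0; apply: (measurable_inner_integral (expo l) (f := fun (w : conf I R) t => G (upd w z t))) => //.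
    exact: (measurableT_comp mG (mU z)).
  rewrite (iexp_resample iX c mF F0) lamc.
  have mF1 := mstep F c (lam h + lam k) mF F0.
  have F10 w : (0 <= \int[expo (lam h + lam k)]_t F (upd w c t))%E by exact: integral_ge0.
  rewrite (iexp_resample iX k mF1 F10).
  have mF2 := mstep _ k (lam k) mF1 F10.
  have F20 w : (0 <= \int[expo (lam k)]_b \int[expo (lam h + lam k)]_t F (upd (upd w k b) c t))%E.
    by apply: integral_ge0 => b _; exact: F10.
  exact: (iexp_resample iX h mF2 F20).
have mX (A : set (conf I R)) (Y : T -> conf I R) : measurable_fun setT Y -> measurable A ->
    P (Y @^-1` A) = (\int[P]_o (\1_A (Y o))%:E)%E.
  move=> mY mA; have mYA : measurable (Y @^-1` A).
    by rewrite -[X in measurable X]setTI; exact: mY.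
  by rewrite -[Y @^-1` A]setIT -integral_indic.
have mind (A : set (conf I R)) : measurable A ->
    measurable_fun setT (fun w : conf I R => (\1_A w)%:E : \bar R).
  by move=> mA; exact/measurable_EFinP/measurable_indic.
have ind0 (A : set (conf I R)) w : (0 <= (\1_A w)%:E :> \bar R)%E by rewrite lee_fin.
rewrite (mX E _ (measurableT_comp measurable_cell iX.1) mE) (mX E _ iX.1 mE).
apply: etrans (resample3 (fun w => (\1_E (cell w))%:E)
  (measurableT_comp (mind _ mE) measurable_cell) (fun w => ind0 _ _)) _.
apply: etrans _ (esym (resample3 (fun w => (\1_E w)%:E) (mind _ mE) (fun w => ind0 _ _))).
apply: eq_integral => o _.
pose f a b t : \bar R := (\1_E (upd (upd (upd (X o) h a) k b) c t))%:E.
have mf : measurable_fun setT (fun p : R * (R * R) => f p.1 p.2.1 p.2.2).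
  apply: (measurableT_comp (mind _ mE)
    (g := fun p : R * (R * R) => upd (upd (upd (X o) h p.1) k p.2.1) c p.2.2 : conf I R)).
  apply: measurable_upd; last by meas.
  apply: measurable_upd; last by meas.
  apply: measurable_upd; last by meas.
  exact: measurable_cst.
have := burke_cell h0 k0 mf (fun a b t => ind0 _ _).
apply: etrans.
apply: eq_integral => a _; apply: eq_integral => b _; apply: eq_integral => t _.
rewrite /f; congr (\1_E _)%:E; apply/funext => i.
have kh : k == h = false by rewrite eq_sym (negbTE hk).
have ch : c == h = false by rewrite eq_sym (negbTE hc).
have ck : c == k = false by rewrite eq_sym (negbTE kc).
rewrite /cell /upd !eqxx ?(negbTE hk, negbTE hc, kh, negbTE kc, ch, ck).
have [->|ih] := eqVneq i h; first by rewrite (negbTE hc) (negbTE hk).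
have [->|ik] := eqVneq i k; first by rewrite (negbTE kc).
by case: eqP.
Qed.

End CellMap.

(** * Change of rates on finitely many coordinates *)

Section Tilting.
Variables (I : eqType) (R : realType) (lam' : I -> R).
Local Notation conf := (conf I R).

Lemma iexp_tilt1 k d (T : measurableType d) (P : probability T R) (X : T -> I -> R) lam
    d' (T' : measurableType d') (P' : probability T' R) (Y : T' -> I -> R) l
    (F : conf -> \bar R) :
  iexp P X lam -> iexp P' Y (upd lam k l) -> 0 < lam k -> 0 < l ->
  measurable_fun setT F -> (forall w, (0 <= F w)%E) ->
  (\int[P]_o (F (X o) * (expR ((lam k - l) * X o k))%:E) =
   (lam k / l)%:E * \int[P']_o F (Y o))%E.
Proof.
move=> iX iY k0 l0 mF F0.
pose G (w : conf) := (F w * (expR ((lam k - l) * w k))%:E)%E.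
have mG : measurable_fun setT G.
  apply: emeasurable_funM => //; apply/measurable_EFinP; apply: measurableT_comp => //.
  by apply: measurable_funM => //; exact: measurable_coord.
have G0 w : (0 <= G w)%E by rewrite mule_ge0// lee_fin expR_ge0.
have mU (w : conf) : measurable_fun setT (fun t : R => upd w k t : conf).
  by apply: measurable_upd; [exact: measurable_cst|exact: measurable_id].
have mU2 : measurable_fun setT (fun p : T * R => upd (X p.1) k p.2 : conf).
  by apply: measurable_upd; [exact: (measurableT_comp iX.1 measurable_fst)|exact: measurable_snd].
rewrite -/(G _) (iexp_resample iX k mG G0).
rewrite (iexp_integral iY (iexp_upd iX k l) mF F0).
transitivity ((lam k / l)%:E * \int[P]_o \int[expo l]_t F (upd (X o) k t))%E; last first.
  congr (_ * _)%E; apply/esym.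
  apply: (fubini_tonelli1 (fun p => F (upd (X p.1) k p.2))) => //.
  exact: (measurableT_comp mF mU2).
rewrite -ge0_integralZl//; last 3 first.
- by apply: (measurable_inner_integral (expo l) (f := fun o t => F (upd (X o) k t))) => //; exact: (measurableT_comp mF mU2).
- by move=> o _; exact: integral_ge0.
- by rewrite lee_fin divr_ge0// ltW.
apply: eq_integral => o _; rewrite -expo_tilt//; last exact: (measurableT_comp mF (mU _)).
by apply: eq_integral => t _; rewrite /G {2}/upd eqxx.
Qed.

(** Coordinates are tilted one at a time, each in a product space; the final family [Y] may live
    anywhere because its law is determined. *)
Lemma iexp_tilt (K : seq I) : uniq K -> forall d (T : measurableType d)
    (P : probability T R) (X : T -> I -> R) lam
    d' (T' : measurableType d') (P' : probability T' R) (Y : T' -> I -> R)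
    (F : conf -> \bar R),
  iexp P X lam -> iexp P' Y (fun i => if i \in K then lam' i else lam i) ->
  (forall k, k \in K -> 0 < lam k /\ 0 < lam' k) ->
  measurable_fun setT F -> (forall w, (0 <= F w)%E) ->
  (\int[P]_o (F (X o) * (expR (\sum_(k <- K) (lam k - lam' k) * X o k))%:E) =
   (\prod_(k <- K) (lam k / lam' k))%:E * \int[P']_o F (Y o))%E.
Proof.
elim: K => [_|k K IH /andP[kK uK]] d T P X lam d' T' P' Y F iX iY pos mF F0.
  rewrite big_nil mul1e -(iexp_integral iX iY mF F0).
  by apply: eq_integral => o _; rewrite big_nil expR0 mule1.
have [k0 k'0] := pos k (mem_head _ _).
pose G (w : conf) := (F w * (expR (\sum_(i <- K) (lam i - lam' i) * w i))%:E)%E.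
have mG : measurable_fun setT G.
  apply: emeasurable_funM => //; apply/measurable_EFinP; apply: measurableT_comp => //.
  apply: measurable_sum => i; apply: measurable_funM => //; exact: measurable_coord.
have G0 w : (0 <= G w)%E by rewrite mule_ge0// lee_fin expR_ge0.
have iU := iexp_upd iX k (lam' k).
transitivity (\int[P]_o (G (X o) * (expR ((lam k - lam' k) * X o k))%:E))%E.
  apply: eq_integral => o _.
  by rewrite /G -muleA -EFinM -expRD big_cons addrC.
rewrite (iexp_tilt1 iX iU k0 k'0 mG G0).
transitivity ((lam k / lam' k)%:E * ((\prod_(i <- K) (lam i / lam' i))%:E * \int[P']_o F (Y o)))%E;
  last by rewrite big_cons muleA -EFinM.
apply: (congr1 (fun u => (lam k / lam' k)%:E * u)%E).
have iY' : iexp P' Y (fun i => if i \in K then lam' i else upd lam k (lam' k) i).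
  congr (iexp P' Y _): iY; apply/funext => i.
  by rewrite inE /upd; case: eqP => [->|//]; rewrite (negbTE kK).
have upK i : i \in K -> upd lam k (lam' k) i = lam i.
  by move=> iK; rewrite /upd; case: eqP => // ik; move: kK; rewrite -ik iK.
have posK i : i \in K -> 0 < upd lam k (lam' k) i /\ 0 < lam' i.
  by move=> iK; rewrite upK//; apply: pos; rewrite inE iK orbT.
transitivity ((\prod_(i <- K) (upd lam k (lam' k) i / lam' i))%:E * \int[P']_o F (Y o))%E.
  apply: etrans _ (IH uK _ _ _ _ _ _ _ _ _ F iU iY' posK mF F0).
  apply: eq_integral => p _; rewrite /G; congr (_ * (expR _)%:E)%E.
  by rewrite big_seq [RHS]big_seq; apply: eq_bigr => i iK; rewrite upK.
congr (_%:E * _)%E; rewrite big_seq [RHS]big_seq; apply: eq_bigr => i iK.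
by rewrite upK.
Qed.

End Tilting.

(** * The corner growth recursion *)

Section CornerGrowth.
Variable R : realType.
Implicit Types (x y : nat * nat -> R) (i j p q : nat).

(** Last-passage time from the corner [(0, 0)], whose own weight is not counted, along paths that
    may follow either axis. *)
Fixpoint g x i : nat -> R :=
  match i with
  | 0 => fix col j := match j with 0 => 0 | j'.+1 => col j' + x (0, j'.+1)%N end
  | i'.+1 => fix col j := match j with
      | 0 => g x i' 0 + x (i'.+1, 0)%N
      | j'.+1 => x (i'.+1, j'.+1) + Num.max (g x i' j'.+1) (col j')
      end
  end.

Lemma gS0 x i : g x i.+1 0 = g x i 0 + x (i.+1, 0)%N. Proof. by []. Qed.
Lemma g0S x j : g x 0 j.+1 = g x 0 j + x (0, j.+1)%N. Proof. by []. Qed.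
Lemma gSS x i j :
  g x i.+1 j.+1 = x (i.+1, j.+1) + Num.max (g x i j.+1) (g x i.+1 j).
Proof. by []. Qed.

Definition hI x i j := g x i.+1 j - g x i j.
Definition vJ x i j := g x i j.+1 - g x i j.

Lemma hI0 x i : hI x i 0 = x (i.+1, 0)%N.
Proof. by rewrite /hI gS0 addrC addKr. Qed.

Lemma vJ0 x j : vJ x 0 j = x (0, j.+1)%N.
Proof. by rewrite /vJ g0S addrC addKr. Qed.

Lemma hIS x i j : hI x i j.+1 = x (i.+1, j.+1) + Num.max (hI x i j - vJ x i j) 0.
Proof.
rewrite /hI /vJ gSS maxC -addrA; congr (_ + _).
by rewrite addr_maxl subrr; congr (Num.max _ _); ring.
Qed.

Lemma vJS x i j : vJ x i.+1 j = x (i.+1, j.+1) + Num.max (vJ x i j - hI x i j) 0.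
Proof.
rewrite /hI /vJ gSS -addrA; congr (_ + _).
by rewrite addr_maxl subrr; congr (Num.max _ _); ring.
Qed.

Definition agree_bulk x y := forall i j, x (i.+1, j.+1) = y (i.+1, j.+1).

(** In [hIS] and [vJS] the incoming increments enter through the positive part of their difference,
    increasing in one and decreasing in the other; the ordering therefore passes from cell to
    cell. *)
Lemma increments_mono x y : agree_bulk x y ->
  (forall i, x (i.+1, 0)%N <= y (i.+1, 0)%N) ->
  (forall j, y (0, j.+1)%N <= x (0, j.+1)%N) ->
  forall j, (forall i, hI x i j <= hI y i j) /\ (forall i, vJ y i j <= vJ x i j).
Proof.
move=> bulk hor ver.
have step j : (forall i, hI x i j <= hI y i j) -> forall i, vJ y i j <= vJ x i j.
  move=> hle; elim=> [|i IH]; first by rewrite !vJ0.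
  rewrite !vJS bulk lerD2l ge_max; apply/andP; split.
    by rewrite le_max lerB.
  by rewrite le_max lexx orbT.
elim=> [|j [IHh IHv]].
  have h0 i : hI x i 0 <= hI y i 0 by rewrite !hI0.
  by split=> //; exact: step.
have hS i : hI x i j.+1 <= hI y i j.+1.
  rewrite !hIS bulk lerD2l ge_max; apply/andP; split.
    by rewrite le_max lerB.
  by rewrite le_max lexx orbT.
by split=> //; exact: step.
Qed.

Lemma g_mono x y i j :
  (forall i' j', (i' <= i)%N -> (j' <= j)%N -> x (i', j') <= y (i', j')) ->
  g x i j <= g y i j.
Proof.
elim: i j => [|i IHi]; elim=> [|j IHj] h //.
- by rewrite !g0S lerD ?h// IHj// => *; apply: h => //; apply: leqW.
- by rewrite !gS0 lerD ?h// IHi// => *; apply: h => //; apply: leqW.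
rewrite !gSS lerD ?h// ge_max !le_max; apply/andP; split; apply/orP.
  by left; apply: IHi => *; apply: h => //; apply: leqW.
by right; apply: IHj => *; apply: h => //; apply: leqW.
Qed.

Lemma g_ge0 x i j : (forall s, 0 <= x s) -> 0 <= g x i j.
Proof.
move=> x0; elim: i j => [|i IHi]; elim=> [|j IHj] //.
- by rewrite g0S addr_ge0.
- by rewrite gS0 addr_ge0.
by rewrite gSS addr_ge0// le_max IHi.
Qed.

(** [zv] silences the vertical axis and [zh] the horizontal one. Comparing [g (zv x)] with
    [g (zh x)] tells which axis a maximal path uses: this is how exit points are encoded. *)
Definition zv x : nat * nat -> R := fun s => if s.1 == 0%N then 0 else x s.
Definition zh x : nat * nat -> R := fun s => if s.2 == 0%N then 0 else x s.

Lemma g_zv0 x j : g (zv x) 0 j = 0.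
Proof. by elim: j => // j IH; rewrite g0S IH /zv/= addr0. Qed.

Lemma g_zh0 x i : g (zh x) i 0 = 0.
Proof. by elim: i => // i IH; rewrite gS0 IH /zh/= addr0. Qed.

Lemma g_zv_h x i : g (zv x) i 0 = g x i 0.
Proof. by elim: i => // i IH; rewrite !gS0 IH. Qed.

Lemma g_zh_v x j : g (zh x) 0 j = g x 0 j.
Proof. by elim: j => // j IH; rewrite !g0S IH. Qed.

(** A path follows only one of the axes, and silencing the other does not change its weight; in
    formulas, the maximum commutes with the recursion. *)
Lemma g_split x i j : (forall s, 0 <= x s) ->
  g x i j = Num.max (g (zv x) i j) (g (zh x) i j).
Proof.
move=> x0; elim: i j => [|i IHi] j.
  by rewrite g_zv0 g_zh_v; apply/esym/max_idPr/g_ge0.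
elim: j => [|j IHj].
  by rewrite g_zh0 g_zv_h; apply/esym/max_idPl/g_ge0.
rewrite !gSS IHi IHj /zv /zh /= -addr_maxr; congr (_ + _).
by rewrite maxACA.
Qed.

Lemma increments_zh x : (forall s, 0 <= x s) ->
  forall j, (forall i, hI (zh (zv x)) i j <= hI (zv x) i j) /\
            (forall i, vJ (zv x) i j <= vJ (zh (zv x)) i j).
Proof.
by move=> x0; apply: increments_mono => // i; rewrite /zh /zv /=.
Qed.

(** When a maximal path to [(i, j)] uses the horizontal axis, [g x] and [g (zv x)] agree there,
    while at [(i.+1, j)] the latter is only a lower bound. Silencing the horizontal axis as well
    decreases [hI] by monotonicity. *)
Lemma hI_pure_le x i j : (forall s, 0 <= x s) ->
  g (zh x) i j <= g (zv x) i j -> hI (zh (zv x)) i j <= hI x i j.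
Proof.
move=> x0 ex; apply: (@le_trans _ _ (hI (zv x) i j)).
  exact: (increments_zh x0 j).1.
rewrite /hI (g_split i j x0) (max_idPl ex) lerD2r.
by rewrite (g_split i.+1 j x0) le_max lexx.
Qed.

(** The inequality is reversed, so the agreement is needed at the upper end of the increment: hence
    the exit condition at [j.+1]. *)
Lemma vJ_pure_ge x i j : (forall s, 0 <= x s) ->
  g (zh x) i j.+1 <= g (zv x) i j.+1 -> vJ x i j <= vJ (zh (zv x)) i j.
Proof.
move=> x0 ex; apply: (@le_trans _ _ (vJ (zv x) i j)).
  rewrite /vJ (g_split i j.+1 x0) (max_idPl ex) lerD2l lerN2.
  by rewrite (g_split i j x0) le_max lexx.
exact: (increments_zh x0 j).2.
Qed.

Definition tr x : nat * nat -> R := fun s => x (s.2, s.1).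

Lemma g_tr x i j : g (tr x) i j = g x j i.
Proof.
elim: i j => [|i IHi]; first by elim=> // j IH; rewrite g0S gS0 IH.
elim=> [|j IHj]; first by rewrite gS0 g0S IHi.
by rewrite !gSS IHi IHj maxC.
Qed.

Lemma hI_tr x i j : hI (tr x) i j = vJ x j i.
Proof. by rewrite /hI /vJ !g_tr. Qed.

Lemma vJ_tr x i j : vJ (tr x) i j = hI x j i.
Proof. by rewrite /hI /vJ !g_tr. Qed.

Lemma zv_tr x : zv (tr x) = tr (zh x). Proof. by []. Qed.
Lemma zh_tr x : zh (tr x) = tr (zv x). Proof. by []. Qed.

Lemma zhzvC x : zh (zv x) = zv (zh x).
Proof. by apply/funext => -[i j]; rewrite /zh /zv /=; case: eqP; case: eqP. Qed.

Lemma vJ_pure_le x i j : (forall s, 0 <= x s) ->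
  g (zv x) i j <= g (zh x) i j -> vJ (zh (zv x)) i j <= vJ x i j.
Proof.
move=> x0 ex.
have := @hI_pure_le (tr x) j i (fun=> x0 _).
by rewrite !(zv_tr, zh_tr) !hI_tr !g_tr -zhzvC => /(_ ex).
Qed.

Lemma hI_pure_ge x i j : (forall s, 0 <= x s) ->
  g (zv x) i.+1 j <= g (zh x) i.+1 j -> hI x i j <= hI (zh (zv x)) i j.
Proof.
move=> x0 ex.
have := @vJ_pure_ge (tr x) j i (fun=> x0 _).
by rewrite !(zv_tr, zh_tr) !vJ_tr !g_tr -zhzvC => /(_ ex).
Qed.

Lemma increments_ge0 x : (forall s, 0 <= x s) ->
  forall i j, 0 <= hI x i j /\ 0 <= vJ x i j.
Proof.
move=> x0 i j; split; case: j => [|j]; rewrite ?hI0 ?hIS//.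
- by rewrite addr_ge0// le_max lexx orbT.
- by case: i => [|i]; rewrite ?vJ0 ?vJS// addr_ge0// le_max lexx orbT.
- by case: i => [|i]; rewrite ?vJ0 ?vJS// addr_ge0// le_max lexx orbT.
Qed.

(* The increments seen from the corner (p, q), as boundary data of a smaller
   quadrant; the value at (0, 0) is never read. *)
Definition off x p q : nat * nat -> R := fun s =>
  match s with
  | (0, 0) => x (0, 0)%N
  | (i.+1, 0) => hI x (p + i) q
  | (0, j.+1) => vJ x p (q + j)
  | (i.+1, j.+1) => x (p + i.+1, q + j.+1)%N
  end.

Lemma g_off x p q i j : g (off x p q) i j = g x (p + i) (q + j) - g x p q.
Proof.
elim: i j => [|i IHi].
  elim=> [|j IHj]; first by rewrite !addn0 subrr.
  by rewrite g0S IHj /= /vJ addn0 addnS; ring.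
elim=> [|j IHj].
  by rewrite gS0 IHi /= /hI addn0 addnS; ring.
rewrite gSS IHi IHj /= -addr_maxl addrA; congr (_ - _).
by rewrite !addnS gSS.
Qed.

Lemma off_ge0 x p q : (forall s, 0 <= x s) -> forall s, 0 <= off x p q s.
Proof.
move=> x0 [[|i] [|j]] //=.
  by case: (increments_ge0 x0 p (q + j)).
by case: (increments_ge0 x0 (p + i) q).
Qed.

Lemma hI_off x p q i j : hI (off x p q) i j = hI x (p + i) (q + j).
Proof. by rewrite /hI !g_off addnS; ring. Qed.

Lemma vJ_off x p q i j : vJ (off x p q) i j = vJ x (p + i) (q + j).
Proof. by rewrite /vJ !g_off addnS; ring. Qed.

Lemma off00 x : off x 0 0 = x.
Proof.
apply/funext => -[[|i] [|j]] //=; first by rewrite add0n vJ0.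
by rewrite add0n hI0.
Qed.

Lemma off_row x p q : off x p q.+1 = off (off x p q) 0 1.
Proof.
apply/funext => -[[|i] [|j]] /=.
- by [].
- by rewrite vJ_off addn0 add1n addnS.
- by rewrite hI_off add0n addn1.
- by rewrite addSnnS.
Qed.

Lemma off_tr x p q : off (tr x) p q = tr (off x q p).
Proof.
apply/funext => -[[|i] [|j]] //=; rewrite /tr /=.
- by rewrite -/(tr x) vJ_tr.
- by rewrite -/(tr x) hI_tr.
Qed.

Lemma tr_tr x : tr (tr x) = x.
Proof. by apply/funext => -[]. Qed.

Lemma off_col x p q : off x p.+1 q = tr (off (tr (off x p q)) 0 1).
Proof. by rewrite -{1}(tr_tr x) off_tr off_row off_tr. Qed.

End CornerGrowth.

(** * Burke's property: stationarity of the increments *)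

Section Stationarity.
Variable R : realType.
Local Notation conf := (conf (nat * nat)%type R).
Implicit Types (x : nat * nat -> R) (i j p q m : nat) (a b : R).

Definition rate a b : nat * nat -> R := fun s =>
  match s with
  | (0, 0) => 1
  | (_.+1, 0) => a
  | (0, _.+1) => b
  | _ => 1
  end.

Lemma measurable_g i j : measurable_fun setT (fun x : conf => g x i j).
Proof.
elim: i j => [|i IHi]; elim=> [|j IHj]; first exact: measurable_cst.
- by apply: measurable_funD => //; exact: measurable_coord.
- by apply: measurable_funD => //; exact: measurable_coord.
apply: measurable_funD; first exact: measurable_coord.
exact: measurable_maxr.
Qed.

Lemma measurable_hI i j : measurable_fun setT (fun x : conf => hI x i j).
Proof. by apply: measurable_funB; exact: measurable_g. Qed.

Lemma measurable_vJ i j : measurable_fun setT (fun x : conf => vJ x i j).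
Proof. by apply: measurable_funB; exact: measurable_g. Qed.

Lemma measurable_off p q : measurable_fun setT (fun x : conf => off x p q : conf).
Proof.
apply: measurable_to_conf => -[[|i] [|j]] /=.
- exact: measurable_coord.
- exact: measurable_vJ.
- exact: measurable_hI.
- exact: measurable_coord.
Qed.

Lemma measurable_zv : measurable_fun setT (fun x : conf => zv x : conf).
Proof.
apply: measurable_to_conf => s; rewrite /zv; case: eqP => _; first exact: measurable_cst.
exact: measurable_coord.
Qed.

Lemma measurable_zh : measurable_fun setT (fun x : conf => zh x : conf).
Proof.
apply: measurable_to_conf => s; rewrite /zh; case: eqP => _; first exact: measurable_cst.
exact: measurable_coord.
Qed.

Lemma measurable_exit d (T : measurableType d) (X : T -> conf) i j : measurable_fun setT X ->
  measurable [set o | g (zv (X o)) i j <= g (zh (X o)) i j] /\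
  measurable [set o | g (zh (X o)) i j <= g (zv (X o)) i j].
Proof.
move=> mX.
have mh : measurable_fun setT (fun o => g (zh (X o)) i j).
  exact: (measurableT_comp (measurable_g i j) (measurableT_comp measurable_zh mX)).
have mv : measurable_fun setT (fun o => g (zv (X o)) i j).
  exact: (measurableT_comp (measurable_g i j) (measurableT_comp measurable_zv mX)).
by split; rewrite -[X in measurable X]setTI; exact: measurable_fun_ler.
Qed.

(** Sweep of the first row: slot [(0, 1)] carries the travelling vertical increment, slot
    [(i.+1, 0)] receives the horizontal increment at height 1, and slot [(i.+1, 1)] the discarded
    minimum. *)
Fixpoint row_cells m x : nat * nat -> R :=
  if m is m'.+1 then cell (m'.+1, 0)%N (0, 1)%N (m'.+1, 1)%N (row_cells m' x) else x.

Lemma row_cells_off m x s : (s.1 <= m)%N ->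
  row_cells m x (s.1, if s.2 == 0%N then 0%N else s.2.+1) =
  off x 0 1 s.
Proof.
have row_cellsE m' : [/\
    forall i, (i < m')%N -> row_cells m' x (i.+1, 0)%N = hI x i 1,
    row_cells m' x (0, 1)%N = vJ x m' 0,
    forall i, (m' <= i)%N -> row_cells m' x (i.+1, 0)%N = x (i.+1, 0)%N /\
      row_cells m' x (i.+1, 1)%N = x (i.+1, 1)%N &
    forall i j, row_cells m' x (i, j.+2) = x (i, j.+2) /\ row_cells m' x (0, 0)%N = x (0, 0)%N].
  elim: m' => [|m' [IH1 IH2 IH3 IH4]]; first by split=> //; rewrite vJ0.
  have [h3 c3] := IH3 m' (leqnn _).
  split.
  - move=> i; rewrite ltnS leq_eqVlt => /orP[/eqP ->|im] /=.
      rewrite /cell eqxx IH2 h3 c3 hIS hI0; congr (_ + Num.max (_ - _) _).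
    rewrite /cell /= !xpair_eqE !eqSS (ltn_eqF im) /= ?andbF; exact: IH1.
  - by rewrite /= /cell /= IH2 h3 c3 vJS hI0.
  - move=> i mi /=; have [h3' c3'] := IH3 i (ltnW mi).
    by rewrite /cell /= !xpair_eqE !eqSS (gtn_eqF mi) /= ?andbF.
  - move=> i j; have [h4 h4'] := IH4 i j.
    by rewrite /= /cell /= !xpair_eqE /= ?andbF.
case: s => -[|i] [|j] /= im; have [h1 h2 h3 h4] := row_cellsE m.
- by have [] := h4 0%N 0%N.
- by have [-> _] := h4 0%N j; rewrite vJ0.
- by rewrite h1.
- by have [-> _] := h4 i.+1 j.
Qed.

Context d (T : measurableType d) (P : probability T R).

Lemma iexp_row_cells m (X : T -> nat * nat -> R) a b : 0 < a -> 0 < b -> a + b = 1 ->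
  iexp P X (rate a b) -> iexp P (fun o => row_cells m (X o)) (rate a b).
Proof.
move=> a0 b0 ab iX; elim: m => // m IH.
apply: iexp_cell IH _ _ _ => //=.
by rewrite xpair_eqE andbF.
Qed.

Lemma iexp_off_row (X : T -> nat * nat -> R) a b : 0 < a -> 0 < b -> a + b = 1 ->
  iexp P X (rate a b) -> iexp P (fun o => off (X o) 0 1) (rate a b).
Proof.
move=> a0 b0 ab iX; split; first exact: (measurableT_comp (measurable_off 0 1) iX.1).
move=> J B uJ mB.
pose m := (\max_(s <- J) s.1)%N.
(* Row 1 is skipped: the sweep has left there the travelling increment and the minima. The bound [m]
   covers all columns occurring in [J]. *)
pose tau (s : nat * nat) := (s.1, if s.2 == 0%N then 0%N else s.2.+1).
have tau_inj : injective tau.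
  by move=> [i [|j]] [i' [|j']] // [] -> // ->.
have iY := iexp_reindex (iexp_row_cells m a0 b0 ab iX) (fun=> 1) tau_inj.
have rateE s : rate a b (tau s) / 1 = rate a b s.
  by rewrite divr1; case: s => -[|i] [|j].
rewrite (_ : (fun s => _) = rate a b) in iY; last by apply/funext => s; exact: rateE.
rewrite -(iY.2 J B uJ mB); congr (P _); apply/seteqP; split => w /= h s sJ;
  have := h s sJ; rewrite mulr1 row_cells_off//; exact: leq_bigmax_seq.
Qed.

Lemma iexp_tr (X : T -> nat * nat -> R) a b :
  iexp P X (rate a b) -> iexp P (fun o => tr (X o)) (rate b a).
Proof.
move=> iX; pose tau (s : nat * nat) := (s.2, s.1).
have tau_inj : injective tau by move=> [i j] [i' j'] [-> ->].
have := iexp_reindex iX (fun=> 1) tau_inj.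
congr (iexp P _ _).
  by apply/funext => o; apply/funext => s; rewrite mulr1.
by apply/funext => -[[|i] [|j]]; rewrite /tau /= divr1.
Qed.

(** The corner moves by one row at a time, or by one column after transposition, and each move
    preserves the law. *)
Lemma iexp_off (X : T -> nat * nat -> R) a b p q : 0 < a -> 0 < b -> a + b = 1 ->
  iexp P X (rate a b) -> iexp P (fun o => off (X o) p q) (rate a b).
Proof.
move=> a0 b0 ab iX; elim: p => [|p IHp].
  elim: q => [|q IHq]; first by under eq_fun do rewrite off00.
  by under eq_fun do rewrite off_row; exact: iexp_off_row.
under eq_fun do rewrite off_col.
by apply: iexp_tr; apply: iexp_off_row; rewrite 1?addrC//; exact: iexp_tr.
Qed.

End Stationarity.

(** * Exit points of the stationary model *)

Section ExitBound.
Variable R : realType.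
Local Notation conf := (conf (nat * nat)%type R).
Implicit Types (x : nat * nat -> R) (i j m n : nat) (w z rho eta : R).

Lemma iexp_rescale (I : eqType) d (T : measurableType d) (P : probability T R)
    (X : T -> I -> R) (lam lam' : I -> R) :
  iexp P X lam -> (forall i : I, 0 < lam i) ->
  iexp P (fun o (i : I) => X o i * (lam i / lam' i)) lam'.
Proof.
move=> iX lam0; have := iexp_reindex iX (fun i : I => lam i / lam' i) (@inj_id I).
congr (iexp P _ _); apply/funext => i.
by rewrite invf_div mulrC divfK// gt_eqF.
Qed.

Lemma rate_gt0 a b s : 0 < a -> 0 < b -> 0 < rate a b s :> R.
Proof. by case: s => -[|i] [|j]. Qed.

Lemma g_telescope x m n :
  g x m n = \sum_(i < m) x (i.+1, 0)%N + \sum_(j < n) vJ x m j.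
Proof.
elim: n => [|n IH].
  rewrite big_ord0 addr0; elim: m => [|m IH]; first by rewrite big_ord0.
  by rewrite big_ord_recr gS0 IH.
by rewrite big_ord_recr /= addrA -IH /vJ; ring.
Qed.

Lemma g_ext x y i j :
  (forall i' j', (i' <= i)%N -> (j' <= j)%N -> x (i', j') = y (i', j')) ->
  g x i j = g y i j.
Proof.
by move=> h; apply/eqP; rewrite eq_le !g_mono// => i' j' hi hj; rewrite h.
Qed.

Context d (T : measurableType d) (P : probability T R).

Lemma integral_expR_vertical (V : T -> nat * nat -> R) a w z n :
  iexp P V (rate a (1 - z)) -> 0 < a -> z < 1 -> w < 1 ->
  (\int[P]_o (expR ((w - z) * \sum_(j < n) V o (0, j.+1)%N))%:E =
   (((1 - z) / (1 - w)) ^+ n)%:E)%E.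
Proof.
move=> iV a0 z1 w1; have z10 : 0 < 1 - z by rewrite subr_gt0.
have w10 : 0 < 1 - w by rewrite subr_gt0.
pose K := [seq (0, j.+1)%N | j <- iota 0 n].
have uK : uniq K by rewrite map_inj_uniq ?iota_uniq// => j j' [].
have iY := iexp_rescale (fun s => if s \in K then 1 - w else rate a (1 - z) s) iV
  (fun s => rate_gt0 s a0 z10).
have posK s : s \in K -> 0 < rate a (1 - z) s /\ 0 < 1 - w.
  by move=> /mapP[j _ ->].
have := iexp_tilt (lam' := fun=> 1 - w) (F := fun=> 1%E) uK iV iY posK
  (measurable_cst _) (fun=> lee01).
have -> : (\int[P]_o 1 = 1)%E.
  by rewrite integral_cst// mul1e; exact: probability_setT.
rewrite mule1 => h.
transitivity (((\prod_(k <- K) (rate a (1 - z) k / (1 - w))))%:E : \bar R)%E.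
  rewrite -h; apply: eq_integral => o _; rewrite mul1e; congr (expR _)%:E.
  rewrite big_map -[n in iota 0 n]subn0 -/(index_iota 0 n) big_mkord mulr_sumr.
  by apply: eq_bigr => j _ /=; congr (_ * _); ring.
rewrite big_map -[n in iota 0 n]subn0 -/(index_iota 0 n) big_mkord /=.
by rewrite prodr_const card_ord.
Qed.

(* Tilting the horizontal boundary weights from rate w to rate z turns the
   model into a stationary one, in which Burke's property applies. *)
Lemma integral_expR_g (X : T -> nat * nat -> R) w z m n :
  iexp P X (rate w (1 - z)) -> 0 < w -> w < 1 -> 0 < z -> z < 1 ->
  (\int[P]_o (expR ((w - z) * g (X o) m n))%:E =
   ((w / z) ^+ m * ((1 - z) / (1 - w)) ^+ n)%:E)%E.
Proof.
move=> iX w0 w1 z0 z1; have z10 : 0 < 1 - z by rewrite subr_gt0.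
pose K := [seq (i.+1, 0)%N | i <- iota 0 m].
have uK : uniq K by rewrite map_inj_uniq ?iota_uniq// => j j' [].
pose F (x : conf) : \bar R := (expR ((w - z) * \sum_(j < n) vJ x m j))%:E.
have mF : measurable_fun setT F.
  apply/measurable_EFinP; apply: measurableT_comp => //.
  by apply: measurable_funM => //; apply: measurable_sum => j; exact: measurable_vJ.
have F0 x : (0 <= F x)%E by rewrite lee_fin expR_ge0.
have lam0 s := rate_gt0 s w0 z10.
have iY := iexp_rescale (fun s => if s \in K then z else rate w (1 - z) s) iX lam0.
have iY' := iexp_rescale (rate z (1 - z)) iX lam0.
have posK s : s \in K -> 0 < rate w (1 - z) s /\ 0 < z by move=> /mapP[j _ ->].
have h := iexp_tilt (lam' := fun=> z) uK iX iY posK mF F0.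
transitivity (\int[P]_o (F (X o) * (expR (\sum_(k <- K) (rate w (1 - z) k - z) * X o k))%:E))%E.
  apply: eq_integral => o _; rewrite -EFinM -expRD; congr (expR _)%:E.
  rewrite g_telescope mulrDr addrC; congr (_ + _).
  rewrite big_map -[m in iota 0 m]subn0 -/(index_iota 0 m) big_mkord mulr_sumr.
  by apply: eq_bigr.
apply: etrans h _; rewrite big_map -[m in iota 0 m]subn0 -/(index_iota 0 m) big_mkord.
rewrite /= prodr_const card_ord EFinM; apply: (congr1 (fun u => _ * u)%E).
have zz : z + (1 - z) = 1 by rewrite addrC subrK.
rewrite -(integral_expR_vertical n (iexp_off m 0 z0 z10 zz iY') z0 z1 w1).
apply: eq_integral => o _; rewrite /F; congr (expR (_ * _))%:E.
apply: eq_bigr => j _ /=; rewrite add0n /vJ.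
have gE j' : g (fun s => X o s * (rate w (1 - z) s / (if s \in K then z else rate w (1 - z) s))) m j' =
    g (fun s => X o s * (rate w (1 - z) s / rate z (1 - z) s)) m j'.
  apply: g_ext => i1 j1 im _; congr (_ * (_ / _)).
  case: i1 j1 im => [|i1] [|j1] im.
  - by case: ifP => // /mapP[].
  - by case: ifP => // /mapP[].
  - by rewrite ifT//; apply: map_f; rewrite mem_iota.
  - by case: ifP => // /mapP[].
by rewrite !gE.
Qed.

(** The families [Y] and [Z] share enlarged horizontal weights; on the vertical axis [Y] agrees with
    [X] and [Z] is smaller. On the event the vertical axis is dominated even in [Y], so
    [g Y <= g Z]. The moments of [expR (- eta * g Y)] and [expR (eta * g Z)] are explicit, and their
    geometric mean bounds the probability. *)
Lemma exit_bound (X : T -> nat * nat -> R) rho eta m n :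
  iexp P X (rate rho (1 - rho)) -> (forall o s, 0 <= X o s) ->
  0 < eta -> eta *+ 2 < rho -> rho < 1 ->
  (P [set o | (g (zh (X o)) m n <= g (zv (X o)) m n)%R] <=
   (expR (eta ^+ 2 / 2 * (m%:R / (rho * (rho - eta *+ 2)) -
      n%:R / (1 - rho + eta) ^+ 2))%R)%:E)%E.
Proof.
move=> iX X0 eta0 eta_rho rho1.
have rho0 : 0 < rho by lra.
have w0 : 0 < rho - eta by lra.
have w1 : rho - eta < 1 by lra.
have w2 : 0 < rho - eta *+ 2 by lra.
have w21 : rho - eta *+ 2 < 1 by lra.
have rho10 : 0 < 1 - rho by lra.
have v0 : 0 < 1 - (rho - eta *+ 2) by lra.
have lam0 s := rate_gt0 s rho0 rho10.
pose Y o (s : nat * nat) := X o s * (rate rho (1 - rho) s / rate (rho - eta) (1 - rho) s).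
pose Z o (s : nat * nat) :=
  X o s * (rate rho (1 - rho) s / rate (rho - eta) (1 - (rho - eta *+ 2)) s).
have iY : iexp P Y (rate (rho - eta) (1 - rho)) := iexp_rescale _ iX lam0.
have iZ : iexp P Z (rate (rho - eta) (1 - (rho - eta *+ 2))) := iexp_rescale _ iX lam0.
have m1E := integral_expR_g m n iY w0 w1 rho0 rho1.
have m2E := integral_expR_g m n iZ w0 w1 w2 w21.
have e1 : rho - eta - rho = - eta by ring.
have e2 : rho - eta - (rho - eta *+ 2) = eta by ring.
rewrite e1 in m1E; rewrite e2 in m2E.
set M1 := _ * _ in m1E; set M2 := _ * _ in m2E.
have M10 : 0 < M1 by rewrite mulr_gt0// exprn_gt0// divr_gt0//; lra.
have M20 : 0 < M2 by rewrite mulr_gt0// exprn_gt0// divr_gt0//; lra.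
pose L1 := ln M1; pose L2 := ln M2.
have M1E : M1 = expR L1 by rewrite lnK.
have M2E : M2 = expR L2 by rewrite lnK.
(* This value balances the two moments: [expR c * M1 = expR (- c) * M2]. *)
pose c := (L2 - L1) / 2.
have mgX (V : T -> nat * nat -> R) lam i j : iexp P V lam -> measurable_fun setT (fun o => g (V o) i j).
  by move=> iV; exact: (measurableT_comp (measurable_g i j) iV.1).
have mE (k : R) (f : T -> R) : measurable_fun setT f -> measurable_fun setT (fun o => (expR (k * f o))%:E).
  move=> mf; apply/measurable_EFinP; apply: measurableT_comp => //.
  exact: measurable_funM.
have mgh : measurable_fun setT (fun o => g (zh (X o)) m n).
  have h1 : measurable_fun setT (fun x : conf => g (zh x) m n).
    exact: (measurableT_comp (measurable_g m n) (@measurable_zh R)).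
  exact: (measurableT_comp h1 iX.1).
have mgv : measurable_fun setT (fun o => g (zv (X o)) m n).
  have h1 : measurable_fun setT (fun x : conf => g (zv x) m n).
    exact: (measurableT_comp (measurable_g m n) (@measurable_zv R)).
  exact: (measurableT_comp h1 iX.1).
have mA : measurable [set o | g (zh (X o)) m n <= g (zv (X o)) m n].
  by rewrite -[X in measurable X]setTI; exact: (measurable_fun_ler mgh mgv).
have ge1 : 1 <= (1 - rho) / (1 - (rho - eta *+ 2)) + 1 by rewrite lerDr divr_ge0// ltW.
have gY0 o s : X o s <= Y o s.
  rewrite /Y ler_peMr//; case: s => -[|i] [|j] /=; rewrite ?divff ?gt_eqF//.
  by rewrite ler_pdivlMr// mul1r; lra.
have pointwise o : g (zh (X o)) m n <= g (zv (X o)) m n ->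
    1 <= 2^-1 * (expR (c + - eta * g (Y o) m n) + expR (- c + eta * g (Z o) m n)).
  move=> ex.
  have Y0 s : 0 <= Y o s by exact: le_trans (X0 o s) (gY0 o s).
  have gYZ : g (Y o) m n <= g (Z o) m n.
    apply: (@le_trans _ _ (g (zv (Y o)) m n)).
      rewrite (g_split m n Y0) ge_max lexx /=.
      have -> : g (zh (Y o)) m n = g (zh (X o)) m n.
        apply: g_ext => -[|i] [|j] _ _; rewrite /zh /Y //= divff ?mulr1//; lra.
      apply: (le_trans ex); apply: g_mono => i j _ _; rewrite /zv; case: ifP => //.
    apply: g_mono => -[|i] [|j] _ _; rewrite /zv /Y /Z //=; rewrite mulr_ge0//.
    by rewrite divr_ge0// ltW.
  set u := g (Y o) m n in gYZ *; set v := g (Z o) m n in gYZ *.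
  have h1 := expR_ge1Dx (c + - eta * u).
  have h2 : expR (- c + eta * u) <= expR (- c + eta * v).
    by rewrite ler_expR lerD2l ler_pM2l.
  have h3 := expR_ge1Dx (- c + eta * u).
  by lra.
pose f1 o := ((expR c)%:E * (expR (- eta * g (Y o) m n))%:E)%E.
pose f2 o := ((expR (- c))%:E * (expR (eta * g (Z o) m n))%:E)%E.
have mf1 : measurable_fun setT f1.
  by apply: emeasurable_funM => //; apply: mE; exact: mgX iY.
have mf2 : measurable_fun setT f2.
  by apply: emeasurable_funM => //; apply: mE; exact: mgX iZ.
have f10 o : (0 <= f1 o)%E by rewrite mule_ge0// lee_fin expR_ge0.
have f20 o : (0 <= f2 o)%E by rewrite mule_ge0// lee_fin expR_ge0.
have mf12 : measurable_fun setT (fun o => f1 o + f2 o)%E by exact: emeasurable_funD.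
have f120 o : setT o -> (0 <= f1 o + f2 o)%E by rewrite adde_ge0.
apply: (@le_trans _ _ (\int[P]_o (2^-1%:E * (f1 o + f2 o)))%E).
  rewrite -[X in P X]setIT -integral_indic//.
  apply: ge0_le_integral => //.
  - by apply/measurable_EFinP/measurable_indic.
  - exact: emeasurable_funM.
  move=> o _; rewrite (_ : (2^-1%:E * _)%E = (2^-1 * (expR c * expR (- eta * g (Y o) m n) +
    expR (- c) * expR (eta * g (Z o) m n)))%:E)// lee_fin indicE.
  case: (boolP (o \in _)) => [|_]; last first.
    by rewrite mulr_ge0// addr_ge0// mulr_ge0// expR_ge0.
  by rewrite inE/= => /pointwise; rewrite !expRD.
rewrite ge0_integralZl// ge0_integralD//.
have -> : (\int[P]_o f1 o = (expR c)%:E * M1%:E)%E.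
  by rewrite -m1E ge0_integralZl ?lee_fin ?expR_ge0//; apply: mE; exact: mgX iY.
have -> : (\int[P]_o f2 o = (expR (- c))%:E * M2%:E)%E.
  by rewrite -m2E ge0_integralZl ?lee_fin ?expR_ge0//; apply: mE; exact: mgX iZ.
rewrite (_ : (2^-1%:E * _)%E = (2^-1 * (expR c * M1 + expR (- c) * M2))%:E)//.
rewrite lee_fin {1}M1E {1}M2E -!expRD.
have -> : c + L1 = (L1 + L2) / 2 by rewrite /c; field.
have -> : - c + L2 = (L1 + L2) / 2 by rewrite /c; field.
rewrite (_ : 2^-1 * _ = expR ((L1 + L2) / 2)); last by field.
rewrite ler_expR ler_pdivrMr// -[L1 + L2]expRK expRD -M1E -M2E.
have M120 : 0 < M1 * M2 by rewrite mulr_gt0.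
rewrite -[leRHS]expRK ler_ln ?posrE ?expR_gt0//.
have u0 : 0 < rho * (rho - eta *+ 2) by rewrite mulr_gt0.
have v20 : 0 < (1 - rho + eta) ^+ 2 by rewrite exprn_gt0//; lra.
(* The terms of first order in [eta] cancel in the product. *)
have -> : M1 * M2 = (1 + eta ^+ 2 / (rho * (rho - eta *+ 2))) ^+ m *
    (1 - eta ^+ 2 / (1 - rho + eta) ^+ 2) ^+ n.
  rewrite /M1 /M2 mulrACA -!exprMn; congr (_ ^+ m * _ ^+ n); field; lra.
have -> : eta ^+ 2 / 2 * (m%:R / (rho * (rho - eta *+ 2)) - n%:R / (1 - rho + eta) ^+ 2) * 2 =
    m%:R * (eta ^+ 2 / (rho * (rho - eta *+ 2))) + n%:R * (- (eta ^+ 2 / (1 - rho + eta) ^+ 2)).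
  field; lra.
rewrite expRD !expRM_natl ler_pM//.
- by rewrite exprn_ge0// addr_ge0// divr_ge0// ?exprn_ge0// ltW.
- rewrite exprn_ge0// subr_ge0 ler_pdivrMr// mul1r ler_sqr ?nnegrE; lra.
- rewrite lerXn2r ?nnegrE ?expR_ge0 ?expR_ge1Dx//.
  by rewrite addr_ge0// divr_ge0// ?exprn_ge0// ltW.
- rewrite lerXn2r ?nnegrE ?expR_ge0 ?expR_ge1Dx//.
  rewrite subr_ge0 ler_pdivrMr// mul1r ler_sqr ?nnegrE; lra.
Qed.

End ExitBound.

Section Positivity.
Variable R : realType.

Lemma expo_positive_part (l : R) (B : set R) : 0 < l -> measurable B ->
  expo l ((fun t => Num.max t 0) @^-1` B) = expo l B.
Proof.
move=> l0 mB; have N0 := expo_le0 l0.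
have mN : measurable (`]-oo, 0]%classic : set R) by [].
have mm : measurable_fun setT (fun t : R => Num.max t 0) by exact: measurable_maxr.
have restr (A : set R) : measurable A -> expo l A = expo l (A `\` `]-oo, 0]%classic).
  move=> mA; rewrite -(setDUK (B := A) (A := A `&` `]-oo, 0]%classic)); last exact: subIsetl.
  rewrite measureU//; last 3 first.
  - exact: measurableI.
  - by apply: measurableD => //; exact: measurableI.
  - by rewrite setDIK.
  rewrite [X in (X + _)%E](_ : _ = 0%E) ?add0e.
    congr (expo l _); apply/seteqP; split => x /=; tauto.
  by apply/eqP; rewrite eq_le measure_ge0 andbT -N0 le_measure ?inE//; exact: measurableI.
have mB' : measurable ((fun t => Num.max t 0) @^-1` B).
  by rewrite -[X in measurable X]setTI; exact: mm.
rewrite restr// [RHS]restr//; congr (expo l _).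
by apply/seteqP; split => x /=; rewrite in_itv/= => -[Bx nx]; split => //; move: Bx;
  have x0 : 0 < x by [rewrite ltNge; exact/negP]; rewrite (max_idPl (ltW x0)).
Qed.

Variable I : eqType.
Context d (T : measurableType d) (P : probability T R).

(** Positive parts make the weights nonnegative everywhere and not just almost surely, so that the
    deterministic comparisons apply to every sample. *)
Lemma iexp_pos (X : T -> I -> R) lam : (forall i, 0 < lam i) -> iexp P X lam ->
  iexp P (fun o i => Num.max (X o i) 0) lam.
Proof.
move=> lam0 iX; split.
  apply: measurable_to_conf => i; apply: measurable_maxr => //.
  exact: measurable_iexp_coord iX _.
move=> J B uJ mB.
have mB' i : measurable ((fun t => Num.max t 0) @^-1` B i).
  by rewrite -[X in measurable X]setTI; apply: measurable_maxr.
by rewrite (iX.2 J _ uJ mB'); apply: eq_bigr => i _; exact: expo_positive_part.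
Qed.

End Positivity.

Section ExitEstimates.
Variable R : realType.
Context d (T : measurableType d) (P : probability T R).
Implicit Types (X : T -> nat * nat -> R) (t eta : R).

Lemma exit_bound_tr X rho eta m n :
  iexp P X (rate rho (1 - rho)) -> (forall o s, 0 <= X o s) ->
  0 < eta -> 0 < rho -> eta *+ 2 < 1 - rho ->
  (P [set o | (g (zv (X o)) m n <= g (zh (X o)) m n)%R] <=
   (expR (eta ^+ 2 / 2 * (n%:R / ((1 - rho) * (1 - rho - eta *+ 2)) -
      m%:R / (rho + eta) ^+ 2))%R)%:E)%E.
Proof.
move=> iX X0 eta0 rho0 er.
have iY : iexp P (fun o => tr (X o)) (rate (1 - rho) (1 - (1 - rho))).
  by rewrite (_ : 1 - (1 - rho) = rho); [exact: iexp_tr|ring].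
have Y0 o s : 0 <= tr (X o) s by exact: X0.
have rho1 : 1 - rho < 1 by lra.
have := exit_bound n m iY Y0 eta0 er rho1.
have -> : 1 - (1 - rho) + eta = rho + eta by ring.
congr (P _ <= _)%E; apply/seteqP; split => o /=;
  by rewrite zv_tr zh_tr !g_tr.
Qed.

(** For [t > 0] the horizontal boundary weights are the larger ones, and paths to points near the
    diagonal are expected to use the horizontal axis. *)
Definition half_rate t : nat * nat -> R := rate (1 / 2 - t) (1 / 2 + t).

Lemma half_rateE t : half_rate t = rate (1 / 2 - t) (1 - (1 / 2 - t)).
Proof. by rewrite /half_rate; congr rate; field. Qed.

Lemma iexp_half_tr X t : iexp P X (half_rate t) ->
  iexp P (fun o => tr (X o)) (half_rate (- t)).
Proof. by move=> /iexp_tr; rewrite /half_rate opprK. Qed.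

Lemma exit_against_drift X t m n :
  iexp P X (half_rate t) -> (forall o s, 0 <= X o s) ->
  0 < t -> t <= 1 / 8 -> n%:R <= (1 + t) * m%:R ->
  (P [set o | (g (zv (X o)) m n <= g (zh (X o)) m n)%R] <=
   (expR (- (t ^+ 3 * m%:R))%R)%:E)%E.
Proof.
move=> + X0 t0 t8 nm; rewrite half_rateE => iX.
(* With the tilt [t / 2] the bracket of the bound is at most [- 8 * t * m], and the prefactor is
   [t ^+ 2 / 8]. *)
have h1 : 0 < t / 2 by lra.
have h2 : 0 < 1 / 2 - t by lra.
have h3 : t / 2 *+ 2 < 1 - (1 / 2 - t) by lra.
apply: le_trans (exit_bound_tr m n iX X0 h1 h2 h3) _.
rewrite lee_fin ler_expR.
have -> : (1 - (1 / 2 - t)) * (1 - (1 / 2 - t) - t / 2 *+ 2) = (1 + 2 * t) / 4 by field.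
have -> : (1 / 2 - t + t / 2) ^+ 2 = (1 - t) ^+ 2 / 4 by field.
have m0 : 0 <= m%:R :> R by [].
have a1 : n%:R / ((1 + 2 * t) / 4) <= 4 * m%:R.
  rewrite ler_pdivrMr; last by lra.
  have : t * m%:R >= 0 by rewrite mulr_ge0// ltW.
  by lra.
have a2 : 4 * (1 + 2 * t) * m%:R <= m%:R / ((1 - t) ^+ 2 / 4).
  rewrite ler_pdivlMr; last by rewrite divr_gt0// exprn_gt0//; lra.
  have -> : 4 * (1 + 2 * t) * m%:R * ((1 - t) ^+ 2 / 4) = ((1 + 2 * t) * (1 - t) ^+ 2) * m%:R by field.
  rewrite ler_piMl//.
  have -> : (1 + 2 * t) * (1 - t) ^+ 2 = 1 - t ^+ 2 * (3 - 2 * t) by ring.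
  rewrite lerBlDr lerDl mulr_ge0 ?sqr_ge0//; lra.
have t20 : 0 <= (t / 2) ^+ 2 / 2 by rewrite divr_ge0// sqr_ge0.
apply: (@le_trans _ _ ((t / 2) ^+ 2 / 2 * (4 * m%:R - 4 * (1 + 2 * t) * m%:R))).
  by rewrite ler_wpM2l// lerB.
rewrite le_eqVlt; apply/orP; left; apply/eqP; by field.
Qed.

(* The boundary parameter is chosen in terms of the deviation [n - m], so that
   the estimate is of the right order at every scale. *)
Lemma exit_at_scale X m n :
  (m < n)%N -> iexp P X (half_rate ((n - m)%:R / (48 * n%:R))) -> (forall o s, 0 <= X o s) ->
  (P [set o | (g (zh (X o)) m n <= g (zv (X o)) m n)%R] <=
   (expR (- ((n - m)%:R ^+ 3 / (2304 * n%:R ^+ 2)))%R)%:E)%E.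
Proof.
move=> mn + X0; set k : R := (n - m)%:R; set eta := k / _; rewrite half_rateE => iX.
have n0 : 0 < n%:R :> R by rewrite ltr0n (leq_ltn_trans _ mn).
have k0 : 0 < k by rewrite ltr0n subn_gt0.
have mE : m%:R = n%:R - k :> R by rewrite /k natrB ?(ltnW mn)// opprB addrC subrK.
have kn : k <= n%:R by rewrite ler_nat leq_subr.
have eta0 : 0 < eta by rewrite divr_gt0// mulr_gt0.
have eta48 : eta <= 1 / 48.
  by rewrite /eta ler_pdivrMr ?mulr_gt0//; lra.
have kE : k = 48 * n%:R * eta by rewrite /eta; field; lra.
have h2 : eta *+ 2 < 1 / 2 - eta by lra.
have h3 : 1 / 2 - eta < 1 by lra.
apply: le_trans (exit_bound m n iX X0 eta0 h2 h3) _.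
rewrite lee_fin ler_expR.
have -> : (1 / 2 - eta) * (1 / 2 - eta - eta *+ 2) = (1 - 2 * eta) * (1 - 6 * eta) / 4 by field.
have -> : (1 - (1 / 2 - eta) + eta) ^+ 2 = (1 + 4 * eta) ^+ 2 / 4 by field.
have m0 : 0 <= m%:R :> R by [].
have d0 : 0 < (1 - 2 * eta) * (1 - 6 * eta) by rewrite mulr_gt0//; lra.
have d1 : 0 < (1 + 4 * eta) ^+ 2 by rewrite exprn_gt0//; lra.
have e2 : eta ^+ 2 <= eta / 48 by rewrite expr2 ler_wpM2l//; lra.
have e20 : 0 <= eta ^+ 2 by exact: sqr_ge0.
have e3 : 0 <= eta ^+ 3 by rewrite exprn_ge0// ltW.
have a1 : m%:R / ((1 - 2 * eta) * (1 - 6 * eta) / 4) <= 4 * (1 + 16 * eta) * m%:R.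
  rewrite ler_pdivrMr; last by rewrite divr_gt0.
  have -> : 4 * (1 + 16 * eta) * m%:R * ((1 - 2 * eta) * (1 - 6 * eta) / 4) =
      ((1 + 16 * eta) * ((1 - 2 * eta) * (1 - 6 * eta))) * m%:R by field.
  rewrite ler_peMl//.
  have -> : (1 + 16 * eta) * ((1 - 2 * eta) * (1 - 6 * eta)) = 1 + (8 * eta - 116 * eta ^+ 2 + 192 * eta ^+ 3) by ring.
  by rewrite lerDl; lra.
have a2 : 4 * (1 - 8 * eta) * n%:R <= n%:R / ((1 + 4 * eta) ^+ 2 / 4).
  rewrite ler_pdivlMr; last by rewrite divr_gt0.
  have -> : 4 * (1 - 8 * eta) * n%:R * ((1 + 4 * eta) ^+ 2 / 4) = ((1 - 8 * eta) * (1 + 4 * eta) ^+ 2) * n%:R by field.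
  rewrite ler_piMl//.
  have -> : (1 - 8 * eta) * (1 + 4 * eta) ^+ 2 = 1 - (48 * eta ^+ 2 + 128 * eta ^+ 3) by ring.
  by rewrite lerBlDr lerDl; lra.
have t20 : 0 <= eta ^+ 2 / 2 by rewrite divr_ge0.
apply: (@le_trans _ _ (eta ^+ 2 / 2 * (4 * (1 + 16 * eta) * m%:R - 4 * (1 - 8 * eta) * n%:R))).
  by rewrite ler_wpM2l// lerB.
(* The two linearisations cost at most [96 * eta * n], which is [2 * k] for [eta = k / (48 * n)];
   half of the main term [- 4 * k] survives. The constant 2304 is the square of 48. *)
have -> : 4 * (1 + 16 * eta) * m%:R - 4 * (1 - 8 * eta) * n%:R = - 2 * k - 64 * eta * k.
  by rewrite mE kE; ring.
apply: (@le_trans _ _ (eta ^+ 2 / 2 * (- 2 * k))).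
  rewrite ler_wpM2l// lerBlDr lerDl.
  by rewrite !mulr_ge0// ltW.
rewrite le_eqVlt; apply/orP; left; apply/eqP; rewrite /eta; field; lra.
Qed.

End ExitEstimates.

(** * Comparison of increments with the stationary model *)

Section Boole.
Context d (T : measurableType d) (R : realType) (P : probability T R).

Lemma measurable_exists_seq (I : eqType) (s : seq I) (A : I -> set T) :
  (forall i, measurable (A i)) -> measurable [set o | exists2 i, i \in s & A i o].
Proof.
move=> mA; elim: s => [|i s IH].
  by rewrite (_ : [set _ | _] = set0)//; apply/seteqP; split => // o [].
rewrite (_ : [set _ | _] = A i `|` [set o | exists2 i, i \in s & A i o]).
  exact: measurableU.
apply/seteqP; split => o /=.
  by move=> [j]; rewrite inE => /orP[/eqP ->|js] Aj; [left|right; exists j].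
by move=> [Ai|[j js Aj]]; [exists i => //; exact: mem_head|exists j => //; rewrite inE js orbT].
Qed.

Lemma boole_seq (I : eqType) (s : seq I) (A : I -> set T) (c : I -> R) :
  (forall i, measurable (A i)) -> (forall i, i \in s -> P (A i) <= (c i)%:E)%E ->
  (P [set o | exists2 i, i \in s & A i o] <= (\sum_(i <- s) c i)%:E)%E.
Proof.
move=> mA; elim: s => [|i s IH] Ac.
  rewrite big_nil (_ : [set _ | _] = set0) ?measure0//.
  by apply/seteqP; split => // o [].
rewrite big_cons (_ : [set _ | _] = A i `|` [set o | exists2 i, i \in s & A i o]).
  apply: le_trans (measureU2 _ _ _) _ => //; first exact: measurable_exists_seq.
  rewrite EFinD leeD ?Ac ?mem_head// IH// => j js.
  by rewrite Ac// inE js orbT.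
apply/seteqP; split => o /=.
  by move=> [j]; rewrite inE => /orP[/eqP ->|js] Aj; [left|right; exists j].
by move=> [Ai|[j js Aj]]; [exists i => //; exact: mem_head|exists j => //; rewrite inE js orbT].
Qed.

Lemma prob_bigcup_nondecreasing (A : (set T)^nat) (c : \bar R) :
  (forall n, measurable (A n)) -> (forall n, A n `<=` A n.+1) ->
  (forall n, (P (A n) <= c)%E) -> (P (\bigcup_n A n) <= c)%E.
Proof.
move=> mA ndA Ac.
have nd : nondecreasing_seq A by apply/nondecreasing_seqP => n; exact/subsetPset.
have cv := @nondecreasing_cvg_mu _ _ _ P A mA (bigcupT_measurable _ mA) nd.
rewrite -(cvg_lim _ cv)//; apply: lime_le; first by apply/cvg_ex; eexists; exact: cv.
by near=> n; exact: Ac.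
Unshelve. all: by end_near. Qed.

End Boole.

Section SiteModel.
Variable R : realType.
Local Notation S := (conf (int * int)%type R).
Implicit Types (w : int * int -> R) (y v V z : int * int) (a b i j p q n K N M : nat).

Definition pos w z : R := Num.max (w z) 0.

Lemma pos_ge0 w z : 0 <= pos w z.
Proof. by rewrite /pos le_max lexx orbT. Qed.

(** The quadrant is seen from its far corner: [(1, 1)] is [V] itself and indices grow towards the
    south-west, so the axes are the row and the column just beyond [V]. *)
Definition cor V (s : nat * nat) : int * int :=
  (V.1 + 1 - (s.1)%:Z, V.2 + 1 - (s.2)%:Z).

Lemma cor_inj V : injective (cor V).
Proof. by move=> [i j] [i' j'] [/= h1 h2]; congr pair; lia. Qed.

(** Dividing the weights of the axes by their rates couples the models of all parameters, with a
    common bulk and boundary weights monotone in [t]. *)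
Definition st (t : R) w V : nat * nat -> R := fun s => pos w (cor V s) / half_rate t s.

Definition pure w V : nat * nat -> R := zh (zv (fun s => pos w (cor V s))).

Definition shift y a b : int * int := (y.1 + a%:Z, y.2 + b%:Z).

(** The last-passage time towards [shift y a b] from [y + e2] minus the one from [y + e1] (see
    [difE]): its sign decides the first step of the geodesic. *)
Definition dif w y a b : R :=
  hI (pure w (shift y a b)) a b - vJ (pure w (shift y a b)) a b.

Lemma half_rate_gt0 (t : R) s : - (1 / 2) < t < 1 / 2 -> 0 < half_rate t s.
Proof. by move=> /andP[t1 t2]; apply: rate_gt0; lra. Qed.

Lemma st_ge0 t w V s : - (1 / 2) < t < 1 / 2 -> 0 <= st t w V s.
Proof. by move=> ht; rewrite divr_ge0 ?pos_ge0// ltW// half_rate_gt0. Qed.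

Lemma pure_ge0 w V s : 0 <= pure w V s.
Proof. by rewrite /pure /zh /zv; case: ifP => //; case: ifP => // _ _; exact: pos_ge0. Qed.

Lemma pure_off t w V p q v : V = shift v p q ->
  zh (zv (off (st t w V) p q)) = pure w v.
Proof.
move=> ->; apply/funext => -[[|i] [|j]] //.
rewrite /pure /zh /zv /= /st /half_rate !addnS /= divr1; congr (pos w _).
by rewrite /cor /shift /=; congr pair; lia.
Qed.

Lemma measurable_pos z : measurable_fun setT (fun w : S => pos w z).
Proof. by apply: measurable_maxr; [exact: measurable_coord|exact: measurable_cst]. Qed.

Lemma measurable_st t V : measurable_fun setT (fun w : S => st t w V : conf (nat * nat)%type R).
Proof.
by apply: measurable_to_conf => s; apply: measurable_funM; [exact: measurable_pos|exact: measurable_cst].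
Qed.

Lemma measurable_pure V : measurable_fun setT (fun w : S => pure w V : conf (nat * nat)%type R).
Proof.
apply: measurable_to_conf => s; rewrite /pure /zh /zv.
case: (s.2 == 0%N); first exact: measurable_cst.
by case: (s.1 == 0%N); [exact: measurable_cst|exact: measurable_pos].
Qed.

Lemma measurable_dif y a b : measurable_fun setT (fun w : S => dif w y a b).
Proof.
apply: measurable_funB.
  exact: (measurableT_comp (measurable_hI a b) (measurable_pure _)).
exact: (measurableT_comp (measurable_vJ a b) (measurable_pure _)).
Qed.

Definition dif_st t w y M : R :=
  hI (st t w (shift y M M)) M M - vJ (st t w (shift y M M)) M M.

(* The stationary geodesic started at the site with coordinates (a, b) seen
   from the corner shift y a b exits through the unexpected side. *)
Definition bad_exit t y M (c e : nat * nat) : set S :=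
  let o w := off (st t w (shift y M M)) (M - c.1) (M - c.2) in
  [set w | g (zv (o w)) e.1 e.2 <= g (zh (o w)) e.1 e.2].

Definition bad_exit' t y M (c e : nat * nat) : set S :=
  let o w := off (st t w (shift y M M)) (M - c.1) (M - c.2) in
  [set w | g (zh (o w)) e.1 e.2 <= g (zv (o w)) e.1 e.2].

Definition bad t y M (c : nat * nat) : set S :=
  (bad_exit t y M c c `|` bad_exit t y M c (c.1, c.2.+1)) `|`
  (bad_exit' (- t) y M c (c.1.+1, c.2) `|` bad_exit' (- t) y M c c).

Lemma measurable_off_st t V p q :
  measurable_fun setT (fun w : S => off (st t w V) p q : conf (nat * nat)%type R).
Proof. exact: (measurableT_comp (@measurable_off R _ _) (measurable_st t _)). Qed.

Lemma measurable_bad_exit t y M c e : measurable (bad_exit t y M c e).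
Proof. by case: (measurable_exit e.1 e.2 (measurable_off_st t (shift y M M) (M - c.1) (M - c.2))). Qed.

Lemma measurable_bad_exit' t y M c e : measurable (bad_exit' t y M c e).
Proof. by case: (measurable_exit e.1 e.2 (measurable_off_st t (shift y M M) (M - c.1) (M - c.2))). Qed.

Lemma measurable_bad t y M c : measurable (bad t y M c).
Proof.
by apply: measurableU; apply: measurableU;
  (exact: measurable_bad_exit || exact: measurable_bad_exit').
Qed.

(** The bounds do not involve [(a, b)]: the increments of the model with corner [shift y M M] are
    boundary data for every smaller corner [shift y a b], so one model is compared with all these
    corners at once. *)
Lemma dif_sandwich t w y M a b : 0 < t < 1 / 2 -> (a <= M)%N -> (b <= M)%N ->
  ~ bad t y M (a, b) w -> dif_st (- t) w y M <= dif w y a b <= dif_st t w y M.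
Proof.
move=> /andP[t0 t2] aM bM nb.
have ht : - (1 / 2) < t < 1 / 2 by apply/andP; split; lra.
have ht' : - (1 / 2) < - t < 1 / 2 by apply/andP; split; lra.
have VE : shift y M M = shift (shift y a b) (M - a) (M - b).
  by rewrite /shift /=; congr pair; lia.
pose o1 := off (st t w (shift y M M)) (M - a) (M - b).
pose o2 := off (st (- t) w (shift y M M)) (M - a) (M - b).
have o10 s : 0 <= o1 s by apply: off_ge0 => s'; exact: st_ge0.
have o20 s : 0 <= o2 s by apply: off_ge0 => s'; exact: st_ge0.
have n1 : g (zh o1) a b <= g (zv o1) a b.
  by rewrite leNgt; apply/negP => /ltW h; apply: nb; left; left.
have n2 : g (zh o1) a b.+1 <= g (zv o1) a b.+1.
  by rewrite leNgt; apply/negP => /ltW h; apply: nb; left; right.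
have n3 : g (zv o2) a.+1 b <= g (zh o2) a.+1 b.
  by rewrite leNgt; apply/negP => /ltW h; apply: nb; right; left.
have n4 : g (zv o2) a b <= g (zh o2) a b.
  by rewrite leNgt; apply/negP => /ltW h; apply: nb; right; right.
have := hI_pure_le o10 n1; have := vJ_pure_ge o10 n2.
have := hI_pure_ge o20 n3; have := vJ_pure_le o20 n4.
rewrite !(pure_off _ _ VE) !hI_off !vJ_off !subnK//.
rewrite /dif_st /dif; lra.
Qed.

Variable mu : probability S R.
Hypothesis hmu : iexp mu (fun w => w) (fun=> 1).

Lemma iexp_st t V : - (1 / 2) < t < 1 / 2 -> iexp mu (fun w => st t w V) (half_rate t).
Proof.
move=> ht.
have h1 := iexp_pos (fun=> ltr01) hmu.
have := iexp_reindex h1 (fun s => (half_rate t s)^-1) (@cor_inj V).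
congr (iexp mu _ _); apply/funext => s.
by rewrite invrK mul1r.
Qed.

Lemma iexp_off_st t V p q : - (1 / 2) < t < 1 / 2 ->
  iexp mu (fun w => off (st t w V) p q) (half_rate t).
Proof.
move=> ht; have /andP[t1 t2] := ht.
have h1 : 0 < 1 / 2 - t by lra.
have h2 : 0 < 1 / 2 + t by lra.
have h3 : (1 / 2 - t) + (1 / 2 + t) = 1 by field.
exact: (iexp_off p q h1 h2 h3 (iexp_st V ht)).
Qed.

Lemma prob_bad_exit t y M c e : 0 < t <= 1 / 8 -> e.2%:R <= (1 + t) * e.1%:R :> R ->
  (mu (bad_exit t y M c e) <= (expR (- (t ^+ 3 * e.1%:R))%R)%:E)%E.
Proof.
move=> /andP[t0 t8] he; have ht : - (1 / 2) < t < 1 / 2 by apply/andP; split; lra.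
apply: (exit_against_drift (iexp_off_st (shift y M M) (M - c.1) (M - c.2) ht)) => // w s.
by apply: off_ge0 => s'; exact: st_ge0.
Qed.

Lemma prob_bad_exit' t y M c e : 0 < t <= 1 / 8 -> e.1%:R <= (1 + t) * e.2%:R :> R ->
  (mu (bad_exit' (- t) y M c e) <= (expR (- (t ^+ 3 * e.2%:R))%R)%:E)%E.
Proof.
move=> /andP[t0 t8] he; have ht : - (1 / 2) < - t < 1 / 2 by apply/andP; split; lra.
have := iexp_half_tr (iexp_off_st (shift y M M) (M - c.1) (M - c.2) ht).
rewrite opprK => iX.
have X0 w s : 0 <= tr (off (st (- t) w (shift y M M)) (M - c.1) (M - c.2)) s.
  by apply: off_ge0 => s'; exact: st_ge0.
have := exit_against_drift iX X0 t0 t8 he.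
by congr (mu _ <= _)%E; apply/seteqP; split => w /=; rewrite zv_tr zh_tr !g_tr.
Qed.

Definition cone K N a b := [&& N <= a, N <= b, K * b <= K.+1 * a & K * a <= K.+1 * b]%N.

Lemma prob_bad K N y M a b : (16 <= K)%N -> (K <= N)%N -> cone K N a b ->
  (mu (bad (2 / K%:R) y M (a, b)) <= (4 * (expR (- ((2 / K%:R) ^+ 3 / 3)) ^+ a *
     expR (- ((2 / K%:R) ^+ 3 / 3)) ^+ b)%R)%:E)%E.
Proof.
move=> K16 KN /and4P[Na Nb h1 h2].
set t : R := 2 / K%:R.
have K0 : 0 < K%:R :> R by rewrite ltr0n; lia.
have t0 : 0 < t by rewrite divr_gt0.
have t8 : t <= 1 / 8.
  have : 16%:R <= K%:R :> R by rewrite ler_nat.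
  by rewrite /t ler_pdivrMr//; lra.
have tt : 0 < t <= 1 / 8 by rewrite t0.
(* The cone has aperture [1 / K] whereas [t = 2 / K]; the spare [1 / K] pays for the extra row or
   column of the exit points, because [K <= u]. *)
have scale (u v : nat) : (K <= u)%N -> (K * v <= K.+1 * u)%N -> v.+1%:R <= (1 + t) * u%:R :> R.
  move=> Ku uv; rewrite -(ler_pM2l K0).
  have -> : K%:R * ((1 + t) * u%:R) = (K%:R + 2) * u%:R by rewrite /t; field; lra.
  rewrite -natrM -natrD -natrM ler_nat; lia.
have scale' (u v : nat) : v.+1%:R <= (1 + t) * u%:R :> R -> v%:R <= (1 + t) * u%:R :> R.
  by apply: le_trans; rewrite ler_nat.
have cab : b.+1%:R <= (1 + t) * a%:R :> R by apply: scale => //; lia.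
have cba : a.+1%:R <= (1 + t) * b%:R :> R by apply: scale => //; lia.
set r := expR _.
have t3 : 0 <= t ^+ 3 by rewrite exprn_ge0// ltW.
(* In the cone [a + b] is at most three times either coordinate; the product form turns sums over
   squares into products of geometric series. *)
have rab (u : nat) : (a + b <= 3 * u)%N -> expR (- (t ^+ 3 * u%:R)) <= r ^+ a * r ^+ b.
  move=> hu; rewrite /r -exprD -expRM_natl ler_expR.
  have : (a + b)%:R <= 3 * u%:R :> R by rewrite -natrM ler_nat.
  move=> /(ler_wpM2l t3); lra.
have ha : (a + b <= 3 * a)%N by nia.
have hb : (a + b <= 3 * b)%N by nia.
have e1 := le_trans (prob_bad_exit y M (a, b) tt (e := (a, b)) (scale' _ _ cab)) (rab a ha : (_%:E <= _%:E)%E).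
have e2 := le_trans (prob_bad_exit y M (a, b) tt (e := (a, b.+1)) cab) (rab a ha : (_%:E <= _%:E)%E).
have e3 := le_trans (prob_bad_exit' y M (a, b) tt (e := (a.+1, b)) cba) (rab b hb : (_%:E <= _%:E)%E).
have e4 := le_trans (prob_bad_exit' y M (a, b) tt (e := (a, b)) (scale' _ _ cba)) (rab b hb : (_%:E <= _%:E)%E).
have mE t' c e := measurable_bad_exit t' y M c e.
have mE' t' c e := measurable_bad_exit' t' y M c e.
apply: le_trans (measureU2 _ _ _) _; [exact: measurableU|exact: measurableU|].
apply: le_trans (leeD (measureU2 _ (mE _ _ _) (mE _ _ _)) (measureU2 _ (mE' _ _ _) (mE' _ _ _))) _.
apply: le_trans (leeD (leeD e1 e2) (leeD e3 e4)) _.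
by rewrite -!EFinD lee_fin; lra.
Qed.

End SiteModel.

Section ExponentialComparison.
Context (I : eqType) (R : realType) d (T : measurableType d) (P : probability T R).

Lemma iexp_laplace (X : T -> I -> R) lam i : iexp P X lam -> 0 < lam i ->
  (\int[P]_o (expR (- X o i))%:E = (lam i / (lam i + 1))%:E)%E.
Proof.
move=> iX l0.
have posK k : k \in [:: i] -> 0 < lam k /\ 0 < lam k + 1.
  by rewrite inE => /eqP ->; split => //; rewrite addr_gt0.
have iU := iexp_upd iX i (lam i + 1).
have iY : iexp (P \x expo (lam i + 1) : probability _ _)%E (fun p => upd (X p.1) i p.2)
    (fun k => if k \in [:: i] then lam k + 1 else lam k).
  congr (iexp _ _ _): iU; apply/funext => k; rewrite inE /upd.
  by case: eqP => // ->.
have h := iexp_tilt (lam' := fun k => lam k + 1) (F := fun=> 1%E) (isT : uniq [:: i])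
  iX iY posK (measurable_cst _) (fun=> lee01).
transitivity ((\prod_(k <- [:: i]) (lam k / (lam k + 1)))%:E * 1 : \bar R)%E.
  rewrite (_ : (1 = \int[P \x expo (lam i + 1)]_o 1)%E); last first.
    by rewrite integral_cst// mul1e; apply/esym; exact: probability_setT.
  rewrite -h; apply: eq_integral => o _; rewrite mul1e big_seq1.
  by congr (expR _)%:E; ring.
by rewrite big_seq1 mule1.
Qed.

(** Ordered variables with nearly equal laws are close: [expR (- U) - expR (- Z)] is nonnegative
    with mean at most [l2 - l1], and a gap above [eta] makes it at least [expR (- t) * eta] unless
    [Z] exceeds [t]. Markov's inequality concludes. *)
Lemma gap_bound (U Z : T -> R) (l1 l2 t eta : R) :
  measurable_fun setT U -> measurable_fun setT Z -> (forall o, U o <= Z o) ->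
  1 / 4 <= l1 -> l1 <= l2 -> 0 < eta -> 0 <= t ->
  (\int[P]_o (expR (- U o))%:E = (l2 / (l2 + 1))%:E)%E ->
  (\int[P]_o (expR (- Z o))%:E = (l1 / (l1 + 1))%:E)%E ->
  P [set o | t < Z o] = (expR (- l1 * t))%:E ->
  (P [set o | (eta < Z o - U o)%R] <=
   (expR (- (t / 4)) + (l2 - l1) * expR t / eta)%:E)%E.
Proof.
move=> mU mZ UZ l14 l12 eta0 t0 EU EZ PZ.
have mexp (V : T -> R) : measurable_fun setT V -> measurable_fun setT (fun o => (expR (- V o))%:E).
  by move=> mV; apply/measurable_EFinP; do 2 apply: measurableT_comp => //.
pose f o := (expR (- U o) - expR (- Z o))%:E.
have f0 o : (0 <= f o)%E by rewrite lee_fin subr_ge0 ler_expR lerN2.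
have mf : measurable_fun setT f.
  by apply/measurable_EFinP; apply: measurable_funB; do 2 apply: measurableT_comp => //.
have Ef : (\int[P]_o f o <= (l2 - l1)%:E)%E.
  have e : (\int[P]_o f o + \int[P]_o (expR (- Z o))%:E = \int[P]_o (expR (- U o))%:E)%E.
    have mZ' := mexp Z mZ.
    rewrite -ge0_integralD//.
    by apply: eq_integral => o _; rewrite -EFinD subrK.
  rewrite EU EZ in e.
  have -> : (\int[P]_o f o = (l2 / (l2 + 1) - l1 / (l1 + 1))%:E)%E.
    have i0 : (0 <= \int[P]_o f o)%E by exact: integral_ge0.
    move: e i0; case: (\int[P]_o f o)%E => [r| |]//= [] <- _.
    by rewrite addrK.
  rewrite lee_fin.
  have -> : l2 / (l2 + 1) - l1 / (l1 + 1) = (l2 - l1) / ((l2 + 1) * (l1 + 1)) by field; lra.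
  rewrite ler_pdivrMr; last by rewrite mulr_gt0//; lra.
  rewrite ler_peMr//; first by rewrite subr_ge0.
  have : 1 * 1 <= (l2 + 1) * (l1 + 1) by apply: ler_pM => //; lra.
  by rewrite mulr1.
pose c := expR (- t) * eta.
have c0 : 0 < c by rewrite mulr_gt0// expR_gt0.
have mD : measurable [set o | eta < Z o - U o].
  rewrite -[X in measurable X]setTI.
  by apply: (measurable_fun_ltr (measurable_cst _)) => //; exact: measurable_funB.
have mT : measurable [set o | t < Z o].
  by rewrite -[X in measurable X]setTI; apply: (measurable_fun_ltr (measurable_cst _)).
have mF : measurable [set o | c%:E <= f o]%E.
  by rewrite -[X in measurable X]setTI; exact: emeasurable_fun_c_infty.
apply: (@le_trans _ _ (P ([set o | t < Z o] `|` [set o | (c%:E <= f o)%E]))).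
  apply: le_measure; rewrite ?inE//; first exact: measurableU.
  move=> o /= h; have [Zt|tZ] := leP (Z o) t; [right|by left].
  rewrite lee_fin /c.
  have -> : expR (- U o) - expR (- Z o) = expR (- Z o) * (expR (Z o - U o) - 1).
    by rewrite mulrBr -expRD mulr1; congr (expR _ - _); ring.
  apply: ler_pM; rewrite ?expR_ge0 ?ler_expR ?lerN2 ?(ltW eta0)//.
  by have := expR_ge1Dx (Z o - U o); lra.
have PZ' : (P [set o | (t < Z o)%R] <= (expR (- (t / 4)))%:E)%E.
  rewrite PZ lee_fin ler_expR mulNr lerN2.
  by have := ler_wpM2r t0 l14; lra.
apply: le_trans (measureU2 _ _ _) _ => //; rewrite EFinD; apply: (leeD PZ').
have mk : (c%:E * P [set o | (c%:E <= f o)%E] <= \int[P]_o f o)%E.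
  have := le_integral_abse P measurableT mf c0.
  have e : [set o | (c%:E <= `|f o|)%E] = [set o | (c%:E <= f o)%E].
    by apply/seteqP; split => o; rewrite /mkset gee0_abs.
  by rewrite setTI e (eq_integral f)// => o _; rewrite gee0_abs.
have PcE : P [set o | (c%:E <= f o)%E] = (fine (P [set o | (c%:E <= f o)%E]))%:E.
  by rewrite fineK// fin_num_measure.
move: (le_trans mk Ef); rewrite PcE -EFinM !lee_fin => h.
have h' : fine (P [set o | (c%:E <= f o)%E]) <= (l2 - l1) * expR t / eta; last first.
  by rewrite -lee_fin in h'; apply: le_trans h'; rewrite fineK// fin_num_measure.
rewrite -(ler_pM2l c0); apply: (le_trans h).
rewrite /c [leRHS](_ : _ = (expR (- t) * expR t) * (l2 - l1)); last by field; lra.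
by rewrite -expRD addNr expR0 mul1r.
Qed.

End ExponentialComparison.

(** * Oscillation of the differences inside cones *)

Section Oscillation.
Variable R : realType.
Local Notation S := (conf (int * int)%type R).
Implicit Types (w : int * int -> R) (y V : int * int) (b i j m N M : nat).
Variable mu : probability S R.
Hypothesis hmu : iexp mu (fun w => w) (fun=> 1).

Lemma dif_st_mono (t : R) w y M : 0 < t < 1 / 2 ->
  hI (st (- t) w (shift y M M)) M M <= hI (st t w (shift y M M)) M M /\
  vJ (st t w (shift y M M)) M M <= vJ (st (- t) w (shift y M M)) M M.
Proof.
move=> /andP[t0 t2].
have mon (l l' u : R) : 0 <= u -> 0 < l -> l <= l' -> u / l' <= u / l.
  by move=> u0 l0 ll'; rewrite ler_wpM2l// lef_pV2// posrE//; lra.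
have bulk : agree_bulk (st (- t) w (shift y M M)) (st t w (shift y M M)) by [].
have hor i : st (- t) w (shift y M M) (i.+1, 0)%N <= st t w (shift y M M) (i.+1, 0)%N.
  by apply: mon; rewrite ?pos_ge0//=; lra.
have ver j : st t w (shift y M M) (0, j.+1)%N <= st (- t) w (shift y M M) (0, j.+1)%N.
  by apply: mon; rewrite ?pos_ge0//=; lra.
by have [h1 h2] := increments_mono bulk hor ver M; split.
Qed.

Lemma measurable_hI_st (t : R) V i j : measurable_fun setT (fun w : S => hI (st t w V) i j).
Proof. exact: (measurableT_comp (measurable_hI i j) (measurable_st t V)). Qed.

Lemma measurable_vJ_st (t : R) V i j : measurable_fun setT (fun w : S => vJ (st t w V) i j).
Proof. exact: (measurableT_comp (measurable_vJ i j) (measurable_st t V)). Qed.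

Lemma prob_gap (t T eta : R) y M : 0 < t <= 1 / 8 -> 0 <= T -> 0 < eta ->
  (mu [set w | (eta *+ 2 < dif_st t w y M - dif_st (- t) w y M)%R] <=
   ((expR (- (T / 4)) + (t *+ 2) * expR T / eta) *+ 2)%:E)%E.
Proof.
move=> /andP[t0 t8] T0 eta0.
have ht : 0 < t < 1 / 2 by apply/andP; split; lra.
have h1 : - (1 / 2) < t < 1 / 2 by apply/andP; split; lra.
have h2 : - (1 / 2) < - t < 1 / 2 by apply/andP; split; lra.
have i1 := iexp_off_st hmu (shift y M M) M M h1.
have i2 := iexp_off_st hmu (shift y M M) M M h2.
have hIE s w : off (st s w (shift y M M)) M M (1, 0)%N = hI (st s w (shift y M M)) M M.
  by rewrite /= addn0.
have vJE s w : off (st s w (shift y M M)) M M (0, 1)%N = vJ (st s w (shift y M M)) M M.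
  by rewrite /= addn0.
have tail (s : R) (c : nat * nat) X : - (1 / 2) < s < 1 / 2 -> iexp mu X (half_rate s) ->
    mu [set w | T < X w c] = (expR (- half_rate s c * T))%:E.
  move=> hs iX; have := iexp_coord iX c (measurable_itv `]T, +oo[).
  rewrite (expo_tail T (half_rate_gt0 c hs)) (max_idPl T0) => <-; congr (mu _).
  by apply/seteqP; split => w /=; rewrite in_itv/= andbT.
have l1 : 1 / 4 <= 1 / 2 - t by lra.
have l2 : 1 / 2 - t <= 1 / 2 + t by lra.
have b1 : (mu [set w | (eta < hI (st t w (shift y M M)) M M - hI (st (- t) w (shift y M M)) M M)%R] <=
   (expR (- (T / 4)) + (1 / 2 + t - (1 / 2 - t)) * expR T / eta)%:E)%E.
  apply: (gap_bound (t := T)) => //.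
  - exact: measurable_hI_st.
  - exact: measurable_hI_st.
  - by move=> w; have [] := dif_st_mono w y M ht.
  - have := iexp_laplace (i := (1, 0)%N) i2 (half_rate_gt0 _ h2).
    under eq_integral do rewrite hIE; by rewrite /half_rate /= opprK.
  - have := iexp_laplace (i := (1, 0)%N) i1 (half_rate_gt0 _ h1).
    by under eq_integral do rewrite hIE.
  - have := tail t (1, 0)%N _ h1 i1.
    by under eq_set do rewrite hIE.
have b2 : (mu [set w | (eta < vJ (st (- t) w (shift y M M)) M M - vJ (st t w (shift y M M)) M M)%R] <=
   (expR (- (T / 4)) + (1 / 2 + t - (1 / 2 - t)) * expR T / eta)%:E)%E.
  apply: (gap_bound (t := T)) => //.
  - exact: measurable_vJ_st.
  - exact: measurable_vJ_st.
  - by move=> w; have [] := dif_st_mono w y M ht.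
  - have := iexp_laplace (i := (0, 1)%N) i1 (half_rate_gt0 _ h1).
    by under eq_integral do rewrite vJE.
  - have := iexp_laplace (i := (0, 1)%N) i2 (half_rate_gt0 _ h2).
    by under eq_integral do rewrite vJE.
  - have := tail (- t) (0, 1)%N _ h2 i2.
    by under eq_set do rewrite vJE.
have e : 1 / 2 + t - (1 / 2 - t) = t *+ 2 by ring.
rewrite e in b1 b2.
have mlt (f g : S -> R) : measurable_fun setT f -> measurable_fun setT g ->
    measurable [set w | eta < f w - g w].
  move=> mf mg; rewrite -[X in measurable X]setTI.
  by apply: (measurable_fun_ltr (measurable_cst _)) => //; exact: measurable_funB.
have m1 := mlt _ _ (measurable_hI_st t (shift y M M) M M) (measurable_hI_st (- t) (shift y M M) M M).
have m2 := mlt _ _ (measurable_vJ_st (- t) (shift y M M) M M) (measurable_vJ_st t (shift y M M) M M).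
rewrite mulr2n EFinD; apply: le_trans (leeD b1 b2).
apply: le_trans (measureU2 _ m1 m2); apply: le_measure; rewrite ?inE//; last 2 first.
- exact: measurableU.
- move=> w /=; rewrite /dif_st => h.
  case: (ltP eta (hI (st t w (shift y M M)) M M - hI (st (- t) w (shift y M M)) M M)) => h'; first by left.
  by right; lra.
rewrite -[X in measurable X]setTI.
apply: (measurable_fun_ltr (measurable_cst _)) => //.
by apply: measurable_funB; apply: measurable_funB;
  (exact: measurable_hI_st || exact: measurable_vJ_st).
Qed.

End Oscillation.

Section RealFacts.
Variable R : realType.

Lemma geometric_tail (r : R) N n : 0 <= r < 1 ->
  \sum_(i <- iota N n) r ^+ i <= r ^+ N / (1 - r).
Proof.
move=> /andP[r0 r1]; rewrite ler_pdivlMr ?subr_gt0//.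
elim: n N => [|n IH] N; first by rewrite big_nil mul0r exprn_ge0.
rewrite /= big_cons mulrDl; have := IH N.+1; rewrite exprS; lra.
Qed.

Lemma expRN_pow_small (c e : R) : 0 < c -> 0 < e ->
  exists N0 : nat, forall N, (N0 <= N)%N -> expR (- c) ^+ N <= e.
Proof.
move=> c0 e0; exists (Num.bound (c * e)^-1) => N hN.
have bN : (c * e)^-1 < N%:R.
  apply: lt_le_trans (archi_boundP _) _; last by rewrite ler_nat.
  by rewrite invr_ge0 mulr_ge0// ltW.
have N0 : 0 < N%:R :> R by apply: le_lt_trans bN; rewrite invr_ge0 mulr_ge0// ltW.
rewrite -expRM_natl mulrN expRN.
have h : N%:R * c <= expR (N%:R * c) by have := expR_ge1Dx (N%:R * c); lra.
apply: (@le_trans _ _ (N%:R * c)^-1).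
  by rewrite lef_pV2// posrE ?expR_gt0// mulr_gt0.
rewrite -(ler_pM2l (mulr_gt0 N0 c0)) divff ?gt_eqF ?mulr_gt0//.
by move: bN; rewrite -(ltr_pM2l (mulr_gt0 c0 e0)) divff ?gt_eqF ?mulr_gt0//; lra.
Qed.

End RealFacts.

Section Cauchy.
Variable R : realType.
Local Notation S := (conf (int * int)%type R).
Implicit Types (w : int * int -> R) (y : int * int) (a b i n K N M : nat).
Variable mu : probability S R.
Hypothesis hmu : iexp mu (fun w => w) (fun=> 1).

Definition square N n : seq (nat * nat) := [seq (a, b) | a <- iota N n, b <- iota N n].

Lemma mem_square N n a b :
  ((a, b) \in square N n) = [&& (N <= a < N + n)%N & (N <= b < N + n)%N].
Proof.
rewrite /square; apply/allpairsP/idP => [[[a' b'] /= [ha hb [-> ->]]]|/andP[ha hb]].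
  by rewrite -!mem_iota ha.
by exists (a, b); rewrite /= !mem_iota.
Qed.

Definition bad_cone K N n y M : set S :=
  [set w | exists2 c, c \in square N n & cone K N c.1 c.2 /\ bad (2 / K%:R) y M c w].

Lemma measurable_bad_in_cone K N y M c :
  measurable [set w : S | cone K N c.1 c.2 /\ bad (2 / K%:R) y M c w].
Proof.
case: (cone K N c.1 c.2).
  by rewrite (_ : [set _ | _] = bad (2 / K%:R) y M c);
    [exact: measurable_bad|apply/seteqP; split => // w []].
by rewrite (_ : [set _ | _] = set0)//; apply/seteqP; split => // w [].
Qed.

Lemma prob_bad_cone K N n y M : (16 <= K)%N -> (K <= N)%N ->
  (mu (bad_cone K N n y M) <= (4 * (expR (- ((2 / K%:R) ^+ 3 / 3)) ^+ N /
     (1 - expR (- ((2 / K%:R) ^+ 3 / 3)))) ^+ 2)%:E)%E.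
Proof.
move=> K16 KN; set r := expR _.
have K0 : 0 < K%:R :> R by rewrite ltr0n; lia.
have r01 : 0 <= r < 1.
  rewrite expR_ge0 /= -expR0 ltr_expR oppr_lt0 divr_gt0// exprn_gt0// divr_gt0//.
have := boole_seq (s := square N n) (c := fun c => 4 * (r ^+ c.1 * r ^+ c.2)) (P := mu)
  (fun c => measurable_bad_in_cone K N y M c).
move=> /(_ _)/le_trans; apply => //.
  move=> [a b] _ /=; case: (boolP (cone K N a b)) => cab.
    rewrite (_ : [set _ | _] = bad (2 / K%:R) y M (a, b)).
      exact: (prob_bad hmu y M K16 KN cab).
    by apply/seteqP; split => // w [].
  rewrite (_ : [set _ | _] = set0) ?measure0; last by apply/seteqP; split => // w [].
  by rewrite lee_fin !mulr_ge0// exprn_ge0//; case/andP: r01.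
rewrite lee_fin -mulr_sumr ler_wpM2l//.
rewrite big_allpairs_dep /=.
under eq_bigr do rewrite -mulr_sumr.
rewrite -mulr_suml expr2.
have s0 : 0 <= \sum_(i <- iota N n) r ^+ i.
  by apply: sumr_ge0 => i _; rewrite exprn_ge0//; case/andP: r01.
by apply: ler_pM => //; exact: geometric_tail.
Qed.

Definition oscillates K N (e : R) y (n : nat) : set S :=
  [set w | exists2 c : (nat * nat) * (nat * nat),
     c \in [seq (c1, c2) | c1 <- square N n, c2 <- square N n] &
     [/\ cone K N c.1.1 c.1.2, cone K N c.2.1 c.2.2 &
       e < `|dif w y c.1.1 c.1.2 - dif w y c.2.1 c.2.2| ]].

Lemma measurable_oscillates K N e y n : measurable (oscillates K N e y n).
Proof.
apply: measurable_exists_seq => -[[a b] [a' b']] /=.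
case: (cone K N a b); last by rewrite [X in measurable X](_ : _ = set0)//; apply/seteqP; split => // w [].
case: (cone K N a' b'); last by rewrite [X in measurable X](_ : _ = set0)//; apply/seteqP; split => // w [].
rewrite [X in measurable X](_ : _ = [set w : S | e < `|dif w y a b - dif w y a' b'|]); last first.
  by apply/seteqP; split => // w [].
rewrite -[X in measurable X]setTI.
apply: (measurable_fun_ltr (measurable_cst _)) => //.
apply: measurableT_comp => //.
by apply: measurable_funB; exact: measurable_dif.
Qed.

Lemma gap_small (eps e : R) : 0 < eps -> 0 < e -> exists2 K, (16 <= K)%N &
  forall y M, (mu [set w | (e < dif_st (2 / K%:R) w y M - dif_st (- (2 / K%:R)) w y M)%R] <= eps%:E)%E.
Proof.
(* [T] and [t0] bring each of the two terms of [prob_gap] below [eps / 4], the first one through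
   [expR (- x) <= 1 / x]; the bound counts both twice. *)
move=> eps0 e0; pose T := 16 / eps.
have T0 : 0 <= T by rewrite divr_ge0// ltW.
have hT : expR (- (T / 4)) <= eps / 4.
  have -> : T / 4 = 4 / eps by rewrite /T; field; lra.
  rewrite expRN -[eps / 4]invrK invf_div lef_pV2 ?posrE ?expR_gt0 ?divr_gt0//.
  by have := expR_ge1Dx (4 / eps); lra.
pose t0 := eps * e / (16 * expR T).
have t00 : 0 < t0 by rewrite divr_gt0 ?mulr_gt0// expR_gt0.
pose K := (Num.bound (2 / t0) + 16)%N.
have K0 : 0 < K%:R :> R by rewrite ltr0n /K; lia.
have Kt : 2 / K%:R <= t0.
  rewrite ler_pdivrMr// mulrC -ler_pdivrMr//.
  apply: ltW; apply: lt_le_trans (archi_boundP _) _; first by rewrite divr_ge0// ltW.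
  by rewrite ler_nat leq_addr.
exists K; first by rewrite leq_addl.
move=> y M.
have t8 : 0 < (2 / K%:R : R) <= 1 / 8.
  rewrite divr_gt0//= ler_pdivrMr//.
  have : 16%:R <= K%:R :> R by rewrite ler_nat leq_addl.
  by lra.
have e20 : 0 < e / 2 by lra.
have := prob_gap hmu y M t8 T0 e20.
rewrite (_ : e / 2 *+ 2 = e); last by field.
move/le_trans; apply; rewrite lee_fin.
have : 2 / K%:R *+ 2 * expR T / (e / 2) <= eps / 4.
  apply: (@le_trans _ _ (t0 *+ 2 * expR T / (e / 2))).
    by rewrite ler_wpM2r ?invr_ge0 ?(ltW e20)// ler_wpM2r ?expR_ge0// lerMn2r/=.
  have E0 := expR_gt0 T.
  rewrite le_eqVlt; apply/orP; left; apply/eqP; rewrite /t0; field; lra.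
lra.
Qed.

(** [K] is chosen first, from the gap between the models of parameters [2 / K] and [- (2 / K)], and
    [N] second, from the bad exits. Both bounds are uniform in [n], since the corner of the models
    may be placed at any [M]. *)
Lemma oscillation_small (eps e : R) y : 0 < eps -> 0 < e ->
  exists K N, forall n, (mu (oscillates K N e y n) <= eps%:E)%E.
Proof.
move=> eps0 e0.
have eps20 : 0 < eps / 2 by lra.
have [K K16 gapK] := gap_small eps20 e0.
have K0 : 0 < K%:R :> R by rewrite ltr0n; lia.
pose c : R := (2 / K%:R) ^+ 3 / 3.
have c0 : 0 < c by rewrite divr_gt0// exprn_gt0// divr_gt0.
pose r := expR (- c).
have r0 : 0 < r by exact: expR_gt0.
have r1 : r < 1 by rewrite -expR0 ltr_expR oppr_lt0.
pose del := Num.min 1 (eps / 8) * (1 - r).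
have del0 : 0 < del by rewrite mulr_gt0 ?subr_gt0// lt_min; apply/andP; split; lra.
have [N0 hN0] := expRN_pow_small c0 del0.
pose N := maxn N0 K; exists K, N => n.
have KN : (K <= N)%N by rewrite leq_maxr.
have small : 4 * (r ^+ N / (1 - r)) ^+ 2 <= eps / 2.
  have h : r ^+ N / (1 - r) <= Num.min 1 (eps / 8).
    by rewrite ler_pdivrMr ?subr_gt0//; apply: hN0; rewrite leq_maxl.
  have h0 : 0 <= r ^+ N / (1 - r) by rewrite divr_ge0 ?exprn_ge0 ?subr_ge0// ltW.
  move: h; rewrite le_min => /andP[h1 h2].
  have : (r ^+ N / (1 - r)) ^+ 2 <= 1 * (eps / 8) by rewrite expr2; apply: ler_pM.
  by lra.
pose M := (N + n)%N.
have mG : measurable [set w : S | e < dif_st (2 / K%:R) w y M - dif_st (- (2 / K%:R)) w y M].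
  rewrite -[X in measurable X]setTI.
  apply: (measurable_fun_ltr (measurable_cst _)) => //.
  by apply: measurable_funB; apply: measurable_funB;
    (exact: measurable_hI_st || exact: measurable_vJ_st).
have mB : measurable (bad_cone K N n y M).
  by apply: measurable_exists_seq => c'; exact: measurable_bad_in_cone.
apply: (@le_trans _ _ (mu (bad_cone K N n y M `|`
    [set w : S | (e < dif_st (2 / K%:R) w y M - dif_st (- (2 / K%:R)) w y M)%R]))).
  apply: le_measure; rewrite ?inE; [exact: measurable_oscillates|exact: measurableU|].
  move=> w [[[a b] [a' b']] /= /allpairsP[[c1 c2] /= [h1 h2 [e1 e2]]] [cab cab' osc]].
  rewrite -{}e1 in h1; rewrite -{}e2 in h2.
  have [Bw|nB] := pselect (bad_cone K N n y M w); [by left|right].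
  have t2 : 0 < (2 / K%:R : R) < 1 / 2.
    rewrite divr_gt0//= ltr_pdivrMr//.
    have : 16%:R <= K%:R :> R by rewrite ler_nat.
    by lra.
  have sand (u u' : nat) : (u, u') \in square N n -> cone K N u u' ->
      dif_st (- (2 / K%:R)) w y M <= dif w y u u' <= dif_st (2 / K%:R) w y M.
    move=> hu cu; apply: dif_sandwich => //.
    - by move: hu; rewrite mem_square => /andP[/andP[_ /ltnW]].
    - by move: hu; rewrite mem_square => /andP[_ /andP[_ /ltnW]].
    by move=> hb; apply: nB; exists (u, u').
  have /andP[s1 s2] := sand _ _ h1 cab; have /andP[s3 s4] := sand _ _ h2 cab'.
  rewrite /=; apply: (lt_le_trans osc); rewrite ler_norml; apply/andP; split; lra.
apply: le_trans (measureU2 _ mB mG) _.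
have h1 := prob_bad_cone n y M K16 KN.
have h2 := gapK y M.
apply: le_trans (leeD h1 h2) _.
by rewrite -EFinD lee_fin -/c -/r; lra.
Qed.

(** The cone may narrow as the precision increases, because [K] fixes the distance between the two
    comparison models. *)
Definition cauchy_dif y w := forall k : nat, exists K N, forall a b a' b',
  cone K N a b -> cone K N a' b' -> `|dif w y a b - dif w y a' b'| <= k.+1%:R^-1.

Lemma ae_cauchy_dif y : {ae mu, forall w : S, cauchy_dif y w}.
Proof.
apply: ae_foralln => k.
have k0 : 0 < k.+1%:R^-1 :> R by rewrite invr_gt0.
pose O K N : set S := \bigcup_n oscillates K N k.+1%:R^-1 y n.
have mO K N : measurable (O K N) by apply: bigcupT_measurable => n; exact: measurable_oscillates.
pose A : set S := \bigcap_K \bigcap_N O K N.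
have mA : measurable A by apply: bigcapT_measurable => K; apply: bigcapT_measurable => N.
exists A; split => //; last first.
  move=> w /= nw K _ N _; apply: contrapT => nO; apply: nw; exists K, N => a b a' b' c1 c2.
  rewrite leNgt; apply/negP => h; apply: nO.
  exists (a + b + a' + b').+1 => //; exists ((a, b), (a', b')) => //.
  apply/allpairsP; exists ((a, b), (a', b')); split => //=; rewrite mem_square;
  by move: c1 c2 => /and4P[? ? _ _] /and4P[? ? _ _]; lia.
apply/eqP; rewrite -measure_le0; apply/lee_addgt0Pr => eps eps0; rewrite add0e.
have [K [N hKN]] := oscillation_small y eps0 k0.
apply: (@le_trans _ _ (mu (O K N))).
  by apply: le_measure; rewrite ?inE// => w; apply; exact: I.
apply: prob_bigcup_nondecreasing => // n; first exact: measurable_oscillates.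
move=> w [[[a b] [a' b']] /= /allpairsP[[c1 c2] /= [h1 h2 [e1 e2]]] h].
exists ((a, b), (a', b')) => //; apply/allpairsP; exists ((a, b), (a', b')); split => //=.
- by rewrite -e1 in h1; move: h1; rewrite !mem_square; lia.
- by rewrite -e2 in h2; move: h2; rewrite !mem_square; lia.
Qed.

End Cauchy.

(** * Ties have probability zero *)

Section Ties.
Variable R : realType.
Local Notation S := (conf (int * int)%type R).
Implicit Types (w : int * int -> R) (y v z : int * int) (a b i j m n K N : nat).

Lemma cor_eq v s s' : (cor v s == cor v s') = (s == s').
Proof. by apply/eqP/eqP => [/cor_inj|->]. Qed.

Lemma pure_upd w z t v s s' : z = cor v s -> s' != s ->
  pure (upd w z t) v s' = pure w v s'.
Proof.
move=> -> ss; rewrite /pure /zh /zv; case: ifP => // _; case: ifP => // _.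
by rewrite /pos /upd cor_eq (negbTE ss).
Qed.

Lemma difE w y a b : dif w y a b =
  g (pure w (shift y a b)) a.+1 b - g (pure w (shift y a b)) a b.+1.
Proof. by rewrite /dif /hI /vJ; ring. Qed.

(** The weight of [y + e2] lies on every path counted by the first term of [dif] and on none counted
    by the second. *)
Lemma dif_fresh w y a b t t' : 0 < t -> 0 < t' ->
  dif (upd w (shift y 0 1) t) y a b.+1 - dif (upd w (shift y 0 1) t') y a b.+1 = t - t'.
Proof.
move=> t0 t'0; set z := shift y 0 1; set v := shift y a b.+1.
have zE : z = cor v (a.+1, b.+1).
  by rewrite /z /v /cor /shift /=; congr pair; lia.
have ge u u' i j : ~~ ((a < i)%N && (b < j)%N) ->
    g (pure (upd w z u) v) i j = g (pure (upd w z u') v) i j.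
  move=> hij; apply: g_ext => i' j' hi hj.
  have ne : (i', j') != (a.+1, b.+1).
    by apply: contra hij => /eqP[<- <-]; rewrite hi hj.
  by rewrite !(pure_upd _ _ zE ne).
have xz u : 0 < u -> pure (upd w z u) v (a.+1, b.+1) = u.
  move=> u0; rewrite /pure /zh /zv /= -zE /pos /upd eqxx.
  by apply/max_idPl/ltW.
rewrite !difE -/v !gSS !xz// (ge t t' a b.+1) ?(ge t t' a.+1 b) ?(ge t t' a b.+2); first by ring.
all: by rewrite ?ltnn ?andbF.
Qed.

Definition to0 (u : nat -> R) := forall k : nat, exists N, forall n, (N <= n)%N ->
  `|u n| <= k.+1%:R^-1.

Lemma measurable_to0 (f : nat -> S -> R) : (forall n, measurable_fun setT (f n)) ->
  measurable [set w : S | to0 (f ^~ w)].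
Proof.
move=> mf; rewrite (_ : [set _ | _] = \bigcap_(k : nat) \bigcup_(N : nat) \bigcap_(n : nat)
    [set w : S | (N <= n)%N -> `|f n w| <= k.+1%:R^-1]).
  apply: bigcapT_measurable => k; apply: bigcupT_measurable => N.
  apply: bigcapT_measurable => n; have [Nn|nN] := leqP N n; last first.
    by rewrite (_ : [set _ | _] = setT)//; apply/seteqP; split.
  rewrite (_ : [set _ | _] = [set w : S | `|f n w| <= k.+1%:R^-1]); last first.
    by apply/seteqP; split => w /= h; [exact: h|move=> _].
  rewrite -[X in measurable X]setTI; apply: measurable_fun_ler => //.
  by apply: measurableT_comp => //; exact: mf.
apply/seteqP; split => w /=.
  by move=> h k _; have [N hN] := h k; exists N => // n _; exact: hN.
by move=> h k; have [N _ hN] := h k I; exists N => n; exact: hN.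
Qed.

Variable mu : probability S R.
Hypothesis hmu : iexp mu (fun w => w) (fun=> 1).

(** With all weights but the one at [z] frozen, at most one positive value of the latter is in [E];
    the exponential law has no atom and does not charge the negative half line. *)
Lemma null_of_subsingleton (E : set S) z : measurable E ->
  (forall w t t', 0 < t -> 0 < t' -> E (upd w z t) -> E (upd w z t') -> t = t') ->
  mu E = 0%E.
Proof.
move=> mE h.
have mi : measurable_fun setT (fun w : S => (\1_E w)%:E : \bar R).
  exact/measurable_EFinP/measurable_indic.
have i0 (w : S) : (0 <= (\1_E w)%:E :> \bar R)%E by rewrite lee_fin.
have -> : mu E = (\int[mu]_w (\1_E w)%:E)%E by rewrite integral_indic// setIT.
rewrite (iexp_resample hmu z mi i0) integral0_eq// => w _.
have mU : measurable_fun setT (fun t : R => upd w z t : S).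
  by apply: measurable_upd; [exact: measurable_cst|exact: measurable_id].
pose B : set R := (fun t => upd w z t) @^-1` E.
have mB : measurable B by rewrite -[X in measurable X]setTI; exact: mU.
have -> : (\int[expo 1]_t (\1_E (upd w z t))%:E = expo 1 B)%E.
  by rewrite -[in RHS](setIT B) -integral_indic.
have [[t0 [t00 Bt0]]|nB] := pselect (exists t0 : R, 0 < t0 /\ B t0).
  apply/eqP; rewrite -measure_le0.
  pose N0 : set R := `]-oo, 0]%classic.
  have m2 : measurable N0 by exact: measurable_itv.
  have : (expo 1 (N0 `|` [set t0]) <= 0)%E.
    apply: le_trans (measureU2 _ m2 (measurable_set1 t0)) _.
    have e1 : expo 1 N0 = 0%E := expo_le0 (@ltr01 R).
    have e2 := expo_set1 t0 (@ltr01 R).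
    by rewrite [X in (X + _)%E]e1 [X in (_ + X)%E]e2 adde0.
  apply: le_trans; apply: le_measure; rewrite ?inE//; first exact: measurableU.
  move=> t Bt; have [tl|tg] := leP t 0; first by left; rewrite /N0 /= in_itv.
  by right; exact: (h w t t0).
pose N0 : set R := `]-oo, 0]%classic.
have m2 : measurable N0 by exact: measurable_itv.
have : (expo 1 N0 <= 0)%E by rewrite (expo_le0 (@ltr01 R) : expo 1 N0 = 0%E).
move=> N00; apply/eqP; rewrite -measure_le0; apply: le_trans N00.
apply: le_measure; rewrite ?inE//.
move=> t Bt; rewrite /N0 /= in_itv/= leNgt.
by apply/negP => t0; apply: nB; exists t.
Qed.

Lemma ae_dif_neq0 y a b : {ae mu, forall w : S, dif w y a b.+1 != 0}.
Proof.
have mE : measurable [set w : S | dif w y a b.+1 = 0].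
  rewrite -[X in measurable X]setTI.
  by have := measurable_dif (R := R) y a b.+1; move=> /(_ measurableT [set 0]); apply.
exists [set w : S | dif w y a b.+1 = 0]; split => //; last first.
  by move=> w /= /negP; rewrite negbK => /eqP.
apply: (null_of_subsingleton (z := shift y 0 1)) => // w t t' t0 t'0 /= h h'.
by have := dif_fresh w y a b t0 t'0; rewrite h h' subrr => /esym/eqP; rewrite subr_eq0 => /eqP.
Qed.

Lemma small_eq (u u' : R) : (forall k : nat, `|u - u'| <= k.+1%:R^-1 *+ 2) -> u = u'.
Proof.
move=> h; apply/eqP; rewrite -subr_eq0 -normr_eq0 eq_le normr_ge0 andbT.
apply/ler_addgt0Pr => e e0; rewrite add0r.
have b0 : 0 <= 2 / e by rewrite divr_ge0// ltW.
apply: le_trans (h (Num.bound (2 / e))) _.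
have := archi_boundP b0; set n := Num.bound _ => hn.
have n0 : 0 < n.+1%:R :> R by rewrite ltr0n.
rewrite -(ler_pM2l n0) mulrnAr divff ?gt_eqF//.
move: hn; rewrite ltr_pdivrMr// => hn; apply: ltW; apply: lt_le_trans hn _.
by rewrite ler_pM2r// ler_nat.
Qed.

(** A change of the weight at [z] shifts the whole sequence by the same amount, so at most one
    positive value of this weight makes it tend to 0. *)
Lemma ae_not_to0 (f : nat -> S -> R) z : (forall n, measurable_fun setT (f n)) ->
  (forall n w t t', (0 < n)%N -> 0 < t -> 0 < t' ->
     f n (upd w z t) - f n (upd w z t') = t - t') ->
  {ae mu, forall w : S, ~ to0 (f ^~ w)}.
Proof.
move=> mf ff; exists [set w : S | to0 (f ^~ w)]; split; first exact: measurable_to0.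
  apply: (null_of_subsingleton (z := z)); first exact: measurable_to0.
  move=> w t t' t0 t'0 /= h h'; apply: small_eq => k.
  have [N hN] := h k; have [N' hN'] := h' k; pose n := (N + N').+1.
  have nN : (N <= n)%N by rewrite /n; lia.
  have nN' : (N' <= n)%N by rewrite /n; lia.
  rewrite -(ff n w _ _ isT t0 t'0) mulr2n.
  by apply: le_trans (ler_normB _ _) _; rewrite lerD ?hN ?hN'.
by move=> w /= /contrapT.
Qed.

Lemma ae_diag_not_to0 y : {ae mu, forall w : S, ~ to0 (fun n => dif w y n n)}.
Proof.
apply: (@ae_not_to0 (fun n w => dif w y n n) (shift y 0 1)); first by move=> n; exact: measurable_dif.
by move=> [|n] w t t' // _ t0 t'0; exact: dif_fresh.
Qed.

Lemma ae_positive z : {ae mu, forall w : S, 0 < w z}.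
Proof.
exists [set w : S | (w z <= 0)]; split.
- rewrite -[X in measurable X]setTI; apply: measurable_fun_ler => //.
  exact: measurable_coord.
- pose N0 : set R := `]-oo, 0]%classic.
  have m2 : measurable N0 by exact: measurable_itv.
  rewrite (_ : [set w : S | w z <= 0] = (fun w : S => w z) @^-1` N0).
    exact: (etrans (iexp_coord hmu z m2) (expo_le0 (@ltr01 R))).
  by apply/seteqP; split => w /=; rewrite /N0 /= in_itv.
- by move=> w /= /negP; rewrite -leNgt.
Qed.

Definition up w y := exists K N, forall a b, cone K N a b -> 0 < dif w y a b.
Definition down w y := exists K N, forall a b, cone K N a b -> dif w y a b < 0.

Lemma cone_diag K N n : (N <= n)%N -> cone K N n n.
Proof. by move=> Nn; apply/and4P; split => //; rewrite leq_mul2r leqnSn orbT. Qed.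

Lemma up_or_down w y : cauchy_dif y w ->
  ~ to0 (fun n => dif w y n n) ->
  up w y \/ down w y.
Proof.
move=> C nz.
(* Diagonal values of arbitrary depth exceed [1 / (k + 1)] in size; in a cone of precision
   [1 / (k + 1)] all values have the sign of such a one. *)
have [k hk] : exists k : nat, forall N, exists2 n, (N <= n)%N & k.+1%:R^-1 < `|dif w y n n|.
  apply: contrapT => h; apply: nz => k; apply: contrapT => h'; apply: h; exists k => N.
  apply: contrapT => h''; apply: h'; exists N => n Nn; rewrite leNgt; apply/negP => h3.
  by apply: h''; exists n.
have [K [N hKN]] := C k; have [n Nn] := hk N.
have cn := cone_diag K Nn.
have [d0|d0] := leP 0 (dif w y n n).
  rewrite ger0_norm// => kn; left; exists K, N => a b cab.
  by have := hKN _ _ _ _ cn cab; rewrite ler_norml => /andP[]; move: kn; set e := _^-1; lra.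
rewrite ltr0_norm// => kn; right; exists K, N => a b cab.
by have := hKN _ _ _ _ cn cab; rewrite ler_norml => /andP[]; move: kn; set e := _^-1; lra.
Qed.

End Ties.

(** * Geodesics and rays *)

Section Bridge.
Variable R : realType.
Local Notation S := (conf (int * int)%type R).
Implicit Types (w : int * int -> R)
  (y v z : int * int)
  (a b i j p q n N : nat)
  (s : seq (int * int)).

(** Both end weights count, so [lp] exceeds [last_passage_time] by the weight of [y] (see
    [last_passage_lp]). *)
Definition lp w y a b : R := g (pure w (shift y a b)) a.+1 b.+1.

Lemma shift_e1 y a b : shift (y + e1) a b = shift y a.+1 b.
Proof. by rewrite /shift /=; congr pair; lia. Qed.

Lemma shift_e2 y a b : shift (y + e2) a b = shift y a b.+1.
Proof. by rewrite /shift /=; congr pair; lia. Qed.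

Lemma pure_corner w y a b : pure w (shift y a b) (a.+1, b.+1) = pos w y.
Proof.
rewrite /pure /zh /zv /=; congr (pos w _).
by rewrite /cor /shift /=; case: y => y1 y2 /=; congr pair; lia.
Qed.

Lemma g_pure_axis w v a b : g (pure w v) a 0 = 0 /\ g (pure w v) 0 b = 0.
Proof. by rewrite /pure g_zh0 zhzvC g_zv0. Qed.

Lemma lpSS w y a b :
  lp w y a.+1 b.+1 = pos w y + Num.max (lp w (y + e1) a b.+1) (lp w (y + e2) a.+1 b).
Proof. by rewrite /lp gSS pure_corner shift_e1 shift_e2. Qed.

Lemma lpS0 w y a : lp w y a.+1 0 = pos w y + lp w (y + e1) a 0.
Proof.
rewrite /lp gSS pure_corner shift_e1; congr (_ + _); apply/max_idPl.
have [-> _] := g_pure_axis w (shift y a.+1 0) a.+2 0.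
by apply: g_ge0 => s; exact: pure_ge0.
Qed.

Lemma lp0S w y b : lp w y 0 b.+1 = pos w y + lp w (y + e2) 0 b.
Proof.
rewrite /lp gSS pure_corner shift_e2; congr (_ + _); apply/max_idPr.
have [_ ->] := g_pure_axis w (shift y 0 b.+1) 0 b.+2.
by apply: g_ge0 => s; exact: pure_ge0.
Qed.

Lemma lp00 w y : lp w y 0 0 = pos w y.
Proof.
rewrite /lp gSS pure_corner.
by have [-> ->] := g_pure_axis w (shift y 0 0) 1 1; rewrite maxxx addr0.
Qed.

Lemma dif_lpSS w y a b : dif w y a.+1 b.+1 = lp w (y + e2) a.+1 b - lp w (y + e1) a b.+1.
Proof. by rewrite difE /lp shift_e1 shift_e2. Qed.

Lemma dif_lpS0 w y a : dif w y a.+1 0 = - lp w (y + e1) a 0.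
Proof.
rewrite difE /lp shift_e1.
by have [-> _] := g_pure_axis w (shift y a.+1 0) a.+2 0; rewrite add0r.
Qed.

Lemma dif_lp0S w y b : dif w y 0 b.+1 = lp w (y + e2) 0 b.
Proof.
rewrite difE /lp shift_e2.
by have [_ ->] := g_pure_axis w (shift y 0 b.+1) 0 b.+2; rewrite subr0.
Qed.

Definition level z : int := z.1 + z.2.

Lemma up_rightP y z : reflect (z = y + e1 \/ z = y + e2) (up_right y z).
Proof.
rewrite /up_right !subr_eq ![_ + y]addrC.
apply: (iffP orP); first by move=> [/eqP h|/eqP h]; [left|right].
by move=> [-> | ->]; [left|right].
Qed.

Lemma up_right_path y s : path up_right y s ->
  le_site y (last y s) /\ level (last y s) = level y + (size s)%:Z.
Proof.
elim: s y => [|z s IH] y /=; first by rewrite /le_site !lexx addr0.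
case/andP => /up_rightP yz /IH[/andP[h1 h2] h3]; rewrite h3 /le_site /level.
by case: yz => zE; rewrite zE /= in h1 h2 *; (split; [apply/andP; split; lia|lia]).
Qed.

(* The maximal path, built step by step; the sign of [dif] also gives the only
   possible step when a = 0 or b = 0. *)
Fixpoint greedy w n y a b : seq (int * int) :=
  if n is n'.+1 then
    if 0 < dif w y a b then (y + e2) :: greedy w n' (y + e2) a b.-1
    else (y + e1) :: greedy w n' (y + e1) a.-1 b
  else [::].

Definition tie_free w := (forall z, 0 < w z) /\ forall z a b, dif w z a.+1 b.+1 != 0.

Lemma lp_gt0 w y a b : tie_free w -> 0 < lp w y a b.
Proof.
case=> w0 _; have p0 : 0 < pos w y by rewrite /pos lt_max w0.
have l0 z i j : 0 <= lp w z i j by apply: g_ge0 => s; exact: pure_ge0.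
case: a b => [|a] [|b]; rewrite ?(lp00, lpS0, lp0S, lpSS)// ltr_wpDr//.
by rewrite le_max l0.
Qed.

Lemma lp_step w y a b : tie_free w -> (0 < a + b)%N ->
  if 0 < dif w y a b then
    [/\ (0 < b)%N, lp w y a b = w y + lp w (y + e2) a b.-1 &
        (0 < a)%N -> lp w (y + e1) a.-1 b < lp w (y + e2) a b.-1]
  else
    [/\ (0 < a)%N, lp w y a b = w y + lp w (y + e1) a.-1 b &
        (0 < b)%N -> lp w (y + e2) a b.-1 < lp w (y + e1) a.-1 b].
Proof.
move=> tf; have [w0 d0] := tf.
have posE z : pos w z = w z by apply/max_idPl/ltW.
case: a b => [|a] [|b] // _.
- by rewrite dif_lp0S lp_gt0// lp0S posE.
- by rewrite dif_lpS0 oppr_gt0 ltNge (ltW (lp_gt0 _ _ _ tf))/= lpS0 posE.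
have := d0 y a b; rewrite dif_lpSS lpSS posE subr_gt0 subr_eq0 /=.
set l1 := lp _ (y + e1) _ _; set l2 := lp _ (y + e2) _ _ => ne.
have [h|h] := ltP l1 l2; split => //.
by rewrite lt_neqAle ne h.
Qed.

(** Induction on the number of steps: by [lp_step], the first step refused by [greedy] leads to
    strictly lighter paths, so uniqueness comes together with maximality. *)
Lemma greedy_max w n y a b : tie_free w -> n = (a + b)%N ->
  [/\ path up_right y (greedy w n y a b),
      last y (greedy w n y a b) = shift y a b,
      path_weight w (greedy w n y a b) = lp w y a b - w y &
      forall s, path up_right y s -> last y s = shift y a b ->
        path_weight w s <= lp w y a b - w y /\
        (path_weight w s = lp w y a b - w y -> s = greedy w n y a b)].
Proof.
move=> tf; have [w0 d0] := tf.
have posE z : pos w z = w z by apply/max_idPl/ltW.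
elim: n y a b => [|n IH] y a b nE.
  have [-> ->] : a = 0%N /\ b = 0%N by lia.
  rewrite lp00 posE subrr /= /path_weight big_nil; split => //.
    by rewrite /shift /= !addr0; case: (y).
  move=> [|z s]; first by rewrite big_nil.
  move=> ps ls; have [_] := up_right_path ps.
  by rewrite ls /level /shift /=; lia.
have ab0 : (0 < a + b)%N by rewrite -nE.
have wc z s : path_weight w (z :: s) = w z + path_weight w s by rewrite /path_weight big_cons.
have r1 z : up_right z (z + e1) by apply/up_rightP; left.
have r2 z : up_right z (z + e2) by apply/up_rightP; right.
have IH1 : (0 < a)%N -> [/\ path up_right (y + e1) (greedy w n (y + e1) a.-1 b),
      last (y + e1) (greedy w n (y + e1) a.-1 b) = shift y a b,
      path_weight w (greedy w n (y + e1) a.-1 b) = lp w (y + e1) a.-1 b - w (y + e1) &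
      forall s, path up_right (y + e1) s -> last (y + e1) s = shift y a b ->
        path_weight w s <= lp w (y + e1) a.-1 b - w (y + e1) /\
        (path_weight w s = lp w (y + e1) a.-1 b - w (y + e1) -> s = greedy w n (y + e1) a.-1 b)].
  move=> a0; have := IH (y + e1) a.-1 b; rewrite shift_e1 prednK//; apply; lia.
have IH2 : (0 < b)%N -> [/\ path up_right (y + e2) (greedy w n (y + e2) a b.-1),
      last (y + e2) (greedy w n (y + e2) a b.-1) = shift y a b,
      path_weight w (greedy w n (y + e2) a b.-1) = lp w (y + e2) a b.-1 - w (y + e2) &
      forall s, path up_right (y + e2) s -> last (y + e2) s = shift y a b ->
        path_weight w s <= lp w (y + e2) a b.-1 - w (y + e2) /\
        (path_weight w s = lp w (y + e2) a b.-1 - w (y + e2) -> s = greedy w n (y + e2) a b.-1)].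
  move=> b0; have := IH (y + e2) a b.-1; rewrite shift_e2 prednK//; apply; lia.
have first s : path up_right y s -> last y s = shift y a b ->
    (exists s', [/\ s = (y + e1) :: s', (0 < a)%N, path up_right (y + e1) s' & last (y + e1) s' = shift y a b]) \/
    (exists s', [/\ s = (y + e2) :: s', (0 < b)%N, path up_right (y + e2) s' & last (y + e2) s' = shift y a b]).
  case: s => [_|z s /= /andP[/up_rightP yz ps] ls].
    by rewrite /shift; case: (y) => y1 y2 [] /=; lia.
  have [h _] := up_right_path ps; rewrite ls /le_site /shift /= in h.
  case/andP: h => h1 h2; case: yz => zE; subst z; rewrite /= in h1 h2; [left|right]; exists s; split => //; lia.
have := lp_step y tf ab0; rewrite /=; case: ifP => _ [c0 lE lt].
  have [p1 p2 p3 p4] := IH2 c0; split; rewrite /= ?r2 ?wc ?p3 ?lE//; first by ring.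
  move=> s /first{}first /first[] [s' [-> c1 q1 q2]]; rewrite wc.
    have [_ _ _ q3] := IH1 c1; have [{}q3 _] := q3 _ q1 q2.
    by have {}lt := lt c1; split; [lra|move=> /eqP; rewrite lt_eqF//; lra].
  by have [q3 q4] := p4 _ q1 q2; split; [lra|move=> e; rewrite q4//; lra].
have [p1 p2 p3 p4] := IH1 c0; split; rewrite /= ?r1 ?wc ?p3 ?lE//; first by ring.
move=> s /first{}first /first[] [s' [-> c1 q1 q2]]; rewrite wc; last first.
  have [_ _ _ q3] := IH2 c1; have [{}q3 _] := q3 _ q1 q2.
  by have {}lt := lt c1; split; [lra|move=> /eqP; rewrite lt_eqF//; lra].
by have [q3 q4] := p4 _ q1 q2; split; [lra|move=> e; rewrite q4//; lra].
Qed.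

Lemma last_passage_lp w y a b : tie_free w ->
  last_passage_time w y (shift y a b) = lp w y a b - w y.
Proof.
move=> tf; have [p1 p2 p3 p4] := greedy_max y tf (erefl (a + b)%N).
apply/eqP; rewrite eq_le; apply/andP; split.
  apply: ge_sup; first by eexists; exists (greedy w (a + b) y a b).
  by move=> _ [s [h1 h2] <-]; have [] := p4 _ h1 h2.
apply: ub_le_sup; last by exists (greedy w (a + b) y a b).
by exists (lp w y a b - w y) => _ [s [h1 h2] <-]; have [] := p4 _ h1 h2.
Qed.

Lemma geodesicP w y a b s : tie_free w ->
  is_geodesic w y (shift y a b) s <-> s = greedy w (a + b) y a b.
Proof.
move=> tf; have [p1 p2 p3 p4] := greedy_max y tf (erefl (a + b)%N).
rewrite /is_geodesic /maximizing_path last_passage_lp//; split.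
  by move=> [[[h1 h2] h3] _]; have [_] := p4 _ h1 h2; apply.
by move=> ->; split => // s' [[h1 h2] h3]; have [_ ->] := p4 _ h1 h2.
Qed.

End Bridge.

Section Rays.
Variable R : realType.
Local Notation S := (conf (int * int)%type R).
Implicit Types (w : int * int -> R)
  (y z x : int * int)
  (a p q m n k K N : nat)
  (v : nat -> int * int).

Definition nx w y : int * int := if `[< up w y >] then y + e2 else y + e1.
Definition ray w y n : int * int := iter n (nx w) y.

Definition regular w := tie_free w /\ forall z, up w z \/ down w z.

Lemma nxP w y : nx w y = y + e1 \/ nx w y = y + e2.
Proof. by rewrite /nx; case: ifP; [right|left]. Qed.

Lemma rayS w y n : ray w y n.+1 = nx w (ray w y n). Proof. by []. Qed.

Lemma ray_add w y n k : ray w y (n + k) = ray w (ray w y n) k.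
Proof. by rewrite /ray addnC iterD. Qed.

Lemma shift00 y : shift y 0 0 = y.
Proof. by rewrite /shift /= !addr0; case: y. Qed.

Lemma shift_inj y p q p' q' : shift y p q = shift y p' q' -> p = p' /\ q = q'.
Proof. by rewrite /shift => -[/addrI[->] /addrI[->]]. Qed.

Lemma shift_add1 y p q : shift y p q + e1 = shift y p.+1 q.
Proof. by rewrite [LHS]surjective_pairing /shift /=; congr pair; lia. Qed.

Lemma shift_add2 y p q : shift y p q + e2 = shift y p q.+1.
Proof. by rewrite [LHS]surjective_pairing /shift /=; congr pair; lia. Qed.

Lemma ray_shift w y n : exists p q, ray w y n = shift y p q /\ (p + q)%N = n.
Proof.
elim: n => [|n [p [q [rE pq]]]]; first by exists 0%N, 0%N; rewrite shift00.
rewrite rayS; have [->|->] := nxP w (ray w y n); rewrite rE.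
  by exists p.+1, q; split; [rewrite ?(shift_add1, shift_add2)|lia].
by exists p, q.+1; split; [rewrite ?(shift_add1, shift_add2)|lia].
Qed.

Lemma ray_up_right w y n : up_right (ray w y n) (ray w y n.+1).
Proof. by apply/up_rightP; exact: nxP. Qed.

Lemma level_ray w y n : level (ray w y n) = level y + n%:Z.
Proof.
have [p [q [-> <-]]] := ray_shift w y n; rewrite /level /shift /=; lia.
Qed.

Lemma cone_diagonal v p q K N : diagonal_sequence R v ->
  \forall n \near \oo, [/\ (p <= `|(v n).1|)%N, (q <= `|(v n).2|)%N &
    cone K N (`|(v n).1| - p) (`|(v n).2| - q)].
Proof.
move=> [v0 vinf vd].
(* Half of the aperture is left to the ratio, through [e], and half to the translation by [(p, q)],
   which is negligible for coordinates beyond [4 * K.+1 * (p + q + N).+1]. *)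
pose L : R := 12 * K.+1%:R * (p + q + N).+1%:R.
have [n1 _ h1] : \forall n \near \oo, L <= (`|(v n).1| + `|(v n).2|)%:~R.
  by move/cvgryPge : vinf; apply.
pose e : R := (2 * K.+1%:R)^-1.
have e0 : 0 < e by rewrite invr_gt0 mulr_gt0.
have [n2 _ h2] : \forall n \near \oo, `|1 - ((v n).2)%:~R / ((v n).1)%:~R| <= e.
  by move/cvgrPdist_le : vd; apply.
exists (maxn n1 n2) => // n /= hn.
have {}h1 := h1 n (leq_trans (leq_maxl _ _) hn).
have {}h2 := h2 n (leq_trans (leq_maxr _ _) hn).
have /andP[/= p1 p2] := v0 n.
move: h1 h2; rewrite (ger0_norm p1) (ger0_norm p2).
rewrite -{1 2}(gez0_abs p1) -{1 2}(gez0_abs p2).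
set A := `|(v n).1|%N; set B := `|(v n).2|%N; rewrite -PoszD -!pmulrn natrD => h1 h2.
have e1 : e < 1.
  by rewrite /e invf_lt1 ?mulr_gt0// -natrM ltr1n; lia.
have A0 : (0 < A)%N.
  rewrite lt0n; apply/eqP => A0; move: h2; rewrite A0 invr0 mulr0 subr0 normr1.
  by rewrite leNgt e1.
have Ap : 0 < A%:R :> R by rewrite ltr0n.
have {}h2 : `|A%:R - B%:R| <= e * A%:R :> R.
  rewrite -(@ler_pdivrMr _ A%:R)// -{2}(gtr0_norm Ap) -normf_div mulrBl divff//.
  by rewrite gt_eqF.
have Kp : 0 < K.+1%:R :> R by rewrite ltr0n.
have {}h2 : 2 * K.+1%:R * `|A%:R - B%:R| <= A%:R :> R.
  by rewrite mulrC -ler_pdivlMr ?mulr_gt0// mulrC.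
have h3 : (2 * K.+1 * A <= A + 2 * K.+1 * B)%N.
  rewrite -(ler_nat R) natrD !natrM.
  have := ler_wpM2l (ltW (mulr_gt0 (ltr0Sn R 1) Kp)) (ler_norm (A%:R - B%:R : R)).
  by lra.
have h4 : (2 * K.+1 * B <= A + 2 * K.+1 * A)%N.
  rewrite -(ler_nat R) natrD !natrM.
  have := ler_wpM2l (ltW (mulr_gt0 (ltr0Sn R 1) Kp)) (ler_norm (B%:R - A%:R : R)).
  by rewrite distrC; lra.
have {}h1 : (12 * K.+1 * (p + q + N).+1 <= A + B)%N.
  by rewrite -(ler_nat R) natrD !natrM.
clear -h1 h3 h4 A0.
have BA : (B <= 2 * A)%N by nia.
have AB : (A <= 2 * B)%N by nia.
have hA : (4 * K.+1 * (p + q + N).+1 <= A)%N by lia.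
by split; [nia|nia|apply/and4P; split; nia].
Qed.

Lemma segmentS (f : nat -> int * int) m : segment f 0 m.+1 = segment f 0 m ++ [:: f m.+1].
Proof.
rewrite /segment; have -> : index_iota 1 m.+2 = index_iota 1 m.+1 ++ [:: m.+1].
  by rewrite /index_iota !subn1 -[m.+2.-1]/(m.+1) -[m.+1.-1]/m -{1}(addn1 m) (iotaD 1 m 1) add1n.
by rewrite map_cat.
Qed.

(** The first [m] steps involve finitely many sites, and [v n] eventually lies in the cones where
    the corresponding differences have their limiting signs; there [greedy] copies the ray. *)
Lemma follow w x v m p q : regular w -> diagonal_sequence R v ->
  ray w x m = shift x p q -> (p + q)%N = m ->
  \forall n \near \oo, [/\ (p <= `|(v n).1|)%N, (q <= `|(v n).2|)%N &
    greedy w (`|(v n).1| + `|(v n).2|) x `|(v n).1| `|(v n).2| =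
    segment (ray w x) 0 m ++
      greedy w (`|(v n).1| - p + (`|(v n).2| - q)) (ray w x m) (`|(v n).1| - p) (`|(v n).2| - q)].
Proof.
move=> [tf dec] dv; elim: m p q => [|m IH] p q rE pq.
  have [-> ->] : p = 0%N /\ q = 0%N by lia.
  by apply: nearW => n; rewrite !subn0.
have [p0 [q0 [rE0 pq0]]] := ray_shift w x m.
have {}IH := IH _ _ rE0 pq0.
have [u|nu] := pselect (up w (ray w x m)).
  have nE : ray w x m.+1 = ray w x m + e2 by rewrite rayS /nx asboolT.
  have [pE qE] : p = p0 /\ q = q0.+1.
    apply: (@shift_inj x); by rewrite -rE nE rE0 ?(shift_add1, shift_add2).
  have [K [N hKN]] := u.
  (* [N.+1] rather than [N] keeps both remaining coordinates positive, so that the next truncated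
     subtraction is exact. *)
  have C := cone_diagonal p0 q0 K N.+1 dv.
  apply: filterS2 IH C => n [a1 a2 ->] [_ _ c].
  have d0 : 0 < dif w (ray w x m) (`|(v n).1| - p0) (`|(v n).2| - q0).
    by apply: hKN; case/and4P: c => c1 c2 c3 c4; apply/and4P; split => //; exact: ltnW.
  case/and4P: c => c1 c2 c3 c4; rewrite pE qE nE; split => //; first by lia.
  have -> : (`|(v n).1| - p0 + (`|(v n).2| - q0) = (`|(v n).1| - p0 + (`|(v n).2| - q0.+1)).+1)%N by lia.
  rewrite segmentS nE -catA /= d0; congr (_ ++ _ :: greedy _ _ _ _ _); lia.
have nE : ray w x m.+1 = ray w x m + e1 by rewrite rayS /nx asboolF.
have [pE qE] : p = p0.+1 /\ q = q0.
  apply: (@shift_inj x); by rewrite -rE nE rE0 ?(shift_add1, shift_add2).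
have [//|[K [N hKN]]] := dec (ray w x m).
have C := cone_diagonal p0 q0 K N.+1 dv.
apply: filterS2 IH C => n [a1 a2 ->] [_ _ c].
have d0 : dif w (ray w x m) (`|(v n).1| - p0) (`|(v n).2| - q0) < 0.
  by apply: hKN; case/and4P: c => c1 c2 c3 c4; apply/and4P; split => //; exact: ltnW.
case/and4P: c => c1 c2 c3 c4; rewrite pE qE nE; split => //; first by lia.
have -> : (`|(v n).1| - p0 + (`|(v n).2| - q0) = (`|(v n).1| - p0.+1 + (`|(v n).2| - q0)).+1)%N by lia.
rewrite segmentS nE -catA /= ltNge (ltW d0) /=; congr (_ ++ _ :: greedy _ _ _ _ _); lia.
Qed.

End Rays.

Section Geodesics.
Variable R : realType.
Local Notation S := (conf (int * int)%type R).
Implicit Types (w : int * int -> R)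
  (y z x c : int * int)
  (a i j p q m n k K N : nat)
  (s : seq (int * int))
  (v f : nat -> int * int).

Lemma path_level y s z : path up_right y s -> z \in s -> level y < level z.
Proof.
elim: s y => // u s IH y /= /andP[/up_rightP yu ps]; rewrite inE => zs.
have yu' : level u = level y + 1 by case: yu => ->; rewrite /level /=; lia.
by case/orP: zs => [/eqP ->|/(IH _ ps)]; lia.
Qed.

Lemma mem_segment0 f m z : reflect (exists2 i, (0 < i <= m)%N & f i = z) (z \in segment f 0 m).
Proof.
apply: (iffP mapP) => [[i + ->]|[i im <-]]; first by rewrite mem_index_iota; exists i.
by exists i => //; rewrite mem_index_iota.
Qed.

Lemma path_weight_cat w s s' : path_weight w (s ++ s') = path_weight w s + path_weight w s'.
Proof. by rewrite /path_weight big_cat. Qed.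

Lemma segment_ray w x k n : (k <= n)%N ->
  segment (ray w x) k n = segment (ray w (ray w x k)) 0 (n - k).
Proof.
move=> kn; rewrite /segment /index_iota subSS subn1 /= -[k.+1]addn1 iotaDl -map_comp.
by apply: eq_map => i /=; rewrite ray_add.
Qed.

Lemma path_segment w x m : path up_right x (segment (ray w x) 0 m) /\
  last x (segment (ray w x) 0 m) = ray w x m.
Proof.
elim: m => // m [h1 h2]; rewrite segmentS cat_path last_cat h1 h2 /= andbT; split => //.
exact: ray_up_right.
Qed.

Lemma diagonal_sequence_nn : diagonal_sequence R (fun n => (n%:Z, n%:Z)).
Proof.
split; first by move=> n; rewrite /le_site /=.
  apply/cvgryPge => A; exists (Num.bound `|A|) => // n /= hn.
  rewrite -PoszD -pmulrn; apply: le_trans (ler_norm A) _.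
  apply: ltW; apply: lt_le_trans (archi_boundP (normr_ge0 A)) _.
  by rewrite ler_nat; apply: leq_trans (leq_addr _ _).
apply: cvg_near_cst; exists 1%N => // n /= n0.
by rewrite divff// intr_eq0; lia.
Qed.

(** The segment begins the geodesic to a far diagonal site; replacing it by a heavier path with the
    same ends would improve that geodesic. *)
Lemma geodesic_segment w x m : regular w ->
  is_geodesic w x (ray w x m) (segment (ray w x) 0 m).
Proof.
move=> rw; have tf := rw.1; have [p [q [rE pq]]] := ray_shift w x m.
have [n _ h] := follow rw diagonal_sequence_nn rE pq.
have [/= a1 a2] := h n (leqnn n); set rest := greedy _ _ (ray w x m) _ _ => gE.
rewrite rE; apply/geodesicP => //.
have [h1 h2 h3 h4] := greedy_max x tf (erefl (p + q)%N).
have [p1 p2] := path_segment w x m.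
have [le1 ->//] := h4 _ p1 (etrans p2 rE).
have [l1 l2 l3 l4] := greedy_max x tf (erefl (n + n)%N).
apply/eqP; rewrite eq_le le1 /= -h3.
have g1 : path up_right x (greedy w (p + q) x p q ++ rest).
  by move: l1; rewrite gE !cat_path p1 p2 h1 h2 rE.
have g2 : last x (greedy w (p + q) x p q ++ rest) = shift x n n.
  by move: l2; rewrite gE !last_cat p2 h2 rE.
have [+ _] := l4 _ g1 g2; rewrite -l3 gE !path_weight_cat.
by rewrite lerD2r.
Qed.

Lemma ray_semi_infinite w x : regular w -> is_semi_infinite_geodesic w x (ray w x).
Proof.
move=> rw; have tf := rw.1; split => //.
- by move=> n; exact: ray_up_right.
- move=> k n kn; rewrite segment_ray ?(ltnW kn)//.
  by rewrite -{1}(subnKC (ltnW kn)) ray_add; exact: geodesic_segment.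
move=> v dv K.
(* The level grows by one at each step of an up-right path, so the sites of the finite set [K] are
   visited within the first [m] steps or never. *)
have [m hm] : exists m, forall z, z \in K -> level z <= level x + m%:Z.
  elim: K => [|u K [m IH]]; first by exists 0%N.
  exists (m + `|level u - level x|)%N => z; rewrite inE => /orP[/eqP ->|/IH]; lia.
have [p [q [rE pq]]] := ray_shift w x m.
have F := follow rw dv rE pq.
apply: filterS F => n [a1 a2 gE].
exists (greedy w (`|(v n).1| + `|(v n).2|) x `|(v n).1| `|(v n).2|).
  have -> : x + v n = shift x `|(v n).1| `|(v n).2|.
    have [v0 _ _] := dv; have /andP[/= v1 v2] := v0 n.
    by rewrite [LHS]surjective_pairing /shift /=; congr pair; rewrite gez0_abs.
  exact/geodesicP.
move=> z zK; have zm := hm z zK; rewrite gE inE mem_cat; split.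
  case/or3P => [/eqP ->|/mem_segment0[i _ <-]|zr]; [by exists 0%N|by exists i|].
  exfalso; have [l1 _ _ _] := greedy_max x tf (erefl (`|(v n).1| + `|(v n).2|)%N).
  move: l1; rewrite gE cat_path (path_segment w x m).1 (path_segment w x m).2 /=.
  by move=> /path_level /(_ zr); rewrite level_ray ltNge zm.
move=> [[|i] rz]; first by rewrite -rz eqxx.
apply/or3P/Or32/mem_segment0; exists i.+1 => //=.
by move: zm; rewrite -rz level_ray; lia.
Qed.

Lemma level_up_right f x n : f 0%N = x -> (forall n, up_right (f n) (f n.+1)) ->
  level (f n) = level x + n%:Z.
Proof.
move=> f0 ff; elim: n => [|n IH]; first by rewrite f0 addr0.
by have /up_rightP[] := ff n => ->; move: IH; rewrite /level /=; lia.
Qed.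

(** Along the diagonal sequence both paths visit the sites of the same finite geodesics, and the
    level of a site gives its index on the path. *)
Lemma semi_infiniteE w x f : regular w -> is_semi_infinite_geodesic w x f -> f = ray w x.
Proof.
move=> rw [f0 ff _ fd]; apply/funext => n.
have [_ _ _ rd] := ray_semi_infinite x rw.
have F := fd _ diagonal_sequence_nn [:: f n].
have G := rd _ diagonal_sequence_nn [:: f n].
have [k _ h] := filterI F G.
have [[s gs hs] [s' gs' hs']] := h k (leqnn k).
have ss : s' = s by case: gs => _ /(_ _ gs'.1) ->.
have fK : f n \in [:: f n] by rewrite inE.
have : exists i, f i = f n by exists n.
move/(hs _ fK); rewrite -ss => /(hs' _ fK)[i rf].
have := level_up_right n f0 ff; rewrite -rf level_ray => e.
by have -> : n = i by lia.
Qed.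

Lemma concatenationP w x c : regular w ->
  is_concatenation w x c (ray w x) (ray w c) <-> exists k, ray w x k = c.
Proof.
move=> rw; split=> [[k _ h]|[k <-]]; first by exists k; have := h 0%N; rewrite addn0 => <-.
exists k; first exact: geodesic_segment.
by move=> n; rewrite ray_add.
Qed.

Lemma coalesceP w x y c : regular w ->
  coalesce_at w x y c <-> (exists k, ray w x k = c) /\ (exists k, ray w y k = c).
Proof.
move=> rw; split.
  move=> [gx [gy [gc [/(semi_infiniteE rw) -> /(semi_infiniteE rw) -> /(semi_infiniteE rw) ->]]]].
  by move=> /(concatenationP _ _ rw) h1 /(concatenationP _ _ rw).
move=> [h1 h2]; exists (ray w x), (ray w y), (ray w c).
by split; [exact: ray_semi_infinite|exact: ray_semi_infinite|exact: ray_semi_infinite|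
  exact/concatenationP|exact/concatenationP].
Qed.

Lemma le_ray w x n k : (n <= k)%N -> le_site (ray w x n) (ray w x k).
Proof.
move=> nk; rewrite -(subnKC nk) ray_add.
have [p [q [-> _]]] := ray_shift w (ray w x n) (k - n).
by rewrite /le_site /shift /=; apply/andP; split; lia.
Qed.

(** Rays issued from the same level share a site only after equally many steps, and the first common
    site lies below all the later ones. *)
Lemma coalescence_point_meet w x y : regular w -> level x = level y ->
  (exists k, ray w x k = ray w y k) ->
  exists2 k, coalescence_point w x y = ray w x k & ray w x k = ray w y k.
Proof.
move=> rw lxy ex.
have ex' : exists k, ray w x k == ray w y k by case: ex => k /eqP; exists k.
case: (ex_minnP ex') => k /eqP rk kmin; exists k => //.
have common c : coalesce_at w x y c -> le_site (ray w x k) c.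
  move/(coalesceP _ _ _ rw) => [[i ic] [j jc]].
  have ij : i = j.
    by have := level_ray w x i; have := level_ray w y j; rewrite ic jc; lia.
  by rewrite -ic; apply: le_ray; apply: kmin; rewrite ic ij jc.
have fk : first_coalescence_points w x y (ray w x k).
  by split => //; apply/coalesceP => //; split; exists k.
have xg : first_coalescence_points w x y (coalescence_point w x y) by exact: xgetI fk.
have h1 := xg.2 _ fk.1; have h2 := fk.2 _ xg.1.
move: h1 h2; rewrite /le_site => /andP[u1 u2] /andP[v1 v2].
rewrite [LHS]surjective_pairing [RHS]surjective_pairing; congr pair; lia.
Qed.

End Geodesics.

(** * Sides through which rays leave rectangles *)

Section Exits.
Variable R : realType.
Local Notation S := (conf (int * int)%type R).
Implicit Types (w : int * int -> R)
  (y V z x c : int * int)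
  (a b i j p q m n k K N M : nat)
  (s : seq (int * int)).

Definition exits_north w x a b := exists n p, (p <= a)%N /\ ray w x n = shift x p b.+1.

Lemma measurable_up y : measurable [set w : S | up w y].
Proof.
rewrite (_ : [set _ | _] = \bigcup_K \bigcup_N \bigcap_a \bigcap_b
    [set w : S | cone K N a b -> 0 < dif w y a b]).
  apply: bigcupT_measurable => K; apply: bigcupT_measurable => N.
  apply: bigcapT_measurable => a; apply: bigcapT_measurable => b.
  have [c|nc] := boolP (cone K N a b); last first.
    by rewrite (_ : [set _ | _] = setT)//; apply/seteqP; split.
  rewrite (_ : [set _ | _] = [set w : S | 0 < dif w y a b]); last first.
    by apply/seteqP; split => w /= h; [exact: h|move=> _].
  by rewrite -[X in measurable X]setTI; apply: measurable_fun_ltr => //; exact: measurable_dif.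
apply/seteqP; split => w /=.
  by move=> [K [N h]]; exists K => //; exists N => // a _ b _; exact: h.
by move=> [K _ [N _ h]]; exists K, N => a b; exact: h.
Qed.

Lemma measurable_ray x n z : measurable [set w : S | ray w x n = z].
Proof.
elim: n z => [|n IH] z.
  have [xz|xz] := eqVneq x z.
    by rewrite (_ : [set _ | _] = setT)//; apply/seteqP; split.
  rewrite (_ : [set _ | _] = set0)//; apply/seteqP; split => // w /= xz'.
  by rewrite xz' eqxx in xz.
rewrite (_ : [set _ | _] =
    ([set w : S | ray w x n = z - e2] `&` [set w : S | up w (z - e2)]) `|`
    ([set w : S | ray w x n = z - e1] `&` ~` [set w : S | up w (z - e1)])).
  by apply: measurableU; apply: measurableI => //; [|apply: measurableC]; exact: measurable_up.
apply/seteqP; split => w; rewrite -[[set _ | _] w]/(nx w (ray w x n) = z) /nx.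
  by case: asboolP => u <-; [left|right]; rewrite /= addrK.
by move=> [[/= -> u]|[/= -> u]]; rewrite ?(asboolT u) ?(asboolF u) subrK.
Qed.

Lemma measurable_exits_north x a b : measurable [set w : S | exits_north w x a b].
Proof.
rewrite (_ : [set _ | _] = \bigcup_n \bigcup_p
    (if (p <= a)%N then [set w : S | ray w x n = shift x p b.+1] else set0)).
  apply: bigcupT_measurable => n; apply: bigcupT_measurable => p.
  by case: ifP => _ //; exact: measurable_ray.
apply/seteqP; split => w /=.
  by move=> [n [p [pa h]]]; exists n => //; exists p => //; rewrite pa.
by move=> [n _ [p _]]; case: ifP => // pa h; exists n, p.
Qed.

(* The last-passage increments towards shift x M M, along the northern and
   eastern sides of the rectangle with corners x and shift x a b. *)
Definition rim w x a b M := off (pure w (shift x M M)) (M - a) (M - b).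

Lemma dif_rim w x a b M p q : (a <= M)%N -> (b <= M)%N -> (p <= a)%N -> (q <= b)%N ->
  dif w (shift x p q) (M - p) (M - q) =
  g (rim w x a b M) (a - p).+1 (b - q) - g (rim w x a b M) (a - p) (b - q).+1.
Proof.
move=> aM bM pa qb; rewrite difE /rim !g_off.
have -> : shift (shift x p q) (M - p) (M - q) = shift x M M.
  by rewrite /shift /=; congr pair; lia.
have -> : (M - a + (a - p).+1 = (M - p).+1)%N by lia.
have -> : (M - b + (b - q).+1 = (M - q).+1)%N by lia.
have -> : (M - a + (a - p) = M - p)%N by lia.
have -> : (M - b + (b - q) = M - q)%N by lia.
by ring.
Qed.

(** The corner [shift x M M] is already far enough to dictate the first [m] steps of the ray. *)
Definition follows w x M m := forall n p q, (n < m)%N -> ray w x n = shift x p q ->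
  if `[< up w (ray w x n) >] then 0 < dif w (ray w x n) (M - p) (M - q)
  else dif w (ray w x n) (M - p) (M - q) < 0.

Lemma follows_near w x m : regular w -> \forall M \near \oo, follows w x M m.
Proof.
move=> rw; elim: m => [|m IH]; first by apply: nearW.
have [p [q [rE pq]]] := ray_shift w x m.
have [K [N h]] : exists K N, forall a b, cone K N a b ->
    if `[< up w (ray w x m) >] then 0 < dif w (ray w x m) a b else dif w (ray w x m) a b < 0.
  case: asboolP => u; first by case: u => K [N h]; exists K, N.
  by have [//|[K [N h]]] := rw.2 (ray w x m); exists K, N.
have C := cone_diagonal p q K N (diagonal_sequence_nn R).
apply: filterS2 IH C => M IH [_ _ c] n p' q'.
rewrite ltnS leq_eqVlt => /orP[/eqP ->|nm]; last exact: IH.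
by rewrite rE => /shift_inj[<- <-]; rewrite -rE; exact: h.
Qed.

(** Seen from the corner of the rectangle, the northern side is the horizontal axis. Backward
    induction along the ray, from its exit, shows that silencing the vertical axis does not lower
    the values at its sites. *)
Lemma north_horizontal w x a b M n p0 : (a <= M)%N -> (b <= M)%N ->
  (p0 <= a)%N -> ray w x n = shift x p0 b.+1 -> follows w x M n ->
  g (zh (rim w x a b M)) a.+1 b.+1 <= g (zv (rim w x a b M)) a.+1 b.+1.
Proof.
move=> aM bM p0a rn fol; set o := rim w x a b M.
have o0 : forall e : nat * nat, 0 <= o e by move=> e; apply: off_ge0 => s'; exact: pure_ge0.
suff H k i p q : (i + k.+1 = n)%N -> (p <= a)%N -> (q <= b)%N -> ray w x i = shift x p q ->
    g o (a - p).+1 (b - q).+1 <= g (zv o) (a - p).+1 (b - q).+1.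
  have n0 : (0 < n)%N.
    rewrite lt0n; apply/eqP => n0; move: rn; rewrite n0 -[ray _ _ _]shift00.
    by move=> /shift_inj[].
  have := H n.-1 0%N 0%N 0%N; rewrite prednK// add0n shift00 !subn0 => {}H.
  apply: le_trans (H erefl (leq0n _) (leq0n _) erefl).
  by rewrite (g_split _ _ o0) le_max lexx orbT.
elim: k i p q => [|k IH] i p q ikn pa qb rE.
all: have i_n : (i < n)%N by lia.
all: have := fol i p q i_n rE; rewrite rE (dif_rim w x aM bM pa qb) -/o !gSS /= [X in _ <= X + _]/zv /= lerD2l.
all: have := rayS w x i; rewrite /nx rE; case: asboolP => u; rewrite ?(shift_add1, shift_add2) => rE'.
- rewrite subr_gt0 => lt; rewrite (max_idPr (ltW lt)) le_max; apply/orP; right.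
  have e : i.+1 = n by lia.
  by move: rE'; rewrite e rn; move=> /shift_inj[_ [<-]]; rewrite subnn g_zv_h.
- have e : i.+1 = n by lia.
  by move: rE'; rewrite e rn => /shift_inj[_ h]; lia.
- rewrite subr_gt0 => lt; rewrite (max_idPr (ltW lt)) le_max; apply/orP; right.
  have [qb'|qb'] := eqVneq q b; first by rewrite qb' subnn g_zv_h.
  have -> : (b - q = (b - q.+1).+1)%N by lia.
  by apply: (IH i.+1) => //; lia.
- rewrite subr_lt0 => lt; rewrite (max_idPl (ltW lt)) le_max; apply/orP; left.
  have [pa'|pa'] := eqVneq p a.
    have in_ : (i.+1 <= n)%N by lia.
    have := le_ray w x in_; rewrite rn rE' /le_site /shift /= => /andP[]; lia.
  have -> : (a - p = (a - p.+1).+1)%N by lia.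
  by apply: (IH i.+1) => //; lia.
Qed.

(** The exit points at which the model with corner [shift x M M] must behave for its increments to
    bound those of [rim]; the successor in the second list is the one of [vJ_pure_ge]. *)
Definition rim_sites a b M : seq (nat * nat) :=
  [seq ((M - a + i)%N, (M - b)%N) | i <- iota 0 a.+1] ++
  [seq ((M - a)%N, (M - b + j).+1) | j <- iota 0 b.+1].

Lemma rim_sitesP a b M (e : nat * nat) : (b <= M)%N -> e \in rim_sites a b M ->
  (M - a <= e.1)%N /\ (e.2 <= M.+1)%N.
Proof.
move=> bM; rewrite mem_cat => /orP[] /mapP[i]; rewrite mem_iota => /andP[_ hi] -> /=; lia.
Qed.

Lemma size_rim_sites a b M : size (rim_sites a b M) = (a + b).+2.
Proof. by rewrite size_cat !size_map !size_iota addSn addnS. Qed.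

Definition rim_north x a b M : set S :=
  [set w | g (zh (rim w x a b M)) a.+1 b.+1 <= g (zv (rim w x a b M)) a.+1 b.+1].

(** Barring bad exits, the stationary increments are larger than those of [rim] on the northern side
    and smaller on the eastern one, so a northern exit persists in the stationary model. Two demands
    on [t] meet here: it must be positive for the far corner, in direction (1,1), yet small against
    the slope of the rectangle. *)
Lemma rim_compare t w x a b M : - (1 / 2) < t < 1 / 2 -> (a <= M)%N -> (b <= M)%N ->
  rim_north x a b M w ->
  bad_exit' t x M (a, b) (a.+1, b.+1) w \/
  exists2 e, e \in rim_sites a b M & bad_exit t x M (M, M) e w.
Proof.
move=> ht aM bM rN; have [|nb] := pselect (exists2 e, e \in rim_sites a b M & bad_exit t x M (M, M) e w).
  by right.
left; set V := shift x M M; set o := off (st t w V) (M - a) (M - b).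
suff : g (zh o) a.+1 b.+1 <= g (zv o) a.+1 b.+1 by [].
have X0 e : 0 <= st t w V e by exact: st_ge0.
have pE : zh (zv (st t w V)) = pure w V.
  have := @pure_off R t w V 0 0 V; rewrite off00; apply.
  by rewrite shift00.
have side e : e \in rim_sites a b M -> g (zh (st t w V)) e.1 e.2 <= g (zv (st t w V)) e.1 e.2.
  move=> er; rewrite leNgt; apply/negP => /ltW h; apply: nb; exists e => //.
  by rewrite /bad_exit /= subnn off00.
have bulk i j : rim w x a b M (i.+1, j.+1) = o (i.+1, j.+1).
  by rewrite /rim /o /= -pE /zh /zv /= !addnS.
have hor i : (i <= a)%N -> rim w x a b M (i.+1, 0)%N <= o (i.+1, 0)%N.
  move=> ia; rewrite /rim /o /= -pE; apply: hI_pure_le => //.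
  apply: (side ((M - a + i)%N, (M - b)%N)).
  by rewrite mem_cat; apply/orP; left; apply/mapP; exists i => //; rewrite mem_iota.
have ver j : (j <= b)%N -> o (0, j.+1)%N <= rim w x a b M (0, j.+1)%N.
  move=> jb; rewrite /rim /o /= -pE; apply: vJ_pure_ge => //.
  apply: (side ((M - a)%N, (M - b + j).+1)).
  by rewrite mem_cat; apply/orP; right; apply/mapP; exists j => //; rewrite mem_iota.
apply: (@le_trans _ _ (g (zh (rim w x a b M)) a.+1 b.+1)).
  apply: g_mono => -[|i] [|j] _ jb; [exact: lexx|exact: ver|exact: lexx|].
  by have := lexx (rim w x a b M (i.+1, j.+1)); rewrite {1}bulk.
apply: (le_trans rN).
apply: g_mono => -[|i] [|j] ia _; [exact: lexx|exact: lexx|exact: hor|].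
by have := lexx (o (i.+1, j.+1)); rewrite -{1}bulk.
Qed.

Lemma measurable_rim_north x a b M : measurable (rim_north x a b M).
Proof.
have mo : measurable_fun setT (fun w : S => rim w x a b M : conf (nat * nat)%type R).
  exact: (measurableT_comp (@measurable_off R _ _) (measurable_pure _)).
by case: (measurable_exit a.+1 b.+1 mo).
Qed.

Variable mu : probability S R.
Hypothesis hmu : iexp mu (fun w => w) (fun=> 1).

Definition exit_rate a b : R := (b - a)%:R ^+ 3 / (2304 * b.+1%:R ^+ 2).

(** The first term is the exit estimate inside the rectangle; the second is a union bound over the
    rim, which vanishes as [M] grows with the rectangle fixed. *)
Lemma prob_rim_north x a b M : (a < b)%N -> (b <= M)%N ->
  let t : R := (b - a)%:R / (48 * b.+1%:R) in
  M.+1%:R <= (1 + t) * (M - a)%:R ->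
  (mu (rim_north x a b M) <=
     (expR (- exit_rate a b) + (a + b).+2%:R * expR (- (t ^+ 3 * (M - a)%:R)))%:E)%E.
Proof.
move=> ab bM t hM; have aM : (a <= M)%N by lia.
have b0 : 0 < b.+1%:R :> R by rewrite ltr0n.
have t0 : 0 < t by rewrite divr_gt0 ?mulr_gt0// ltr0n; lia.
have t8 : t <= 1 / 8.
  rewrite /t ler_pdivrMr ?mulr_gt0//.
  have : (b - a)%:R <= b.+1%:R :> R by rewrite ler_nat; lia.
  by lra.
have tt : 0 < t <= 1 / 8 by rewrite t0.
have ht : - (1 / 2) < t < 1 / 2 by apply/andP; split; lra.
have ht' : half_rate t = half_rate ((b.+1 - a.+1)%:R / (48 * b.+1%:R)) by [].
have iX : iexp mu (fun w => off (st t w (shift x M M)) (M - a) (M - b))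
    (half_rate ((b.+1 - a.+1)%:R / (48 * b.+1%:R))) by exact: iexp_off_st.
have o0 (w : S) (e : nat * nat) : 0 <= off (st t w (shift x M M)) (M - a) (M - b) e.
  by apply: off_ge0 => s'; exact: st_ge0.
have E1 := exit_at_scale (ltn_ord (Ordinal (ab : a.+1 < b.+1)%N)) iX o0.
have mB e : measurable (bad_exit t x M (M, M) e) by exact: measurable_bad_exit.
pose B : set S := [set w | exists2 e, e \in rim_sites a b M & bad_exit t x M (M, M) e w].
have mBB : measurable B by exact: measurable_exists_seq.
have E2 : (mu B <= (\sum_(e <- rim_sites a b M) expR (- (t ^+ 3 * (M - a)%:R)))%:E)%E.
  apply: boole_seq => // e er.
  have [e1 e2] := rim_sitesP bM er.
  have e1' : (M - a)%:R <= e.1%:R :> R by rewrite ler_nat.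
  apply: le_trans (prob_bad_exit hmu x M (M, M) tt (e := e) _) _.
    apply: (@le_trans _ _ M.+1%:R); first by rewrite ler_nat.
    by apply: (le_trans hM); rewrite ler_pM2l//; lra.
  by rewrite lee_fin ler_expR lerN2 ler_pM2l// exprn_gt0.
have le1 : (mu (rim_north x a b M) <= mu (bad_exit' t x M (a, b) (a.+1, b.+1) `|` B))%E.
  apply: le_measure; rewrite ?inE//; first exact: measurable_rim_north.
    by apply: measurableU => //; exact: measurable_bad_exit'.
  by move=> w; exact: rim_compare.
apply: (le_trans le1); apply: le_trans (measureU2 _ (measurable_bad_exit' _ _ _ _ _) mBB) _.
rewrite EFinD; apply: leeD.
  by apply: (le_trans E1); rewrite subSS.
apply: (le_trans E2); rewrite lee_fin big_const_seq count_predT iter_addr addr0 -[leLHS]mulr_natl.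
by rewrite size_rim_sites.
Qed.

End Exits.

Section AlmostEverywhere.
Context d (T : measurableType d) (R : realType) (mu : probability T R).

Lemma ae_count (I : countType) (Q : I -> T -> Prop) :
  (forall i, {ae mu, forall o, Q i o}) -> {ae mu, forall o, forall i, Q i o}.
Proof.
move=> h; have : {ae mu, forall o, forall n : nat, if unpickle n is Some i then Q i o else True}.
  by apply: ae_foralln => n; case: unpickle => [i|]; [exact: h|apply: aeW].
by apply: filterS => o H i; have := H (pickle i); rewrite pickleK.
Qed.

Lemma ae_mp (Q Q' : T -> Prop) : {ae mu, forall o, Q o} ->
  (forall o, Q o -> Q' o) -> {ae mu, forall o, Q' o}.
Proof. by move=> h1 h; move: h1; apply: filterS. Qed.

Lemma ae_mp2 (Q1 Q2 Q' : T -> Prop) : {ae mu, forall o, Q1 o} -> {ae mu, forall o, Q2 o} ->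
  (forall o, Q1 o -> Q2 o -> Q' o) -> {ae mu, forall o, Q' o}.
Proof. by move=> h1 h2 h; move: h1 h2; apply: filterS2. Qed.

Lemma prob_le_ae (E B : set T) : measurable E -> measurable B ->
  {ae mu, forall o, E o -> B o} -> (mu E <= mu B)%E.
Proof.
move=> mE mB [N [mN N0 h]].
apply: (@le_trans _ _ (mu (B `|` N))).
  apply: le_measure; rewrite ?inE//; first exact: measurableU.
  move=> o Eo; have [Bo|nB] := pselect (B o); first by left.
  by right; apply: h => /= H; apply: nB; exact: H.
apply: le_trans (measureU2 _ mB mN) _.
by rewrite [X in (_ + X)%E]N0 adde0.
Qed.

End AlmostEverywhere.

Section ExitProbability.
Variable R : realType.
Local Notation S := (conf (int * int)%type R).
Implicit Types (w : int * int -> R) (z x c : int * int) (a b i p m n N M : nat).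

Variable mu : probability S R.
Hypothesis hmu : iexp mu (fun w => w) (fun=> 1).

Lemma reindex_invariant (tau : int * int -> int * int) (E : set S) :
  injective tau -> measurable E -> mu [set w : S | E (fun z => w (tau z))] = mu E.
Proof.
move=> tI mE.
have h : iexp mu (fun w z => w (tau z)) (fun=> 1).
  have := iexp_reindex hmu (fun=> 1) tI; rewrite divr1.
  by congr (iexp mu _ _); apply/funext => w; apply/funext => z; rewrite mulr1.
exact: (iexp_unique h hmu mE).
Qed.

Lemma measurable_reindex (tau : int * int -> int * int) (E : set S) :
  measurable E -> measurable [set w : S | E (fun z => w (tau z))].
Proof.
move=> mE; have m : measurable_fun setT (fun w : S => (fun z => w (tau z)) : S).
  by apply: measurable_to_conf => z; exact: measurable_coord.
by rewrite -[X in measurable X]setTI; exact: m.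
Qed.

Lemma reindex_ae (tau : int * int -> int * int) (Q : S -> Prop) : injective tau ->
  {ae mu, forall w, Q w} -> {ae mu, forall w : S, Q (fun z => w (tau z))}.
Proof.
move=> tI [N [mN N0 h]]; exists [set w : S | N (fun z => w (tau z))]; split.
- exact: measurable_reindex.
- by rewrite reindex_invariant.
- by move=> w /= nQ; exact: h.
Qed.

Lemma ae_regular : {ae mu, forall w : S, regular w}.
Proof.
have h1 : {ae mu, forall w : S, forall z, 0 < w z} by apply: ae_count => z; exact: ae_positive.
have h2 : {ae mu, forall w : S, forall i : (int * int) * (nat * nat), dif w i.1 i.2.1 i.2.2.+1 != 0}.
  by apply: ae_count => -[z [a b]]; exact: ae_dif_neq0.
have h3 : {ae mu, forall w : S, forall z, up w z \/ down w z}.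
  apply: ae_count => z; apply: (ae_mp2 (ae_cauchy_dif hmu z) (ae_diag_not_to0 hmu z)) => w.
  exact: up_or_down.
have h12 : {ae mu, forall w : S, tie_free w}.
  by apply: (ae_mp2 h1 h2) => w p1 p2; split => // z a b; exact: (p2 (z, (a.+1, b))).
exact: (ae_mp2 h12 h3).
Qed.

Lemma prob_exits_north x a b : (a < b)%N ->
  (mu [set w : S | exits_north w x a b] <= (expR (- exit_rate R a b))%:E)%E.
Proof.
move=> ab; pose D N : set S := \bigcap_M rim_north x a b (N + M).
have mD N : measurable (D N) by apply: bigcapT_measurable => M; exact: measurable_rim_north.
have mU : measurable (\bigcup_N D N) by exact: bigcupT_measurable.
apply: (@le_trans _ _ (mu (\bigcup_N D N))).
  apply: prob_le_ae => //; first exact: measurable_exits_north.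
  apply: (ae_mp ae_regular) => w rw [n [p [pa rE]]].
  have [N _ hN] := follows_near x n rw.
  exists (N + b)%N => // M _; apply: (@north_horizontal _ _ _ _ _ _ n p) => //; try lia.
  by apply: hN => /=; lia.
have ndD N : D N `<=` D N.+1 by move=> w h M _; rewrite addSnnS; exact: h.
apply: prob_bigcup_nondecreasing => // N.
apply/lee_addgt0Pr => e e0.
pose t : R := (b - a)%:R / (48 * b.+1%:R).
have t0 : 0 < t by rewrite divr_gt0 ?mulr_gt0// ltr0n; lia.
have t3 : 0 < t ^+ 3 by rewrite exprn_gt0.
(* The first summand yields the slope condition between [M.+1] and [M - a], the second makes the
   union bound at most [e]. *)
pose A : R := a.+1%:R / t + (a + b).+2%:R / (t ^+ 3 * e).
have A1 : 0 < a.+1%:R / t by rewrite divr_gt0.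
have A2 : 0 < (a + b).+2%:R / (t ^+ 3 * e).
  apply: divr_gt0; [by rewrite ltr0n|exact: mulr_gt0].
pose L := Num.bound A.
have hL : A < L%:R by apply: archi_boundP; rewrite addr_ge0// ltW.
pose M := (N + b + L + a)%N.
have hM : A <= (M - a)%:R.
  by apply: (le_trans (ltW hL)); rewrite ler_nat /M; lia.
apply: (@le_trans _ _ (mu (rim_north x a b M))).
  apply: le_measure; rewrite ?inE//; first exact: measurable_rim_north.
  by move=> w /(_ (b + L + a)%N I); rewrite /M !addnA.
have bM : (b <= M)%N by rewrite /M; lia.
have hM' : M.+1%:R <= (1 + t) * (M - a)%:R.
  have h : a.+1%:R / t <= (M - a)%:R by apply: le_trans hM; rewrite /A; lra.
  move: h; rewrite ler_pdivrMr// => h.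
  have -> : M.+1%:R = (M - a)%:R + a.+1%:R :> R by rewrite -natrD; congr _%:R; rewrite /M; lia.
  by lra.
apply: (le_trans (prob_rim_north hmu x ab bM hM')).
rewrite -/t -EFinD lee_fin lerD2l.
have M0 : 0 < (M - a)%:R :> R by apply: lt_le_trans hM; rewrite addr_gt0.
have tM : 0 < t ^+ 3 * (M - a)%:R := mulr_gt0 t3 M0.
have te : 0 < t ^+ 3 * e := mulr_gt0 t3 e0.
have le1 : expR (- (t ^+ 3 * (M - a)%:R)) <= (t ^+ 3 * (M - a)%:R)^-1.
  rewrite expRN lef_pV2 ?posrE ?expR_gt0//.
  by apply: le_trans (expR_ge1Dx _); rewrite lerDr.
have c0 : 0 <= (a + b).+2%:R :> R by rewrite ler0n.
apply: (le_trans (ler_wpM2l c0 le1)).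
rewrite ler_pdivrMr//.
have : (a + b).+2%:R / (t ^+ 3 * e) <= (M - a)%:R by apply: le_trans hM; rewrite /A; lra.
rewrite ler_pdivrMr// => h; apply: (le_trans h).
by rewrite mulrC (mulrC e) mulrAC.
Qed.

End ExitProbability.

(** * Reflection and translation of the weights *)

Section Symmetries.
Variable R : realType.
Local Notation S := (conf (int * int)%type R).
Implicit Types (w : int * int -> R)
  (y v z x c : int * int)
  (a b i j q n K N : nat)
  (s : seq (int * int)).

Definition swap z : int * int := (z.2, z.1).

Lemma swapK : involutive swap. Proof. by case. Qed.

Lemma pure_swap w v : pure (fun z => w (swap z)) (swap v) = tr (pure w v).
Proof.
by apply/funext => -[i j]; rewrite /tr /pure /zh /zv /=; case: eqP; case: eqP.
Qed.

Lemma dif_swap w y a b : dif (fun z => w (swap z)) (swap y) a b = - dif w y b a.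
Proof.
rewrite /dif (_ : shift (swap y) a b = swap (shift y b a)) // pure_swap hI_tr vJ_tr.
by rewrite [RHS]opprB.
Qed.

Lemma cone_sym K N a b : cone K N a b = cone K N b a.
Proof. by rewrite /cone; apply/and4P/and4P => -[]. Qed.

Lemma up_swap w y : up (fun z => w (swap z)) (swap y) <-> down w y.
Proof.
split=> -[K [N h]]; exists K, N => a b; rewrite cone_sym => /h.
  by rewrite dif_swap oppr_gt0.
by rewrite dif_swap oppr_gt0.
Qed.

Lemma up_not_down w y : up w y -> ~ down w y.
Proof.
move=> [K [N h]] [K' [N' h']].
have c := cone_diag K (leq_addr N' N); have c' := cone_diag K' (leq_addl N N').
by have := lt_trans (h _ _ c) (h' _ _ c'); rewrite ltxx.
Qed.

Lemma ray_swap w x n : regular w ->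
  ray (fun z => w (swap z)) (swap x) n = swap (ray w x n).
Proof.
move=> rw; elim: n => // n IH; rewrite !rayS IH /nx.
case: asboolP => [/up_swap d|nd]; case: asboolP => [u|nu].
- by case: (up_not_down u d).
- by rewrite [LHS]surjective_pairing.
- by rewrite [LHS]surjective_pairing.
by exfalso; apply: nd; apply/up_swap; case: (rw.2 (ray w x n)).
Qed.

Definition exits_east w x a b := exists n q, (q <= b)%N /\ ray w x n = shift x a.+1 q.

Lemma measurable_exits_east x a b : measurable [set w : S | exits_east w x a b].
Proof.
rewrite (_ : [set _ | _] = \bigcup_n \bigcup_q
    (if (q <= b)%N then [set w : S | ray w x n = shift x a.+1 q] else set0)).
  apply: bigcupT_measurable => n; apply: bigcupT_measurable => q.
  by case: ifP => _ //; exact: measurable_ray.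
apply/seteqP; split => w /=.
  by move=> [n [q [qb h]]]; exists n => //; exists q => //; rewrite qb.
by move=> [n _ [q _]]; case: ifP => // qb h; exists n, q.
Qed.

Lemma exits_swap w x a b : regular w ->
  exits_east w x a b -> exits_north (fun z => w (swap z)) (swap x) b a.
Proof.
move=> rw [n [q [qb rE]]]; exists n, q; split => //.
by rewrite ray_swap// rE.
Qed.

Variable mu : probability S R.
Hypothesis hmu : iexp mu (fun w => w) (fun=> 1).

Lemma prob_exits_east x a b : (b < a)%N ->
  (mu [set w : S | exits_east w x a b] <= (expR (- exit_rate R b a))%:E)%E.
Proof.
move=> ba; have mN := measurable_exits_north (R := R) (swap x) b a.
apply: le_trans (prob_exits_north hmu (swap x) ba).
have e := reindex_invariant hmu (inv_inj swapK) mN.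
apply: (@le_trans _ _ (mu [set w : S | exits_north (fun z => w (swap z)) (swap x) b a])); last by rewrite e.
apply: prob_le_ae; [exact: measurable_exits_east|exact: measurable_reindex mN|].
by apply: (ae_mp (ae_regular hmu)) => w rw; exact: exits_swap.
Qed.

Definition translate y w : int * int -> R := fun z => w (y + z).

Lemma dif_translate y w z a b : dif (translate y w) z a b = dif w (y + z) a b.
Proof.
suff H v : pure (translate y w) v = pure w (y + v).
  rewrite /dif H; congr (hI (pure w _) _ _ - vJ (pure w _) _ _);
  by rewrite /shift /=; congr pair; rewrite addrA.
apply/funext => s; rewrite /pure /zh /zv; case: ifP => // _; case: ifP => // _.
by congr (Num.max (w _) _); rewrite [LHS]surjective_pairing /cor /=; congr pair; lia.
Qed.

Lemma up_translate y w z : up (translate y w) z <-> up w (y + z).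
Proof.
by split=> -[K [N h]]; exists K, N => a b /h; rewrite dif_translate.
Qed.

Lemma ray_translate y w z n : y + ray (translate y w) z n = ray w (y + z) n.
Proof.
elim: n => // n IH; rewrite !rayS -IH /nx.
have [u|nu] := pselect (up w (y + ray (translate y w) z n)).
  by rewrite !asboolT ?addrA//; apply/up_translate.
by rewrite !asboolF ?addrA// => /up_translate.
Qed.

End Symmetries.

(** * Busemann limits *)

Definition cones : set_system (nat * nat)%type :=
  fun P => exists K N, forall a b, cone K N a b -> P (a, b).

Lemma cone_narrow K N K' N' a b : (K <= K')%N -> (N <= N')%N -> cone K' N' a b -> cone K N a b.
Proof.
move=> KK NN /and4P[c1 c2 c3 c4]; apply/and4P; split; try lia.
  by have [ab|ba] := leqP b a; nia.
by have [ab|ba] := leqP a b; nia.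
Qed.

Global Instance cones_filter : ProperFilter cones.
Proof.
split; first by move=> [K [N /(_ N N (cone_diag K (leqnn N)))]].
split.
- by exists 0%N, 0%N.
- move=> P Q [K [N h]] [K' [N' h']]; exists (K + K')%N, (N + N')%N => a b c; split.
    by apply: h; apply: cone_narrow c; lia.
  by apply: h'; apply: cone_narrow c; lia.
- by move=> P Q PQ [K [N h]]; exists K, N => a b /h /PQ.
Qed.

Lemma cones_shift_right k (P : set (nat * nat)) : cones P ->
  cones [set p | P ((p.1 - k)%N, (p.2 + k)%N)].
Proof.
(* Doubling [K] leaves room for the translation by [k], which is negligible at this depth. *)
move=> [K [N h]]; exists (2 * K.+1)%N, (N + k + 4 * (K.+1 * k))%N => a b /and4P[c1 c2 c3 c4].
have u (p q : nat) : (2 * K.+1 * p <= (2 * K.+1).+1 * q)%N -> (2 * (K * p) <= 2 * (K * q) + q)%N.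
  move=> hpq; have [pq|qp] := leqP p q.
    by have := leq_mul (leqnn K) pq; lia.
  have pE : p = (q + (p - q))%N by lia.
  move: (p - q)%N pE => r pE; subst p; lia.
have u1 := u _ _ c3; have u2 := u _ _ c4.
have e1 : (K.+1 * k = K * k + k)%N by rewrite mulSn addnC.
rewrite /=; apply: h; apply/and4P; split; [lia|lia| |].
  by rewrite mulnDr mulnBr e1 mulSn; lia.
have := leq_mul (leqnn K) (leq_subr k a); rewrite mulSn mulnDr; lia.
Qed.

Lemma cones_shift_left k (P : set (nat * nat)) : cones P ->
  cones [set p | P ((p.1 + k)%N, (p.2 - k)%N)].
Proof.
move=> [K [N h]].
have [K' [N' h']] := @cones_shift_right k [set p | P (p.2, p.1)]
  (ex_intro _ K (ex_intro _ N (fun a b c => h b a (etrans (cone_sym _ _ _ _) c)))).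
by exists K', N' => a b; rewrite cone_sym => /h'.
Qed.

Section Busemann.
Variable R : realType.
Local Notation S := (conf (int * int)%type R).
Implicit Types (w : int * int -> R) (y v z c : int * int) (a b k K N : nat) (s : seq (int * int)).

Lemma cvg_dif w y : cauchy_dif y w ->
  exists l : R, (fun p : nat * nat => dif w y p.1 p.2) @ cones --> l.
Proof.
move=> C; apply/cvg_ex.
apply/cauchy_cvgP/cauchy_exP => e e0.
have [k ke] : exists k : nat, k.+1%:R^-1 < e.
  exists (Num.bound e^-1); rewrite invf_plt ?posrE//.
  have e1 : 0 <= e^-1 by rewrite invr_ge0 ltW.
  by apply: lt_le_trans (archi_boundP e1) _; rewrite ler_nat.
have [K [N h]] := C k; exists (dif w y N N), K, N => a b c /=.
by apply: le_lt_trans (h _ _ _ _ (cone_diag K (leqnn N)) c) ke.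
Qed.

Definition south_east y k : int * int := (y.1 + k%:Z, y.2 - k%:Z).

Definition lp_gap w y k (p : nat * nat) : R :=
  lp w y p.1 p.2 - lp w (south_east y k) (p.1 - k) (p.2 + k).

Lemma max_subr (u v : R) : Num.max u v = Num.max (u - v) 0 + v.
Proof. by rewrite addr_maxl subrK add0r. Qed.

(** The neighbours [y] and [y + (1, -1)] have the common successor [y + e1]; relative to the
    last-passage time from there, each contributes its weight and a positive part of plus or minus a
    [dif]. *)
Lemma lp_gap_step w y a b : lp_gap w y 1 (a.+1, b.+1) =
  pos w y + Num.max (dif w y a.+1 b.+1) 0
  - (pos w (south_east y 1) + Num.max (- dif w (south_east y 1) a b.+2) 0).
Proof.
rewrite /lp_gap /= subn1 addn1 /=.
have e : south_east y 1 + e2 = y + e1.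
  by rewrite [LHS]surjective_pairing [RHS]surjective_pairing /=; congr pair; lia.
rewrite lpSS dif_lpSS.
set B := lp w (y + e1) a b.+1.
have lE : lp w (south_east y 1) a b.+2 = pos w (south_east y 1) +
    Num.max (- dif w (south_east y 1) a b.+2) 0 + B.
  case: a @B => [|a] B.
    rewrite lp0S dif_lp0S e (max_idPr _) ?addr0// oppr_le0.
    by apply: g_ge0 => s; exact: pure_ge0.
  by rewrite lpSS dif_lpSS e -/B opprB -addrA; congr (_ + _); exact: max_subr.
rewrite lE; set C := lp w (y + e2) _ _; set D := Num.max (- _) 0.
rewrite maxC (max_subr C B).
by ring.
Qed.

Lemma cvg_cones_right (f : nat * nat -> R) (l : R) k : f @ cones --> l ->
  (fun p : nat * nat => f ((p.1 - k)%N, (p.2 + k)%N)) @ cones --> l.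
Proof. by move=> fl A /fl h; exact: (cones_shift_right k h). Qed.

Lemma cvg_cones_left (f : nat * nat -> R) (l : R) k : f @ cones --> l ->
  (fun p : nat * nat => f ((p.1 + k)%N, (p.2 - k)%N)) @ cones --> l.
Proof. by move=> fl A /fl h; exact: (cones_shift_left k h). Qed.

Lemma cvg_cones_eq (f h : nat * nat -> R) (l : R) K N :
  (forall a b, cone K N a b -> f (a, b) = h (a, b)) -> f @ cones --> l -> h @ cones --> l.
Proof.
move=> fh fl A /fl [K' [N' H]]; exists (K + K')%N, (N + N')%N => a b c /=.
rewrite -fh; first by apply: H; apply: cone_narrow c; lia.
by apply: cone_narrow c; lia.
Qed.

Lemma cvg_max0 (f : nat * nat -> R) (l : R) : f @ cones --> l ->
  (fun p : nat * nat => Num.max (f p) 0) @ cones --> Num.max l 0.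
Proof.
move=> fl; rewrite (_ : (fun p : nat * nat => _) = fun p : nat * nat => (f p + `|f p|) / 2); last first.
  by apply/funext => p; rewrite maxr_absE addr0 subr0.
rewrite maxr_absE addr0 subr0; apply: cvgMl; apply: cvgD => //.
exact: cvg_norm.
Qed.

Lemma cvg_lp_gap w y k : (forall z, cauchy_dif z w) ->
  exists l : R, lp_gap w y k @ cones --> l.
Proof.
move=> C; elim: k => [|k [l IH]].
  exists 0; rewrite (_ : lp_gap w y 0 = fun=> 0); first exact: cvg_cst.
  apply/funext => p; rewrite /lp_gap subn0 addn0 (_ : south_east y 0 = y) ?subrr//.
  by case: y => y1 y2; rewrite /south_east /= addr0 subr0.
set z := south_east y k.
have [l1 h1] := cvg_dif (C z).
have [l2 h2] := cvg_dif (C (south_east z 1)).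
have [l' h'] : exists l' : R, lp_gap w z 1 @ cones --> l'.
  exists (pos w z + Num.max l1 0 - (pos w (south_east z 1) + Num.max (- l2) 0)).
  have c1 : (fun=> pos w z) @ cones --> pos w z by exact: cvg_cst.
  have c2 : (fun=> pos w (south_east z 1)) @ cones --> pos w (south_east z 1) by exact: cvg_cst.
  have H := cvgB (cvgD c1 (cvg_max0 h1)) (cvgD c2 (cvg_max0 (cvgN (cvg_cones_right 1 h2)))).
  refine (@cvg_cones_eq _ _ _ 0 1 _ (H _ _ _ _)); move=> a b /and4P[]; case: a b => [|a] [|b]// _ _ _ _.
  by rewrite lp_gap_step /= !fctE /= subn1 addn1.
exists (l + l'); rewrite (_ : lp_gap w y k.+1 =
    fun p : nat * nat => lp_gap w y k p + lp_gap w z 1 ((p.1 - k)%N, (p.2 + k)%N)).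
  exact: (cvgD IH (cvg_cones_right k h')).
apply/funext => p; rewrite /lp_gap /= -subnDA -addnA addn1.
rewrite (_ : south_east z 1 = south_east y k.+1); first by rewrite addrA subrK.
by rewrite /south_east /=; congr pair; lia.
Qed.

Definition north_west y k : int * int := (y.1 - k%:Z, y.2 + k%:Z).

Definition lp_gap' w y k (p : nat * nat) : R :=
  lp w y p.1 p.2 - lp w (north_west y k) (p.1 + k) (p.2 - k).

Lemma cvg_lp_gap' w y k : (forall z, cauchy_dif z w) ->
  exists l : R, lp_gap' w y k @ cones --> l.
Proof.
move=> C; have [l h] := cvg_lp_gap (north_west y k) k C.
exists (- l); refine (@cvg_cones_eq _ _ _ 0 k _ (cvgN (cvg_cones_left k h))); move=> a b /and4P[_ kb _ _].
rewrite /lp_gap /lp_gap' /= [LHS]opprB addnK subnK//.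
rewrite (_ : south_east (north_west y k) k = y)//.
by case: y {h} => y1 y2; rewrite /south_east /north_west /= subrK addrK.
Qed.

End Busemann.

(** * Reversed paths and the comparison of two sites *)

Section Reversal.
Variable R : realType.
Local Notation S := (conf (int * int)%type R).
Implicit Types (w : int * int -> R)
  (y v z x : int * int)
  (a b i j p q m n k N : nat)
  (s : seq (int * int)).

Definition neg w : int * int -> R := fun z => w (- z).

Lemma negK w : neg (neg w) = w.
Proof. by apply/funext => z; rewrite /neg opprK. Qed.

Lemma shift_opp x a b : shift (- shift x a b) a b = - x.
Proof. by rewrite [RHS]surjective_pairing /shift /=; congr pair; lia. Qed.

Lemma lp_reverse_le w x a b : tie_free w -> tie_free (neg w) ->
  lp w x a b <= lp (neg w) (- shift x a b) a b.
Proof.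
move=> tf tf'; have [p1 p2 p3 _] := greedy_max x tf (erefl (a + b)%N).
set s := greedy w _ _ _ _ in p1 p2 p3.
have [_ _ _ h] := greedy_max (- shift x a b) tf' (erefl (a + b)%N).
pose s' := [seq - z | z <- rev (belast x s)].
have ps : path up_right (- shift x a b) s'.
  rewrite path_map -p2.
  rewrite (eq_path (e' := fun u v => up_right v u)) ?rev_path// => u u'.
  by rewrite /up_right /= opprK addrC.
have ls : last (- shift x a b) s' = shift (- shift x a b) a b.
  rewrite shift_opp last_map -p2; congr (- _).
  by case: (s) => //= z s0; rewrite rev_cons last_rcons.
have [+ _] := h _ ps ls.
have wx : w x + path_weight w s = path_weight (neg w) s' + w (shift x a b).
  have -> : w x + path_weight w s = \sum_(z <- x :: s) w z by rewrite big_cons.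
  rewrite lastI p2 -cats1 big_cat big_seq1 /path_weight /s' big_map; congr (_ + _).
  rewrite -(perm_big _ (permEl (perm_rev (belast x s)))).
  by apply: eq_bigr => z _; rewrite /neg opprK.
by rewrite p3 in wx; rewrite {3}/neg opprK; lra.
Qed.

(** Reversing and reflecting a path keeps its weight: passage times into a site become passage times
    out of a site for [neg w], to which the forward limits apply. *)
Lemma lp_reverse w x a b : tie_free w -> tie_free (neg w) ->
  lp w x a b = lp (neg w) (- shift x a b) a b.
Proof.
move=> tf tf'; apply/eqP; rewrite eq_le lp_reverse_le//=.
have := @lp_reverse_le (neg w) (- shift x a b) a b tf'.
by rewrite negK shift_opp opprK; apply.
Qed.

Lemma lp_through w x p q n n' : tie_free w -> (p <= n)%N -> (q <= n')%N ->
  lp w x p q + lp w (shift x p q) (n - p) (n' - q) - w (shift x p q) <= lp w x n n'.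
Proof.
move=> tf pn qn.
have [p1 p2 p3 _] := greedy_max x tf (erefl (p + q)%N).
have [q1 q2 q3 _] := greedy_max (shift x p q) tf (erefl (n - p + (n' - q))%N).
have [_ _ _ h] := greedy_max x tf (erefl (n + n')%N).
have e : shift (shift x p q) (n - p) (n' - q) = shift x n n'.
  by rewrite /shift /=; congr pair; lia.
have := h (greedy w (p + q) x p q ++ greedy w (n - p + (n' - q)) (shift x p q) (n - p) (n' - q)).
rewrite cat_path last_cat p1 p2 q1 q2 e path_weight_cat p3 q3 => /(_ isT erefl)[+ _].
by lra.
Qed.

Lemma lp_ray_through w x m p q : regular w -> ray w x m = shift x p q -> (p + q)%N = m ->
  \forall n \near \oo, lp w x n n =
    lp w x p q + lp w (shift x p q) (n - p) (n - q) - w (shift x p q).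
Proof.
move=> rw rE pq; have tf := rw.1.
apply: filterS (follow rw (diagonal_sequence_nn R) rE pq) => n /= [pn qn gE].
have [_ _ h _] := greedy_max x tf (erefl (n + n)%N).
have /geodesicP sE : is_geodesic w x (shift x p q) (segment (ray w x) 0 m).
  by rewrite -rE; exact: geodesic_segment.
have [_ _ p3 _] := greedy_max x tf (erefl (p + q)%N).
have [_ _ q3 _] := greedy_max (shift x p q) tf (erefl (n - p + (n - q))%N).
move: h; rewrite gE path_weight_cat sE// p3 rE q3; lra.
Qed.

Lemma lp_fresh w y a b t t' : 0 < t -> 0 < t' ->
  lp (upd w y t) y a b - lp (upd w y t') y a b = t - t'.
Proof.
move=> t0 t'0; set v := shift y a b.
have zE : y = cor v (a.+1, b.+1).
  by rewrite [LHS]surjective_pairing /v /cor /shift /=; congr pair; lia.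
have ge u u' i j : ~~ ((a < i)%N && (b < j)%N) ->
    g (pure (upd w y u) v) i j = g (pure (upd w y u') v) i j.
  move=> hij; apply: g_ext => i' j' hi hj.
  have ne : (i', j') != (a.+1, b.+1).
    by apply: contra hij => /eqP[<- <-]; rewrite hi hj.
  by rewrite !(pure_upd _ _ zE ne).
rewrite /lp !gSS !pure_corner (ge t t' a b.+1) ?(ge t t' a.+1 b) ?ltnn ?andbF//.
have posE u : 0 < u -> pos (upd w y u) y = u.
  by move=> u0; rewrite /pos /upd eqxx; apply/max_idPl/ltW.
by rewrite !posE//; ring.
Qed.

Lemma lp_upd_out w z y a b t : ~~ le_site y z -> lp (upd w z t) y a b = lp w y a b.
Proof.
move=> yz; apply: g_ext => i j ia jb; rewrite /pure /zh /zv /=.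
case: ifP => // _; case: ifP => // _; rewrite /pos /upd; case: eqP => // zE.
exfalso; move/negP: yz; apply; rewrite -zE /le_site /cor /shift /=.
by apply/andP; split; lia.
Qed.

Lemma neg_upd0 w t : neg (upd w 0 t) = upd (neg w) 0 t.
Proof. by apply/funext => z; rewrite /neg /upd oppr_eq0. Qed.

Lemma measurable_lp y a b : measurable_fun setT (fun w : S => lp w y a b).
Proof. exact: (measurableT_comp (measurable_g _ _) (measurable_pure _)). Qed.

(* The difference between the largest weights of the paths through 0 and of
   those through (k, -k), both from far south-west to far north-east. *)
Definition through_gap w k n : R :=
  lp_gap w 0 k (n, n) + lp_gap' (neg w) 0 k (n, n) - w 0 + w (south_east 0 k).

Variable mu : probability S R.
Hypothesis hmu : iexp mu (fun w => w) (fun=> 1).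

(** The weight of [0] enters two passage times positively and is subtracted once, while the paths
    from [(k, -k)] avoid [0]: the gap moves exactly with that weight. *)
Lemma ae_through_gap k : (0 < k)%N -> {ae mu, forall w : S, ~ to0 (through_gap w k)}.
Proof.
move=> k0; apply: (ae_not_to0 hmu (f := fun n w => through_gap w k n) (z := 0)).
  move=> n; have m1 y a b := measurable_lp y a b.
  have mneg : measurable_fun setT (fun w : S => neg w : S).
    by apply: measurable_to_conf => z; exact: measurable_coord.
  have m2 y a b : measurable_fun setT (fun w : S => lp (neg w) y a b).
    exact: (measurableT_comp (m1 y a b) mneg).
  apply: measurable_funD; last exact: measurable_coord.
  apply: measurable_funB; last exact: measurable_coord.
  by apply: measurable_funD; apply: measurable_funB.
move=> n w t t' n0 t0 t'0.
rewrite /through_gap /lp_gap /lp_gap' !neg_upd0.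
have n1 : ~~ le_site (south_east 0 k) 0 by rewrite /le_site /=; lia.
have n2 : ~~ le_site (north_west 0 k) 0 by rewrite /le_site /=; lia.
rewrite !(lp_upd_out _ _ _ _ n1) !(lp_upd_out _ _ _ _ n2).
have e0 : (south_east 0 k == 0) = false.
  by apply/eqP => -[]; lia.
rewrite {3 4 7 8}/upd eqxx e0 /=.
have h1 := lp_fresh w 0 n n t0 t'0; have h2 := lp_fresh (neg w) 0 n n t0 t'0.
by lra.
Qed.

End Reversal.

(** * Ancestors *)

Section Ancestors.
Variable R : realType.
Local Notation S := (conf (int * int)%type R).
Implicit Types (w : int * int -> R) (v x c : int * int) (a b i n k K N : nat).

Definition southwest a b : int * int := (- a%:Z, - b%:Z).

Lemma shift_southwest a b : shift (southwest a b) a b = 0.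
Proof. by rewrite /shift /southwest /= !addNr. Qed.

Definition ancestor w n := exists a b, (a + b)%N = n /\ ray w (southwest a b) n = 0.

Definition has_past w := forall n, ancestor w n.

Definition stray K n : set S :=
  [set w | exists2 i, i \in iota 0 n.+1 &
     ~~ cone K 0 i (n - i) /\ ray w (southwest i (n - i)) n = 0].

Lemma measurable_ancestor n : measurable [set w : S | ancestor w n].
Proof.
rewrite (_ : [set _ | _] = \bigcup_a \bigcup_b
    (if (a + b)%N == n then [set w : S | ray w (southwest a b) n = 0] else set0)).
  apply: bigcupT_measurable => a; apply: bigcupT_measurable => b.
  by case: ifP => _ //; exact: measurable_ray.
apply/seteqP; split => w /=.
  by move=> [a [b [/eqP ab h]]]; exists a => //; exists b => //; rewrite ab.
by move=> [a _ [b _]]; case: ifP => // /eqP ab h; exists a, b.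
Qed.

Lemma measurable_has_past : measurable [set w : S | has_past w].
Proof.
rewrite (_ : [set _ | _] = \bigcap_n [set w : S | ancestor w n]).
  by apply: bigcapT_measurable => n; exact: measurable_ancestor.
by apply/seteqP; split => w h n; [move=> _; exact: h|exact: (h n I)].
Qed.

Lemma measurable_stray_site K n i : measurable
  [set w : S | ~~ cone K 0 i (n - i) /\ ray w (southwest i (n - i)) n = 0].
Proof.
case: (cone _ _ _ _) => /=.
  by rewrite (_ : [set _ | _] = set0)//; apply/seteqP; split => // w [].
rewrite (_ : [set _ | _] = [set w : S | ray w (southwest i (n - i)) n = 0]).
  exact: measurable_ray.
by apply/seteqP; split => w => [[]|].
Qed.

Lemma measurable_stray K n : measurable (stray K n).
Proof. by apply: measurable_exists_seq => i; exact: measurable_stray_site. Qed.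

Variable mu : probability S R.
Hypothesis hmu : iexp mu (fun w => w) (fun=> 1).

Definition stray_rate K : R := (16 * 2304 * K.+1%:R ^+ 3)^-1.

Lemma stray_rate_gt0 K : 0 < stray_rate K.
Proof.
rewrite /stray_rate; have Q0 : 0 < 2304 :> R by rewrite ltr0n.
move: (2304 : R) Q0 => Q Q0.
by rewrite invr_gt0 mulr_gt0 ?exprn_gt0 ?ltr0n// mulr_gt0.
Qed.

(** For [d = b - 1 - a] one has [b <= 2 * K.+1 * d], so [d ^ 3 / b ^ 2] is at least
    [b / (8 * K.+1 ^ 3)]; then [a + b <= 2 * b] accounts for the factor 16. The lower bound on
    [a + b] pays for the predecessor of [b]. *)
Lemma exit_rate_wide K a b : (4 * K.+1 <= a + b)%N -> (K.+1 * a < K * b)%N ->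
  stray_rate K * (a + b)%:R <= exit_rate R a b.-1.
Proof.
move=> h1 h2; have b0 : (0 < b)%N by case: b h1 h2 => //; lia.
have ab : (a < b)%N.
  rewrite ltnNge; apply/negP => ba; move: h2; rewrite ltnNge => /negP; apply.
  by apply: leq_mul.
have kb : (b < K.+1 * (b - a))%N by rewrite mulnBr; move: h2; rewrite !mulSn; lia.
have wide : (b <= 2 * K.+1 * (b.-1 - a))%N.
  have : (K.+1 * (b - a) = K.+1 * (b.-1 - a) + K.+1)%N.
    by rewrite -[X in _ = (_ + X)%N]muln1 -mulnDr; congr muln; have : (b.-1 - a + 1 = b - a)%N; lia.
  have : (a + b < 2 * b)%N by lia.
  by rewrite -mulnA; lia.
rewrite /exit_rate prednK// /stray_rate.
have Q0 : 0 < 2304 :> R by rewrite ltr0n.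
move: (2304 : R) Q0 => Q Q0.
set k : R := K.+1%:R; set B : R := b%:R; set d : R := (b.-1 - a)%:R.
have k0 : 0 < k by rewrite ltr0n.
have B0 : 0 < B by rewrite ltr0n.
have wide' : B <= 2 * k * d by rewrite /B /k /d -!natrM ler_nat.
have aB : (a + b)%:R <= 2 * B by rewrite /B -natrM ler_nat; lia.
have B3 : B ^+ 3 <= 8 * k ^+ 3 * d ^+ 3.
  have -> : 8 * k ^+ 3 * d ^+ 3 = (2 * k * d) ^+ 3 by ring.
  by rewrite lerXn2r// nnegrE ltW// (lt_le_trans B0).
have k3 : 0 < k ^+ 3 by rewrite exprn_gt0.
have QB : 0 < Q * B ^+ 2 by rewrite mulr_gt0// exprn_gt0.
have Qk : 0 < 16 * Q * k ^+ 3 by rewrite !mulr_gt0.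
apply: (@le_trans _ _ ((16 * Q * k ^+ 3)^-1 * (2 * B))).
  by rewrite ler_pM2l ?invr_gt0.
rewrite mulrC ler_pdivrMr// mulrAC ler_pdivlMr//.
have -> : 2 * B * (Q * B ^+ 2) = 2 * Q * B ^+ 3 by ring.
have := ler_wpM2l (ltW Q0) B3; lra.
Qed.

Lemma prob_stray_site K n i : (i <= n)%N -> (4 * K.+1 <= n)%N ->
  (mu [set w : S | ~~ cone K 0 i (n - i) /\ ray w (southwest i (n - i)) n = 0%R] <=
     (expR (- (stray_rate K * n%:R)))%:E)%E.
Proof.
move=> i_n Kn; set a := i; set b := (n - i)%N.
have nE : n = (a + b)%N by rewrite /a /b; lia.
have [c|nc] := boolP (cone K 0 a b).
  rewrite (_ : [set _ | _] = set0) ?measure0 ?lee_fin ?expR_ge0//.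
  by apply/seteqP; split => // w [].
have mr : measurable [set w : S | ray w (southwest a b) n = 0] by exact: measurable_ray.
apply: (@le_trans _ _ (mu [set w : S | ray w (southwest a b) n = 0])).
  apply: le_measure; rewrite ?inE//; last by move=> w [].
  by have := measurable_stray_site K n i; rewrite /= nc.
have : ~~ ((K * b <= K.+1 * a)%N && (K * a <= K.+1 * b)%N).
  by apply: contra nc => /andP[c1 c2]; rewrite /cone !leq0n c1 c2.
have narrow (u v : nat) : (K.+1 * u < K * v)%N -> n = (u + v)%N -> (u < v.-1)%N.
  move=> huv nuv; rewrite ltnNge; apply/negP => vu.
  have vu1 : (v <= u.+1)%N by lia.
  have := leq_mul (leqnn K) vu1; rewrite mulnS; move: huv Kn; rewrite mulSn nuv; lia.
rewrite negb_and -!ltnNge => /orP[h|h].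
  have b0 : (0 < b)%N by case: (b) h => //; lia.
  have ab := narrow _ _ h nE.
  apply: le_trans (_ : (mu [set w : S | exits_north w (southwest a b) a b.-1] <= _)%E).
    apply: le_measure; rewrite ?inE//; first exact: measurable_exits_north.
    by move=> w /= rE; exists n, a; split => //; rewrite prednK// shift_southwest.
  apply: le_trans (prob_exits_north hmu _ ab) _.
  by rewrite lee_fin ler_expR lerN2 nE; apply: exit_rate_wide => //; rewrite -nE.
have a0 : (0 < a)%N by case: (a) h => //; lia.
have ba := narrow _ _ h (etrans nE (addnC _ _)).
apply: le_trans (_ : (mu [set w : S | exits_east w (southwest a b) a.-1 b] <= _)%E).
  apply: le_measure; rewrite ?inE//; first exact: measurable_exits_east.
  by move=> w /= rE; exists n, b; split => //; rewrite prednK// shift_southwest.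
apply: le_trans (prob_exits_east hmu _ ba) _.
rewrite lee_fin ler_expR lerN2 nE addnC; apply: exit_rate_wide => //.
by rewrite addnC -nE.
Qed.

Lemma prob_stray_small K N (e : R) : 0 < e ->
  exists2 n, (N <= n)%N & (mu (stray K n) <= e%:E)%E.
Proof.
move=> e0; have := stray_rate_gt0 K.
have := @prob_stray_site K; move: (stray_rate K) => c h c0.
pose L := Num.bound (8 / (c ^+ 2 * e)).
have hL : 8 / (c ^+ 2 * e) < L%:R.
  by apply: archi_boundP; rewrite divr_ge0// mulr_ge0 ?exprn_ge0// ltW.
pose n := (N + L + 4 * K.+1)%N.
exists n; first by rewrite /n; lia.
have n1 : 1 <= n%:R :> R by rewrite ler1n /n; lia.
have hn : 8 / (c ^+ 2 * e) <= n%:R.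
  by apply: le_trans (ltW hL) _; rewrite ler_nat /n; lia.
apply: (@le_trans _ _ (\sum_(i <- iota 0 n.+1) expR (- (c * n%:R)))%:E).
  apply: boole_seq => [i|i]; first exact: measurable_stray_site.
  by rewrite mem_iota => /andP[_ hi]; apply: h; rewrite /n; lia.
rewrite lee_fin big_const_seq count_predT iter_addr addr0 size_iota -[leLHS]mulr_natl.
have x0 : 0 < c * n%:R / 2 by rewrite !mulr_gt0// (lt_le_trans ltr01).
(* A quadratic lower bound on the exponential is required, as the union bound has [n.+1] terms. *)
have sq : (c * n%:R / 2) ^+ 2 <= expR (c * n%:R).
  set x := c * n%:R / 2 in x0 *; have -> : c * n%:R = 2 * x by rewrite /x; field.
  rewrite expRM_natl lerXn2r// ?nnegrE ?expR_ge0 ?ltW//.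
  by apply: lt_le_trans (expR_ge1Dx _); lra.
rewrite expRN ler_pdivrMr ?expR_gt0//.
apply: (@le_trans _ _ (e * (c * n%:R / 2) ^+ 2)); last by rewrite ler_pM2l.
move: hn; rewrite ler_pdivrMr ?mulr_gt0 ?exprn_gt0// => hn.
have -> : e * (c * n%:R / 2) ^+ 2 = n%:R * (c ^+ 2 * e) * n%:R / 4 by field.
rewrite -natr1; nra.
Qed.

Lemma ae_not_stray : {ae mu, forall w : S, forall K N, exists2 n, (N <= n)%N & ~ stray K n w}.
Proof.
suff h (KN : nat * nat) : {ae mu, forall w : S, exists2 n, (KN.2 <= n)%N & ~ stray KN.1 n w}.
  by have := ae_count h; move/ae_mp; apply => w H K N; exact: (H (K, N)).
case: KN => K N /=; pose E : set S := \bigcap_n stray K (N + n).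
have mE : measurable E by apply: bigcapT_measurable => n; exact: measurable_stray.
exists E; split => //; last first.
  move=> w /= nh n _; apply: contrapT => ns; apply: nh; exists (N + n)%N => //; exact: leq_addr.
apply/eqP; rewrite -measure_le0; apply/lee_addgt0Pr => e e0; rewrite add0e.
have [n Nn h] := prob_stray_small K N e0; apply: le_trans h.
apply: le_measure; rewrite ?inE//; first exact: measurable_stray.
by move=> w /(_ (n - N)%N I); rewrite subnKC.
Qed.

End Ancestors.

Section NoPast.
Variable R : realType.
Local Notation S := (conf (int * int)%type R).
Implicit Types (w : int * int -> R) (z c : int * int) (a b m n k K N M : nat).

Lemma southwest_south_east a b k : (k <= b)%N ->
  shift (southwest a b) (a + k) (b - k) = south_east 0 k.
Proof. by move=> kb; rewrite /shift /southwest /south_east /=; congr pair; lia. Qed.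

Lemma lp_to_origin w a b : tie_free w -> tie_free (neg w) ->
  lp w (southwest a b) a b = lp (neg w) 0 a b.
Proof. by move=> tf tf'; rewrite lp_reverse// shift_southwest oppr0. Qed.

Lemma lp_to_south_east w a b k : tie_free w -> tie_free (neg w) -> (k <= b)%N ->
  lp w (southwest a b) (a + k) (b - k) = lp (neg w) (north_west 0 k) (a + k) (b - k).
Proof.
move=> tf tf' kb; rewrite lp_reverse// southwest_south_east//; congr (lp _ _ _ _).
by rewrite [LHS]surjective_pairing /south_east /north_west /=; congr pair; lia.
Qed.

(** Unlike in [through_gap], the two far corners vary separately: the south-west one is imposed by
    an ancestor, and the north-east one must be far in terms of it. *)
Definition gap_through w k (p q : nat * nat) : R :=
  lp_gap w 0 k p + lp_gap' (neg w) 0 k q - w 0 + w (south_east 0 k).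

Lemma gap_through_ge0 w a b k : regular w -> tie_free (neg w) -> (k <= b)%N ->
  ray w (southwest a b) (a + b) = 0 ->
  \forall M \near \oo, 0 <= gap_through w k ((M - a)%N, (M - b)%N) (a, b).
Proof.
move=> rw tf' kb rE; have tf := rw.1.
have h : ray w (southwest a b) (a + b) = shift (southwest a b) a b by rewrite shift_southwest.
have [N _ {}h] := lp_ray_through rw h erefl.
exists (N + a + b + k)%N => // M /= hM.
have {}h := h M _; have /h {}h : (N <= M)%N by lia.
have akM : (a + k <= M)%N by lia.
have bkM : (b - k <= M)%N by lia.
have := lp_through (southwest a b) tf akM bkM; rewrite h.
rewrite southwest_south_east// shift_southwest lp_to_origin// lp_to_south_east//.
rewrite /gap_through /lp_gap /lp_gap' /= subnDA.
have -> : (M - b + k = M - (b - k))%N by lia.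
by lra.
Qed.

Lemma gap_through_le0 w a b k : regular w -> tie_free (neg w) -> (k <= b)%N ->
  ray w (southwest a b) (a + b) = south_east 0 k ->
  \forall M \near \oo, gap_through w k ((M - a)%N, (M - b)%N) (a, b) <= 0.
Proof.
move=> rw tf' kb rE; have tf := rw.1.
have h : ray w (southwest a b) (a + b) = shift (southwest a b) (a + k) (b - k).
  by rewrite southwest_south_east.
have hab : (a + k + (b - k) = a + b)%N by lia.
have [N _ {}h] := lp_ray_through rw h hab.
exists (N + a + b + k)%N => // M /= hM.
have {}h := h M _; have /h {}h : (N <= M)%N by lia.
have aM : (a <= M)%N by lia.
have bM : (b <= M)%N by lia.
have := lp_through (southwest a b) tf aM bM; rewrite h.
rewrite southwest_south_east// shift_southwest lp_to_origin// lp_to_south_east//.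
rewrite /gap_through /lp_gap /lp_gap' /= subnDA.
have -> : (M - b + k = M - (b - k))%N by lia.
by lra.
Qed.

Lemma cvg_cones_ball (f : nat * nat -> R) (l e : R) : 0 < e -> f @ cones --> l ->
  cones [set p | `|l - f p| <= e].
Proof. by move=> e0 /cvgrPdist_le /(_ e e0). Qed.

Lemma cone_depth (P : set (nat * nat)) w n0 : cones P ->
  (forall K N, exists2 n, (N <= n)%N & ~ stray K n w) -> has_past w ->
  exists a b, [/\ (n0 <= a)%N, (n0 <= b)%N, P (a, b) & ray w (southwest a b) (a + b) = 0].
Proof.
move=> [K [N h]] ns hp.
(* [K.+1] and not [K]: for [K = 0] the cone would not bound the ratio of the coordinates. The chosen
   depth then makes both of them at least [N + n0]. *)
have [n hn nsn] := ns K.+1 (3 * (N + n0)).+1.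
have [a [b [ab rE]]] := hp n.
have c : cone K.+1 0 a b.
  apply: contrapT => /negP nc; apply: nsn; exists a; first by rewrite mem_iota; lia.
  by have -> : (n - a = b)%N by lia.
have /and4P[_ _ c1 c2] := c.
have ha : (N + n0 <= a)%N by nia.
have hb : (N + n0 <= b)%N by nia.
exists a, b; split; [lia|lia| |by rewrite ab].
apply: h; apply: (@cone_narrow K N K.+1 N) => //; apply/and4P; split => //; lia.
Qed.

(** The gap between the two sites has a nonzero limit [L]. If [L > 0], deep ancestors of [(k, -k)]
    would make the gap nonpositive; if [L < 0], those of [0] would make it nonnegative. *)
Lemma pasts_disjoint w k : (0 < k)%N -> regular w -> tie_free (neg w) ->
  (forall z, cauchy_dif z w) -> (forall z, cauchy_dif z (neg w)) ->
  ~ to0 (through_gap w k) ->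
  (forall K N, exists2 n, (N <= n)%N & ~ stray K n w) ->
  (forall K N, exists2 n, (N <= n)%N & ~ stray K n (translate (south_east 0 k) w)) ->
  has_past w -> ~ has_past (translate (south_east 0 k) w).
Proof.
move=> k0 rw tf' C C' n0 ns ns' hp hp'.
have [B hB] := cvg_lp_gap 0 k C; have [D hD] := cvg_lp_gap' 0 k C'.
pose L := B + D - w 0 + w (south_east 0 k).
have close (e : R) : 0 < e -> exists2 P, cones P & forall p q, P p -> P q ->
    `|L - gap_through w k p q| <= 2 * e.
  move=> e0; exists ([set p | `|B - lp_gap w 0 k p| <= e] `&` [set p | `|D - lp_gap' (neg w) 0 k p| <= e]).
    by apply: filterI; apply: cvg_cones_ball.
  move=> p q [/= + _] [_ /=]; rewrite !ler_norml /L /gap_through => /andP[u1 u2] /andP[u3 u4].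
  by apply/andP; split; lra.
have L0 : L != 0.
  apply/eqP => L0; apply: n0 => m.
  have m0 : 0 < m.+1%:R^-1 / 2 :> R by rewrite divr_gt0 ?invr_gt0.
  have [P [K [N hP]] h] := close _ m0; exists N => n Nn.
  have Pn : P (n, n) by apply/hP/cone_diag.
  have := h _ _ Pn Pn; rewrite L0 sub0r normrN mulrCA mulfV ?mulr1//.
have e0 : 0 < `|L| / 4 by rewrite divr_gt0// normr_gt0.
have [P cP h] := close _ e0.
have near_cone a b : \forall M \near \oo, P ((M - a)%N, (M - b)%N).
  case: cP => K [N hP]; have := cone_diagonal a b K N (diagonal_sequence_nn R).
  by apply: filterS => M [_ _ c]; exact: hP.
have [Lpos|Lneg] := ltP 0 L.
  (* Ancestors are located relative to [(k, -k)], the gap relative to [0]: hence the shifted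
     cone. *)
  have [a [b [ka kb Pab rE]]] := @cone_depth _ _ k.*2 (cones_shift_right k cP) ns' hp'.
  have rE' : ray w (southwest (a - k) (b + k)) (a - k + (b + k)) = south_east 0 k.
    have := ray_translate (south_east 0 k) w (southwest a b) (a + b).
    rewrite rE addr0 => ->; rewrite (_ : (a - k + (b + k) = a + b)%N); last by lia.
    by congr (ray w _ _); rewrite [RHS]surjective_pairing /southwest /=; congr pair; lia.
  have kb' : (k <= b + k)%N by lia.
  have G := gap_through_le0 rw tf' kb' rE'.
  have [N _ H] := filterI G (near_cone (a - k)%N (b + k)%N).
  have [/= g0 PN] := H N (leqnn N).
  have := h _ _ PN Pab; rewrite (gtr0_norm Lpos) ler_norml => /andP[]; lra.
have {}Lneg : L < 0 by rewrite lt_neqAle L0.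
have [a [b [ka kb Pab rE]]] := @cone_depth _ _ k cP ns hp.
have G := gap_through_ge0 rw tf' kb rE.
have [N _ H] := filterI G (near_cone a b).
have [/= g0 PN] := H N (leqnn N).
have := h _ _ PN Pab; rewrite (ltr0_norm Lneg) ler_norml => /andP[]; lra.
Qed.

End NoPast.

(** * Coalescence *)

Section Coalescence.
Variable R : realType.
Local Notation S := (conf (int * int)%type R).
Implicit Types (w : int * int -> R)
  (y z c : int * int)
  (a b i j n k N M : nat)
  (s : seq (int * int)).

Definition diag j : int * int := south_east 0 j.

Lemma diagD j k : diag j + diag k = diag (j + k).
Proof. by rewrite /diag /south_east [LHS]surjective_pairing /=; congr pair; lia. Qed.

Lemma translateD w y z : translate z (translate y w) = translate (y + z) w.
Proof. by apply/funext => u; rewrite /translate addrA. Qed.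

Lemma addr_inj_site y : injective (fun z => y + z).
Proof. exact: addrI. Qed.

Lemma ancestorS w n : ancestor w n.+1 -> ancestor w n.
Proof.
move=> [a [b [ab rE]]].
have rE' : ray w (nx w (southwest a b)) n = 0 by rewrite -rE /ray iterSr.
have [p [q [rs pq]]] := ray_shift w (nx w (southwest a b)) n.
move: rE'; rewrite rs; have [e|e] := nxP w (southwest a b).
  case: a ab rE e rs => [|a] ab rE e rs.
    by rewrite e => -[] /=; lia.
  move=> r0; exists a, b; split; first by lia.
  rewrite -r0 -rs e; congr (ray w _ n).
  by rewrite [RHS]surjective_pairing /southwest /=; congr pair; lia.
case: b ab rE e rs => [|b] ab rE e rs.
  by rewrite e => -[] /=; lia.
move=> r0; exists a, b; split; first by lia.
rewrite -r0 -rs e; congr (ray w _ n).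
by rewrite [RHS]surjective_pairing /southwest /=; congr pair; lia.
Qed.

(** Planarity: on a common level the first coordinates are integers growing by 0 or 1 at each step,
    so rays cannot cross without meeting, and then they coincide. *)
Lemma ray_mono w y y' n : level y = level y' -> y.1 <= y'.1 -> (ray w y n).1 <= (ray w y' n).1.
Proof.
move=> ly yy; elim: n => // n IH; rewrite !rayS.
have := level_ray w y n; have := level_ray w y' n; rewrite -ly.
move: (ray w y n) (ray w y' n) IH => u u' IH l' l.
have [uu|uu] := eqVneq u.1 u'.1.
  suff -> : u = u' by [].
  rewrite [LHS]surjective_pairing [RHS]surjective_pairing uu; congr pair.
  by move: l l'; rewrite /level; lia.
by have [->|->] := nxP w u; have [->|->] := nxP w u' => /=; lia.
Qed.

Definition col w j n : nat := `|(ray w (diag j) n).1|%N.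

Definition site_at n i : int * int := (i%:Z, n%:Z - i%:Z).

Lemma ray_col w j n : ray w (diag j) n = site_at n (col w j n) /\
  (col w j n <= j + n)%N /\ ancestor (translate (site_at n (col w j n)) w) n.
Proof.
have [p [q [rE pq]]] := ray_shift w (diag j) n.
have cE : col w j n = (j + p)%N by rewrite /col rE /shift /=; lia.
have sE : ray w (diag j) n = site_at n (col w j n).
  by rewrite cE rE /shift /site_at /diag /=; congr pair; lia.
split => //; split; first by rewrite cE; lia.
exists p, q; split => //; have := ray_translate (site_at n (col w j n)) w (southwest p q) n.
have -> : site_at n (col w j n) + southwest p q = diag j.
  by rewrite cE [LHS]surjective_pairing /site_at /southwest /diag /south_east /=; congr pair; lia.
by rewrite sE -[RHS]addr0 => /addrI.
Qed.

Lemma col_le w j n : (col w j n <= col w j.+1 n)%N.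
Proof.
have [e _] := ray_col w j n; have [e' _] := ray_col w j.+1 n.
have := @ray_mono w (diag j) (diag j.+1) n; rewrite e e' /site_at /level /diag /=.
move=> h; have : (col w j n)%:Z <= (col w j.+1 n)%:Z by apply: h; lia.
by [].
Qed.

(* Distinct rays sit at distinct sites, each of which has an ancestor. *)
Lemma count_apart w n M :
  (\sum_(0 <= j < M) `[< ray w (diag j) n <> ray w (diag j.+1) n >] <=
   \sum_(0 <= i < M + n) `[< ancestor (translate (site_at n i) w) n >])%N.
Proof.
pose F (c : nat) := (\sum_(0 <= i < c) `[< ancestor (translate (site_at n i) w) n >])%N.
have Fmono (c c' : nat) : (c <= c')%N -> (F c <= F c')%N.
  by move=> cc; rewrite /F [leqRHS](big_cat_nat (leq0n c) cc)/= leq_addr.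
have [_ [cM _]] := ray_col w M n; apply: leq_trans (Fmono _ _ cM).
elim: M {cM} => [|M IH]; first by rewrite big_geq.
rewrite big_nat_recr//=; case: asboolP => [ne|_]; last first.
  by rewrite addn0; apply: leq_trans IH (Fmono _ _ (col_le w M n)).
have [e [_ anc]] := ray_col w M n; have [e' _] := ray_col w M.+1 n.
have lt : (col w M n < col w M.+1 n)%N.
  rewrite ltn_neqAle col_le andbT; apply/eqP => ce.
  by apply: ne; rewrite e e' ce.
apply: leq_trans (Fmono _ _ lt); rewrite /F big_nat_recr//= asboolT//.
by rewrite leq_add2r.
Qed.

Variable mu : probability S R.
Hypothesis hmu : iexp mu (fun w => w) (fun=> 1).

Lemma ae_pasts_disjoint k : (0 < k)%N ->
  {ae mu, forall w : S, has_past w -> ~ has_past (translate (diag k) w)}.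
Proof.
move=> k0.
have oI : injective (fun z : int * int => - z) := oppr_inj.
have h1 := ae_regular hmu; have h1' := reindex_ae hmu oI h1.
have h2 := ae_count (fun z => ae_cauchy_dif hmu z); have h2' := reindex_ae hmu oI h2.
have h3 := ae_through_gap hmu k0.
have h4 := ae_not_stray hmu; have h4' := reindex_ae hmu (@addr_inj_site (diag k)) h4.
have a1 := ae_mp2 h1 h1' (fun w p q => conj p q).
have a2 := ae_mp2 h2 h2' (fun w p q => conj p q).
have a3 := ae_mp2 h4 h4' (fun w p q => conj p q).
have a12 := ae_mp2 a1 a2 (fun w p q => conj p q).
have a33 := ae_mp2 h3 a3 (fun w p q => conj p q).
apply: (ae_mp2 a12 a33) => w [[r r'] [c c']] [g [s s']].
by apply: pasts_disjoint => //; exact: r'.1.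
Qed.

(** The events for the sites [diag j] are equally likely and almost surely pairwise disjoint, so [M]
    of them have total probability at most one, for every [M]. *)
Lemma prob_has_past : mu [set w : S | has_past w] = 0%E.
Proof.
set A := [set w : S | has_past w]; have mA : measurable A := @measurable_has_past R.
pose T j : set S := [set w | A (translate (diag j) w)].
have mT j : measurable (T j) := measurable_reindex (fun z => diag j + z) mA.
have PT j : mu (T j) = mu A := reindex_invariant hmu (@addr_inj_site (diag j)) mA.
have dis : {ae mu, forall w : S, forall i j, (i < j)%N -> T i w -> ~ T j w}.
  have h (ij : nat * nat) : {ae mu, forall w : S, (ij.1 < ij.2)%N -> T ij.1 w -> ~ T ij.2 w}.
    case: ij => i j /=; have [ij|ij] := ltnP i j; last by apply: aeW.
    have d0 : (0 < j - i)%N by rewrite subn_gt0.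
    have := reindex_ae hmu (@addr_inj_site (diag i)) (ae_pasts_disjoint d0).
    move/ae_mp; apply => w h _ Ti; have := h Ti.
    rewrite /T /= -/(translate (diag i) w) translateD diagD subnKC//.
    exact: ltnW.
  by apply: (ae_mp (ae_count h)) => w H i j; exact: (H (i, j)).
pose B M : set S := \bigcup_(j in `I_M) T j.
have mB M : measurable (B M) by apply: bigcup_measurable => j _.
have PB M : (M%:R%:E * mu A <= mu (B M))%E.
  elim: M => [|M IH]; first by rewrite mul0e.
  have -> : B M.+1 = B M `|` (T M `\` B M).
    apply/seteqP; split => w.
      move=> [j /= jM Tj]; have [BM|nBM] := pselect (B M w); first by left.
      right; split => //; move: jM; rewrite ltnS leq_eqVlt => /orP[/eqP <-//|jM].
      by exfalso; apply: nBM; exists j.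
    by move=> [[j /= jM Tj]|[TM _]]; [exists j => //=; exact: ltnW|exists M => /=].
  rewrite measureU//; [|exact: measurableD|by rewrite setDIK].
  rewrite -natr1 EFinD muleDl//; last first.
    by rewrite /= fin_num_measure.
  rewrite mul1e; apply: leeD => //; rewrite -(PT M).
  apply: prob_le_ae => //; first exact: measurableD.
  by apply: (ae_mp dis) => w H TM; split => // -[j /= jM Tj]; exact: H _ _ jM Tj TM.
apply/eqP; rewrite -measure_le0; apply/lee_addgt0Pr => e e0; rewrite add0e.
pose M := (Num.bound e^-1).+1.
have hM : e^-1 <= M%:R.
  have e1 : 0 <= e^-1 by rewrite invr_ge0 ltW.
  by apply: ltW; apply: lt_le_trans (archi_boundP e1) _; rewrite ler_nat.
have fA : mu A \is a fin_num by exact: fin_num_measure.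
have := le_trans (PB M) (probability_le1 mu (mB M)).
rewrite -(fineK fA) -EFinM !lee_fin => h.
have M0 : 0 < M%:R :> R by rewrite ltr0n.
have : ((fine (mu A))%:E <= e%:E)%E.
  rewrite lee_fin -(ler_pM2l M0); apply: (le_trans h).
  by rewrite -ler_pdivrMr// mul1r.
by rewrite (fineK fA).
Qed.

Lemma prob_ancestor_cvg : mu [set w : S | ancestor w n] @[n --> \oo] --> 0%E.
Proof.
have mA n : measurable [set w : S | ancestor w n] := @measurable_ancestor R n.
rewrite -prob_has_past (_ : [set w : S | has_past w] = \bigcap_n [set w : S | ancestor w n]).
  apply: nonincreasing_cvg_mu => //.
  - by rewrite -ge0_fin_numE//; exact: fin_num_measure.
  - exact: bigcapT_measurable.
  - by apply/nonincreasing_seqP => n; apply/subsetPset => w; exact: ancestorS.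
by apply/seteqP; split => w h n; [move=> _; exact: h|exact: (h n I)].
Qed.

End Coalescence.

Lemma prob_sum_le d (T : measurableType d) (R : realType) (mu : probability T R)
    (I J : Type) (r : seq I) (r' : seq J) (A : I -> set T) (B : J -> set T) :
  (forall i, measurable (A i)) -> (forall j, measurable (B j)) ->
  (forall o, \sum_(i <- r) `[< A i o >] <= \sum_(j <- r') `[< B j o >])%N ->
  (\sum_(i <- r) mu (A i) <= \sum_(j <- r') mu (B j))%E.
Proof.
move=> mA mB AB.
have mi K (C : K -> set T) : (forall k, measurable (C k)) ->
    forall k, measurable_fun setT (fun o => (\1_(C k) o)%:E : \bar R).
  by move=> mC k; exact/measurable_EFinP/measurable_indic.
have E K (s : seq K) (C : K -> set T) : (forall k, measurable (C k)) ->
    (\sum_(k <- s) mu (C k) = \int[mu]_o \sum_(k <- s) (\1_(C k) o)%:E)%E.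
  move=> mC; rewrite ge0_integral_sum//; last by move=> k; exact: mi.
  by apply: eq_bigr => k _; rewrite integral_indic// setIT.
have S K (s : seq K) (C : K -> set T) o :
    (\sum_(k <- s) (\1_(C k) o)%:E = (\sum_(k <- s) `[< C k o >])%N%:R%:E :> \bar R)%E.
  rewrite sumEFin natr_sum; congr EFin; apply: eq_bigr => k _.
rewrite !E//; apply: ge0_le_integral => //.
- by move=> o _; apply: sume_ge0 => i _; rewrite lee_fin.
- by apply: emeasurable_sum => i; exact: mi.
- by apply: emeasurable_sum => i; exact: mi.
by move=> o _; rewrite !S lee_fin ler_nat.
Qed.

Section Meeting.
Variable R : realType.
Local Notation S := (conf (int * int)%type R).
Implicit Types (w : int * int -> R) (y V z x : int * int) (a i j n k N M : nat).

Variable mu : probability S R.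
Hypothesis hmu : iexp mu (fun w => w) (fun=> 1).

Definition apart n : set S := [set w | ray w (diag 0) n <> ray w (diag 1) n].

Lemma measurable_apart n : measurable (apart n).
Proof.
rewrite (_ : apart n = ~` \bigcup_(z in [set: int * int])
    ([set w : S | ray w (diag 0) n = z] `&` [set w : S | ray w (diag 1) n = z])).
  apply: measurableC; apply: countable_bigcupT_measurable => [|z]; first exact: countableP.
  by apply: measurableI; exact: measurable_ray.
apply/seteqP; split => w /=; first by move=> h [z _ [/= e1 e2]]; apply: h; rewrite e1 e2.
by move=> h e; apply: h; exists (ray w (diag 0) n).
Qed.

Lemma apart_translate w j n : apart n (translate (diag j) w) <->
  ray w (diag j) n <> ray w (diag j.+1) n.
Proof.
have e1 := ray_translate (diag j) w (diag 0) n; have e2 := ray_translate (diag j) w (diag 1) n.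
rewrite diagD addn0 in e1; rewrite diagD addn1 in e2.
by rewrite -e1 -e2 /apart /=; split => h e; apply: h; [exact: addrI e|rewrite e].
Qed.

(** Expectations in [count_apart], with translation invariance, give
    [M * P(apart) <= (M + n) * P(ancestor)]; the boundary term [n] disappears after division by
    [M]. *)
Lemma prob_apart n : (mu (apart n) <= mu [set w : S | ancestor w n])%E.
Proof.
set A := [set w : S | ancestor w n]; have mA : measurable A := @measurable_ancestor R n.
have mP := measurable_apart n.
have key M : (M%:R%:E * mu (apart n) <= (M + n)%:R%:E * mu A)%E.
  pose U j : set S := [set w | apart n (translate (diag j) w)].
  pose V i : set S := [set w | A (translate (site_at n i) w)].
  have mU j : measurable (U j) := measurable_reindex (fun z => diag j + z) mP.
  have mV i : measurable (V i) := measurable_reindex (fun z => site_at n i + z) mA.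
  have PU j : mu (U j) = mu (apart n) := reindex_invariant hmu (@addr_inj_site (diag j)) mP.
  have PV i : mu (V i) = mu A := reindex_invariant hmu (@addr_inj_site (site_at n i)) mA.
  have := @prob_sum_le _ _ _ mu _ _ (index_iota 0 M) (index_iota 0 (M + n)) U V mU mV.
  rewrite (eq_bigr _ (fun j _ => PU j)) (eq_bigr _ (fun j _ => PV j)).
  rewrite !sumr_const_nat !subn0 !mule_natl; apply => w.
  have := count_apart w n M; congr (_ <= _)%N; apply: eq_bigr => j _.
  by congr nat_of_bool; apply/asboolP/asboolP => /apart_translate.
have fA : mu A \is a fin_num by exact: fin_num_measure.
have fP : mu (apart n) \is a fin_num by exact: fin_num_measure.
have pA : fine (mu A) <= 1.
  by rewrite -lee_fin fineK//; exact: probability_le1.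
have {}key M : M%:R * fine (mu (apart n)) <= (M + n)%:R * fine (mu A).
  by rewrite -lee_fin !EFinM (fineK fA) (fineK fP).
suff : ((fine (mu (apart n)))%:E <= (fine (mu A))%:E)%E by rewrite (fineK fA) (fineK fP).
rewrite lee_fin; apply/ler_addgt0Pr => e e0.
pose M := (Num.bound (n%:R / e)).+1.
have M0 : 0 < M%:R :> R by rewrite ltr0n.
rewrite -(ler_pM2l M0); apply: (le_trans (key M)).
rewrite natrD mulrDl mulrDr lerD2l.
apply: (@le_trans _ _ n%:R); first by rewrite ler_piMr.
rewrite -ler_pdivrMr//.
have n0 : 0 <= n%:R / e by rewrite divr_ge0// ltW.
by apply: ltW; apply: lt_le_trans (archi_boundP n0) _; rewrite ler_nat.
Qed.

Definition meet w y y' := exists n, ray w y n = ray w y' n.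

Lemma meet_trans w x y z : meet w x y -> meet w y z -> meet w x z.
Proof.
move=> [n h] [n' h']; exists (n + n')%N.
by rewrite [LHS]ray_add h -ray_add addnC ray_add h' -ray_add addnC.
Qed.

Lemma ae_meet_adjacent : {ae mu, forall w : S, meet w (diag 0) (diag 1)}.
Proof.
pose E : set S := \bigcap_n apart n.
have mE : measurable E by apply: bigcapT_measurable => n; exact: measurable_apart.
exists E; split => //; last first.
  by move=> w /= nm n _ h; apply: nm; exists n.
apply/eqP; rewrite -measure_le0.
rewrite -(cvg_lim _ (prob_ancestor_cvg hmu))//; apply: lime_ge.
  by apply/cvg_ex; exists 0%E; exact: prob_ancestor_cvg.
apply: nearW => n; apply: le_trans (prob_apart n).
by apply: le_measure; rewrite ?inE//; [exact: measurable_apart|move=> w; apply].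
Qed.

Lemma ae_meet : {ae mu, forall w : S, forall z k, meet w z (z + diag k)}.
Proof.
have h z : {ae mu, forall w : S, meet w z (z + diag 1)}.
  apply: (ae_mp (reindex_ae hmu (@addr_inj_site z) ae_meet_adjacent)) => w [n rn].
  exists n; have e1 := ray_translate z w (diag 0) n; have e2 := ray_translate z w (diag 1) n.
  have d0 : diag 0 = 0 by rewrite [LHS]surjective_pairing [RHS]surjective_pairing /diag /=; congr pair; lia.
  by rewrite d0 addr0 in e1; rewrite -e1 -e2; congr (_ + _); rewrite -d0.
apply: (ae_mp (ae_count h)) => w H z; elim => [|k IH].
  exists 0%N; rewrite /ray /=.
  by rewrite [LHS]surjective_pairing [RHS]surjective_pairing /=; congr pair; lia.
by apply: meet_trans IH _; rewrite -addn1 -diagD addrA; exact: H.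
Qed.

End Meeting.

(** * Height of the coalescence point *)

Section Height.
Variable R : realType.
Local Notation S := (conf (int * int)%type R).
Implicit Types (w : int * int -> R) (y x : int * int) (a i m n k N : nat).

(* The ray from (0, m) leaves the box [.., n]^2 through its northern side and
   the ray from (m, 0) through its eastern side, so they do not meet inside. *)
Lemma coalescence_time_gt w m n : regular w -> (m <= n)%N ->
  meet w (0, m%:Z) (m%:Z, 0) ->
  ~ exits_north w (m%:Z, 0) (n - m) n -> ~ exits_east w (0, m%:Z) n (n - m) ->
  n%:Z < coalescence_time w m.
Proof.
move=> rw mn [k0 rk0] nN nE; set x : int * int := (m%:Z, 0); set y : int * int := (0, m%:Z).
have lxy : level x = level y by rewrite /level /= addr0 add0r.
have [k cE rk] : exists2 k, coalescence_point w x y = ray w x k & ray w x k = ray w y k.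
  by apply: coalescence_point_meet => //; exists k0.
rewrite /coalescence_time -/x -/y cE ltNge; apply/negP => ck.
(* The absence of an eastern exit, read along the whole ray: while its second coordinate is at most
   [n], so is the first. [C2] is the counterpart for the ray from [(m, 0)]. *)
have C1 i : (ray w y i).2 <= n%:Z -> (ray w y i).1 <= n%:Z.
  elim: i => [|i IH] //; rewrite rayS; have [p [q [rE pq]]] := ray_shift w y i.
  have [e|e] := nxP w (ray w y i); rewrite e => /=; rewrite ?addr0 => h; last by apply: IH; lia.
  have {}IH := IH h; rewrite leNgt; apply/negP => gt; apply: nE.
  exists i.+1, q; rewrite rayS e rE shift_add1; move: h IH gt; rewrite rE /shift /= => h IH gt.
  by split; [lia|congr pair; lia].
have C2 i : (ray w x i).1 <= n%:Z -> (ray w x i).2 <= n%:Z.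
  elim: i => [|i IH] //; rewrite rayS; have [p [q [rE pq]]] := ray_shift w x i.
  have [e|e] := nxP w (ray w x i); rewrite e => /=; rewrite ?addr0 => h; first by apply: IH; lia.
  have {}IH := IH h; rewrite leNgt; apply/negP => gt; apply: nN.
  exists i.+1, p; rewrite rayS e rE shift_add2; move: h IH gt; rewrite rE /shift /= => h IH gt.
  by split; [lia|congr pair; lia].
have same i : ray w x (k + i) = ray w y (k + i) by rewrite !ray_add rk.
(* From the meeting on, the common ray obeys both constraints: a step east keeps the second
   coordinate and [C1] applies, a step north keeps the first and [C2] applies. It would never leave
   the box, although its level grows. *)
have inside i : (ray w x (k + i)).1 <= n%:Z /\ (ray w x (k + i)).2 <= n%:Z.
  elim: i => [|i [h1 h2]].
    by rewrite addn0; split => //; rewrite rk; apply: C1; rewrite -rk.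
  rewrite addnS; have [e|e] := nxP w (ray w x (k + i)).
    have h : (ray w x (k + i).+1).2 <= n%:Z by rewrite rayS e /= addr0.
    by split => //; move: h; rewrite -addnS same; exact: C1.
  have h : (ray w x (k + i).+1).1 <= n%:Z by rewrite rayS e /= addr0.
  by split => //; exact: C2.
have [h1 h2] := inside (2 * n).+1.
by have := level_ray w x (k + (2 * n).+1); rewrite /level /=; lia.
Qed.

Variable mu : probability S R.
Hypothesis hmu : iexp mu (fun w => w) (fun=> 1).

Definition apart_at m n : set S :=
  ~` ([set w : S | exits_north w (m%:Z, 0) (n - m) n] `|`
      [set w : S | exits_east w (0, m%:Z) n (n - m)]).

Lemma measurable_apart_at m n : measurable (apart_at m n).
Proof.
by apply: measurableC; apply: measurableU; [exact: measurable_exits_north|exact: measurable_exits_east].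
Qed.

Lemma prob_apart_at m n : (0 < m <= n)%N ->
  ((1 - 2 * (2304 * n.+1%:R ^+ 2 / m%:R ^+ 3))%:E <= mu (apart_at m n))%E.
Proof.
move=> /andP[m0 mn].
have nm : (n - m < n)%N by lia.
have p1 := prob_exits_north hmu (m%:Z, 0) nm.
have p2 := prob_exits_east hmu (0, m%:Z) nm.
set A := [set w | exits_north _ _ _ _] in p1 *; set B := [set w | exits_east _ _ _ _] in p2 *.
have mA : measurable A := @measurable_exits_north R _ _ _.
have mB : measurable B := @measurable_exits_east R _ _ _.
have mAB : measurable (A `|` B) by exact: measurableU.
rewrite /apart_at -/A -/B probability_setC//.
have le1 : expR (- exit_rate R (n - m) n) <= 2304 * n.+1%:R ^+ 2 / m%:R ^+ 3.
  rewrite /exit_rate subKn//; have Q0 : 0 < 2304 :> R by rewrite ltr0n.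
  move: (2304 : R) Q0 => Q Q0.
  have m3 : 0 < m%:R ^+ 3 :> R by rewrite exprn_gt0// ltr0n.
  have n2 : 0 < Q * n.+1%:R ^+ 2 by rewrite mulr_gt0// exprn_gt0.
  rewrite expRN -[leRHS]invrK invf_div lef_pV2 ?posrE ?expR_gt0 ?divr_gt0//.
  by apply: le_trans (expR_ge1Dx _); rewrite lerDr.
have fAB : mu (A `|` B) \is a fin_num by exact: fin_num_measure.
have : (mu (A `|` B) <= (2 * (2304 * n.+1%:R ^+ 2 / m%:R ^+ 3))%:E)%E.
  apply: le_trans (measureU2 _ mA mB) _; rewrite mulr2n mulrDl mul1r EFinD.
  by apply: leeD; [apply: le_trans p1 _|apply: le_trans p2 _]; rewrite lee_fin.
rewrite -(fineK fAB) -EFinB !lee_fin => h; lra.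
Qed.

End Height.

Lemma limn_einf_ge (R : realType) (u : (\bar R)^nat) (l : R) (e : R^nat) :
  e @ \oo --> (0 : R) -> (forall n, (0 < n)%N -> ((l - e n)%:E <= u n)%E) ->
  (l%:E <= limn_einf u)%E.
Proof.
move=> e0 h; pose v n : \bar R := (l - e n)%:E.
have vl : v @ \oo --> l%:E.
  apply/fine_cvgP; split; first by apply: nearW.
  by rewrite -[X in _ --> X]subr0; apply: cvgB => //; exact: cvg_cst.
rewrite -(cvg_limn_einf_sup vl).1 !limn_einf_lim; apply: lee_lim.
- exact: is_cvg_einfs.
- exact: is_cvg_einfs.
exists 1%N => // n /= n0; apply: le_ereal_inf_tmp => _ [k /= nk <-].
apply: le_trans (h k (leq_trans n0 nk)); apply: ereal_inf_lbound.
by exists k.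
Qed.

(** * From the given probability space to the law of the weights *)

Section Transfer.
Variable R : realType.
Local Notation S := (conf (int * int)%type R).
Context d (Omega : measurableType d) (P : probability Omega R).
Variables (W : site -> {RV P >-> R}) (T : nat -> {RV P >-> R}).
Hypothesis W_iid : iid_exponential W.
Hypothesis T_coalescence : forall m : nat, (1 <= m)%N ->
  {ae P, forall o, T m o = (coalescence_time (fun x => W x o) m)%:~R}.

Let weights (o : Omega) : S := fun x => W x o.

Lemma measurable_weights : measurable_fun setT weights.
Proof. by apply: measurable_to_conf => z; exact: measurable_funP. Qed.

Let mu : probability S R := law P measurable_weights.

Lemma iexp_weights : iexp mu (fun w => w) (fun=> 1).
Proof.
split; first exact: measurable_id.
move=> J B uJ mB; have [ind lawW] := W_iid.
have e : weights @^-1` box J B = \bigcap_(i in [set` J]) (W i @^-1` B i).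
  by apply/seteqP; split => o h i /=; exact: h.
apply: etrans (_ : P (weights @^-1` box J B) = _); first by [].
rewrite e (ind J B uJ mB); apply: eq_bigr => i _.
rewrite (expo_exponential_prob (@ltr01 R) (mB i)).
exact: (lawW i (B i) (mB i)).
Qed.

Lemma ae_weights (Q : S -> Prop) : {ae mu, forall w, Q w} -> {ae P, forall o, Q (weights o)}.
Proof.
move=> [N [mN N0 h]]; exists (weights @^-1` N); split.
- by rewrite -[X in measurable X]setTI; exact: measurable_weights.
- exact: N0.
- by move=> o /= nQ; exact: h.
Qed.

Definition scale_at m : R := 2 `^ (- (5 / 2)) * m%:R `^ (3 / 2).

Lemma scale_at_gt0 m : (0 < m)%N -> 0 < scale_at m.
Proof. by move=> m0; rewrite mulr_gt0 ?powR_gt0// ltr0n. Qed.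

Lemma scale_at_sqr m : scale_at m ^+ 2 = m%:R ^+ 3 / 32.
Proof.
rewrite /scale_at exprMn mulrC -!powR_mulrn ?powR_ge0// -!powRrM.
have -> : 3 / 2 * 2%:R = 3%:R :> R by field.
have -> : - (5 / 2) * 2%:R = - 5%:R :> R by field.
rewrite powRN !powR_mulrn//; congr (_ / _).
by rewrite -natrX.
Qed.

Lemma measurable_T_gt m (r : R) : measurable [set o | (r < T m o / scale_at m)%R].
Proof.
rewrite -[X in measurable X]setTI; apply: measurable_fun_ltr => //.
by apply: measurable_funM => //; exact: measurable_funP.
Qed.

Lemma prob_T_gt m n (r : R) : (0 < m <= n)%N -> r * scale_at m < n.+1%:R ->
  ((1 - 2 * (2304 * n.+1%:R ^+ 2 / m%:R ^+ 3))%:E <=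
   P [set o | (r < T m o / scale_at m)%R])%E.
Proof.
move=> mn rn; have /andP[m0 mn'] := mn.
apply: le_trans (prob_apart_at iexp_weights mn) _.
rewrite -[X in (X <= _)%E]/(P (weights @^-1` @apart_at R m n)).
apply: prob_le_ae.
- by rewrite -[X in measurable X]setTI; apply: measurable_weights => //; exact: measurable_apart_at.
- exact: measurable_T_gt.
have h1 := ae_weights (ae_regular iexp_weights).
have h2 := ae_weights (ae_meet iexp_weights).
have h12 := ae_mp2 h1 h2 (fun _ p q => conj p q).
apply: (ae_mp2 (T_coalescence m0) h12) => o TE [rw mt] Eo /=.
have gt : n%:Z < coalescence_time (weights o) m.
  apply: coalescence_time_gt => //.
  - have := mt (0, m%:Z) m; congr meet.
    by rewrite [LHS]surjective_pairing /diag /south_east /=; congr pair; lia.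
  - by move=> h; apply: Eo; left.
  - by move=> h; apply: Eo; right.
rewrite ltr_pdivlMr ?scale_at_gt0// TE; apply: (lt_le_trans rn).
(* The coalescence time is an integer, so exceeding [n] means reaching [n + 1]. *)
have : n.+1%:Z <= coalescence_time (weights o) m by lia.
by rewrite -(ler_int R) -pmulrn.
Qed.

Lemma prob_T_lower m (r : R) : (0 < m)%N -> 0 <= r ->
  ((1 - 2304 / 8 * r ^+ 2 - 2304 * 32 / m.+1%:R)%:E <=
   P [set o | (r < T m o / scale_at m)%R])%E.
Proof.
move=> m0 r0; set th := r * scale_at m.
have th0 : 0 <= th by rewrite mulr_ge0// ltW// scale_at_gt0.
have /andP[t1 t2] := truncn_itv th0.
(* The maximum ensures [m <= n], as the boxes require, even when [r] is small or zero; the resulting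
   error is of order [1 / m] and vanishes in the lower limit. *)
pose n := maxn (Num.truncn th) m.
have mn : (0 < m <= n)%N by rewrite m0 leq_maxr.
have thn : th < n.+1%:R by apply: (lt_le_trans t2); rewrite ler_nat ltnS leq_maxl.
apply: le_trans (prob_T_gt mn thn); rewrite lee_fin.
have m1 : 1 <= m%:R :> R by rewrite ler1n.
have n1 : n.+1%:R <= th + 2 * m%:R.
  have nm : n%:R <= (Num.truncn th)%:R + m%:R :> R by rewrite -natrD ler_nat /n; lia.
  by rewrite -natr1; lra.
have n0 : 0 <= n.+1%:R :> R by rewrite ler0n.
have mp : 0 < m%:R :> R by rewrite ltr0n.
have m3 : 0 < m%:R ^+ 3 :> R by rewrite exprn_gt0.
have thE : th ^+ 2 = r ^+ 2 * m%:R ^+ 3 / 32 by rewrite /th exprMn scale_at_sqr mulrA.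
have sq : n.+1%:R ^+ 2 <= 2 * th ^+ 2 + 8 * m%:R ^+ 2 :> R.
  have s1 : n.+1%:R ^+ 2 <= (th + 2 * m%:R) ^+ 2 by rewrite lerXn2r// nnegrE (le_trans n0).
  apply: (le_trans s1); rewrite -subr_ge0.
  by rewrite (_ : _ - _ = (th - 2 * m%:R) ^+ 2) ?sqr_ge0//; ring.
(* Here 16 is 32, from the squared scale, over the 2 of [sq]; the two exit events halve it again,
   whence [2304 / 8]. *)
have key : n.+1%:R ^+ 2 / m%:R ^+ 3 <= r ^+ 2 / 16 + 8 / m%:R :> R.
  rewrite ler_pdivrMr// mulrDl.
  have -> : 8 / m%:R * m%:R ^+ 3 = 8 * m%:R ^+ 2 :> R by field; lra.
  by apply: (le_trans sq); rewrite thE; lra.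
have h8 : 8 / m%:R <= 16 / m.+1%:R :> R.
  rewrite ler_pdivrMr// mulrAC ler_pdivlMr ?ltr0n// -natr1; lra.
have Q0 : 0 <= 2304 :> R by rewrite ler0n.
move: (2304 : R) Q0 => Q Q0; rewrite -[Q * n.+1%:R ^+ 2 / _]mulrA.
have := ler_wpM2l Q0 (le_trans key (lerD (lexx _) h8)).
move: (n.+1%:R ^+ 2 / m%:R ^+ 3) (m.+1%:R^-1 : R) => u v; lra.
Qed.

Lemma error_cvg0 : (fun m => 2304 * 32 / m.+1%:R : R) @ \oo --> (0 : R).
Proof.
rewrite -[X in _ --> X](mulr0 (2304 * 32 : R)); apply: cvgMr.
exact: cvg_harmonic.
Qed.

Lemma liminf_tail_ge (r : R) : 0 <= r -> ((1 - 2304 / 8 * r ^+ 2)%:E <= liminf_tail T r)%E.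
Proof.
move=> r0; apply: (@limn_einf_ge _ _ _ (fun m => 2304 * 32 / m.+1%:R)); first exact: error_cvg0.
by move=> m m0; exact: prob_T_lower.
Qed.

Lemma liminf_tail_le1 (r : R) : (liminf_tail T r <= 1)%E.
Proof.
rewrite /liminf_tail limn_einf_lim; apply: lime_le; first exact: is_cvg_einfs.
apply: nearW => n; apply: le_trans (ereal_inf_lbound _) _; first by exists n => /=.
by apply: probability_le1; exact: measurable_T_gt.
Qed.

(** The limit in the theorem is two-sided. For [r < 0] the event contains the one for [r = 0], whose
    bound has no quadratic term. *)
Lemma liminf_tail_neg (r : R) : r < 0 -> (1 <= liminf_tail T r)%E.
Proof.
move=> r0; apply: (@limn_einf_ge _ _ 1 (fun m => 2304 * 32 / m.+1%:R)); first exact: error_cvg0.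
move=> m m0; have := prob_T_lower m0 (lexx 0); rewrite expr0n mulr0 subr0 => h.
apply: (le_trans h); apply: le_measure; rewrite ?inE; [exact: measurable_T_gt|exact: measurable_T_gt|].
by move=> o /=; exact: lt_trans.
Qed.

End Transfer.

Theorem theorem2 (R : realType) (d : measure_display) (Omega : measurableType d)
    (P : probability Omega R) (W : site -> {RV P >-> R})
    (T : nat -> {RV P >-> R})
    (W_iid : iid_exponential W)
    (T_coalescence : forall m : nat, (1 <= m)%N ->
       {ae P, forall o, T m o = (coalescence_time (fun x => W x o) m)%:~R}) :
  (exists c0 r0 : R,
     [/\ 0 < c0, 0 < r0 &
         forall r : R, 0 <= r <= r0 ->
           ((1 - c0 * r ^+ 2)%:E <= liminf_tail T r)%E]) /\
  liminf_tail T r @[r --> 0^'] --> 1%E.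
Proof.
have ge := liminf_tail_ge W_iid T_coalescence.
have lt0 := liminf_tail_neg W_iid T_coalescence.
have : 0 < 2304 / 8 :> R by apply: divr_gt0; rewrite ltr0n.
move: (2304 / 8 : R) ge => c ge c0; split.
  (* The quadratic bound holds for all [r >= 0], so [r0 = 1] is an arbitrary choice. *)
  by exists c, 1; split; [exact: c0|exact: ltr01|move=> r /andP[r0 _]; exact: ge].
apply: (@squeeze_cvge _ _ _ _ (fun r : R => (1 - c * r ^+ 2)%:E) _ (fun=> 1%E)).
- apply: nearW => r; rewrite liminf_tail_le1 andbT.
  have [r0|r0] := leP 0 r; first exact: ge.
  apply: le_trans (lt0 _ r0); rewrite lee_fin gerBl mulr_ge0 ?exprn_even_ge0//.
  exact: ltW.
- apply/fine_cvgP; split; first by apply: nearW.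
  apply: cvg_within_filter; have {2}<- : 1 - c * 0 ^+ 2 = 1 :> R by rewrite expr0n mulr0 subr0.
  apply: cvgB; first exact: cvg_cst.
  by apply: cvgMr; exact: exprn_continuous.
exact: cvg_cst.
Qed.
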